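(* Define the map $$\iota:\mathrm{ARI}^{\mathrm{pol}}_{\underline{al}*\underline{il}}\to \mathrm{BARI}^{\mathrm{pol}}_{\underline{il},swap},\qquad A\mapsto A+swap(A)+C_A,$$ where $C_A$ denotes the constant mould (with zero depth $1$ component) such that $swap(A)+C_A$ is alternil. Then for all $A,B\in \mathrm{ARI}^{\mathrm{pol}}_{\underline{al}*\underline{il}}$ we have $$\iota\big(ari(A,B)\big)=uri\big(\iota(A),\iota(B)\big).$$ In particular, $\big(\iota(\mathrm{ARI}^{\mathrm{pol}}_{\underline{al}*\underline{il}}),uri\big)$ is a Lie algebra.
   Context: **Bimoulds.** Fix a commutative $\mathbb{Q}$-algebra $R$. A bimould is a sequence $M=(M_d)_{d\ge 0}$, where $M_d=M_d\binom{u_1,\ldots,u_d}{v_1,\ldots,v_d}$ lies in $R[u_1,v_1,\ldots,u_d,v_d]$ (polynomial bimould) or in the ring of rational functions $R(u_1,v_1,\ldots,u_d,v_d)$ (rational bimould). The index $d$ is often omitted, $M(\emptyset)=M_0$, $w_i=\binom{u_i}{v_i}$ and $w=(w_1,\ldots,w_d)$. $\mathrm{BARI}^{\mathrm{pol}}$ is the space of polynomial bimoulds with $M_0=0$ and only finitely many nonzero components; $\mathrm{BARI}^{\mathrm{rat}}$ is the space of rational bimoulds with $M_0=0$. $\mathrm{ARI}^{\mathrm{pol}}\subset \mathrm{BARI}^{\mathrm{pol}}$ is the subspace of moulds, i.e. of bimoulds not depending on the variables $v_i$. A constant mould is a mould $C$ with $C_0=0$ and $C_d\in R$ for all $d$.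 **Swap.** $swap(M)\binom{u_1,\ldots,u_d}{v_1,\ldots,v_d}=M\binom{v_d,\,v_{d-1}-v_d,\ldots,\,v_1-v_2}{u_1+\cdots+u_d,\,u_1+\cdots+u_{d-1},\ldots,\,u_1}$; $M$ is swap invariant if $swap(M)=M$. **Alternal, alternil.** Consider words in letters $\binom{a}{b}$, where $a,b$ are linear forms in the $u$- resp. $v$-variables, and define products on linear combinations of words recursively by $1*x=x*1=x$, $1\sqcup\!\sqcup x=x\sqcup\!\sqcup 1=x$ and, for letters $\binom{a}{b},\binom{a'}{b'}$ and words $x,y$, $$\tbinom{a}{b}x\sqcup\!\sqcup\tbinom{a'}{b'}y=\tbinom{a}{b}\big(x\sqcup\!\sqcup\tbinom{a'}{b'}y\big)+\tbinom{a'}{b'}\big(\tbinom{a}{b}x\sqcup\!\sqcup y\big),$$ $$\tbinom{a}{b}x*\tbinom{a'}{b'}y=\tbinom{a}{b}\big(x*\tbinom{a'}{b'}y\big)+\tbinom{a'}{b'}\big(\tbinom{a}{b}x*y\big)+\tfrac{1}{b-b'}\Big(\tbinom{a+a'}{b}-\tbinom{a+a'}{b'}\Big)(x*y).$$ Extend $M$ linearly (over rational functions) to linear combinations of words. $M$ (with $M_0=0$) is alternal, resp. alternil, if for all $0<n<d$ the value of $M$ on $w_1\cdots w_n\sqcup\!\sqcup w_{n+1}\cdots w_d$, resp. on $w_1\cdots w_n*w_{n+1}\cdots w_d$, is $0$. For polynomial bimoulds, writing $M_d=\sum \varphi(y_{k_1,m_1}\cdots y_{k_d,m_d})\frac{u_1^{m_1}}{m_1!}v_1^{k_1-1}\cdots\frac{u_d^{m_d}}{m_d!}v_d^{k_d-1}$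 (sum over $k_i\ge1$, $m_i\ge0$), this means that $\varphi$ vanishes on all shuffle products, resp. all stuffle products (quasi-shuffle with $y_{k_1,m_1}\diamond y_{k_2,m_2}=y_{k_1+k_2,m_1+m_2}$), of two nonempty words in the letters $y_{k,m}$. **Spaces.** $\mathrm{ARI}^{\mathrm{pol}}_{\underline{al}*\underline{il}}$ is the space of alternal $A\in\mathrm{ARI}^{\mathrm{pol}}$ such that $swap(A)+C_A$ is alternil for some constant mould $C_A$ and such that $A_1$ is an even polynomial with zero constant term. $\mathrm{BARI}^{\mathrm{pol}}_{\underline{il},swap}$ is the space of alternil, swap invariant $A\in \mathrm{BARI}^{\mathrm{pol}}$ with $A_1$ even, i.e. $A_1\binom{-u_1}{-v_1}=A_1\binom{u_1}{v_1}$. **Flexions.** For consecutive blocks $w=\cdots abc\cdots$ define: $\lceil c$ is $c$ with the sum of all $u$'s of the block $b$ immediately before it added to the first $u$ of $c$; $a\rceil$ is $a$ with the sum of all $u$'s of the block $b$ immediately after it added to the last $u$ of $a$; $b\rfloor$ is $b$ with the first $v$ of the block $c$ immediately after it subtracted from every $v$ of $b$; $\lfloor b$ is $b$ with the last $v$ of the block $a$ immediately before it subtracted from every $v$ of $b$. If the relevant neighbouring block is empty, nothing is changed. **Products and brackets.** $mu(A,B)(w_1,\ldots,w_d)=\sum_{j=0}^d A(w_1,\ldots,w_j)B(w_{j+1},\ldots,w_d)$, $lu(A,B)=mu(A,B)-mu(B,A)$, $$arit(B)(A)(w)=\sum_{w=abc,\ b,c\ne\emptyset}A(a\lceil c)B(b\rfloor)-\sum_{w=abc,\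 a,b\neq\emptyset}A(a\rceil c)B(\lfloor b),$$ $$ari(A,B)=arit(B)(A)-arit(A)(B)+lu(A,B).$$ **ganit and uri.** For a rational bimould $B$ with $B_0=1$ set $$ganit_B(A)(w)=\sum_{w=b_1c_1\cdots b_sc_s}A(b_1\rceil\cdots b_s\rceil)B(\lfloor c_1)\cdots B(\lfloor c_s),$$ the sum being over all decompositions in which only $c_s$ may be empty (here $b_i\rceil$ refers to the block $c_i$ following it and $\lfloor c_i$ to the block $b_i$ preceding it). Let $pic,poc$ have depth $0$ component $1$ and, for $r\ge 1$, $$pic\binom{u_1,\ldots,u_r}{v_1,\ldots,v_r}=\frac1{v_1\cdots v_r},\qquad poc\binom{u_1,\ldots,u_r}{v_1,\ldots,v_r}=-\frac1{v_1(v_1-v_2)\cdots(v_{r-1}-v_r)}.$$ For $A,B\in \mathrm{BARI}^{\mathrm{rat}}$ define $uri(A,B)=ganit_{pic}\big(ari(ganit_{poc}(A),ganit_{poc}(B))\big)$. *)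

(* Defs.v *)
From HB Require Import structures.
From mathcomp Require Import all_boot all_order all_algebra generic_quotient.
From mathcomp Require Import boolp classical_sets.
From mathcomp Require Import mpoly ring.

Set Implicit Arguments.
Unset Strict Implicit.
Unset Printing Implicit Defensive.

Import GRing.Theory.
Local Open Scope ring_scope.
Local Open Scope quotient_scope.

(* Total ring of fractions A[S^-1], S the set of non-zero-divisors of A.
   The library only has fraction fields of integral domains ({fraction A}),
   whereas the coefficient ring of bimoulds may have zero divisors; the
   construction follows mathcomp.algebra.fraction with "nonzero" replaced by
   "regular".  *)

Module TotFrac.
Section TotFrac.
Variable A : comNzRingType.

Definition regular (x : A) : bool := `[< GRing.lreg x >].

Lemma regularP x : reflect (GRing.lreg x) (regular x).
Proof. exact: asboolP. Qed.

Lemma regular1 : regular 1.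
Proof. by apply/regularP; apply: lreg1. Qed.

Lemma regularM x y : regular x -> regular y -> regular (x * y).
Proof. by move=> /regularP hx /regularP hy; apply/regularP; apply: lregM. Qed.

Lemma regularMl x y : regular (x * y) -> regular x.
Proof.
move=> /regularP h; apply/regularP => a b /= eab; apply: h.
by rewrite /= [x * y]mulrC -!mulrA eab.
Qed.

Inductive ratio := mkRatio { frac :> A * A; _ : regular frac.2 }.
HB.instance Definition _ := [isSub for frac].
HB.instance Definition _ := [Choice of ratio by <:].

Implicit Types x y z : ratio.

Lemma denP x : regular x.2. Proof. by case: x. Qed.
Hint Resolve denP : core.

Definition equivf x y := x.1 * y.2 == x.2 * y.1.

Lemma equivf_refl : reflexive equivf.
Proof. by move=> x; rewrite /equivf mulrC. Qed.

Lemma equivf_sym : ssrbool.symmetric equivf.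
Proof.
by move=> x y; rewrite /equivf eq_sym; congr (_ == _); rewrite mulrC.
Qed.

Lemma equivf_trans : transitive equivf.
Proof.
move=> [y Py] [x Px] [z Pz]; rewrite /equivf /= => /eqP xy /eqP yz.
apply/eqP/(regularP _ Py).
by rewrite /= mulrCA mulrA xy -mulrA yz mulrCA.
Qed.

Canonical equivf_equiv := EquivRel equivf equivf_refl equivf_sym equivf_trans.

Definition type := {eq_quot equivf}.
HB.instance Definition _ : EqQuotient _ equivf type := EqQuotient.on type.
HB.instance Definition _ := Choice.on type.

Lemma piP x y : reflect (x.1 * y.2 = x.2 * y.1) (\pi_type x == \pi_type y).
Proof. by rewrite eqmodE; apply: eqP. Qed.

Definition tofrac (a : A) : type := \pi_type (@mkRatio (a, 1) regular1).

Definition addf x y :=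
  @mkRatio (x.1 * y.2 + y.1 * x.2, x.2 * y.2) (regularM (denP x) (denP y)).
Definition oppf x := @mkRatio (- x.1, x.2) (denP x).
Definition mulf x y :=
  @mkRatio (x.1 * y.1, x.2 * y.2) (regularM (denP x) (denP y)).

Definition add := lift_op2 type addf.
Definition opp := lift_op1 type oppf.
Definition mul := lift_op2 type mulf.

Lemma reprE x : x.1 * (repr (\pi_type x)).2 = x.2 * (repr (\pi_type x)).1.
Proof. by apply/piP; rewrite reprK. Qed.

Lemma pi_add : {morph \pi : x y / addf x y >-> add x y}.
Proof.
move=> x y; unlock add; apply/eqP/piP => /=.
have hx := reprE x; have hy := reprE y.
move: (repr _) (repr _) hx hy => x' y' hx hy.
rewrite mulrDl mulrDr; congr (_ + _).
  by rewrite mulrACA hx; ring.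
by rewrite [_ * x.2]mulrC mulrACA hy; ring.
Qed.
Canonical pi_add_morph := PiMorph2 pi_add.

Lemma pi_opp : {morph \pi : x / oppf x >-> opp x}.
Proof.
by move=> x; unlock opp; apply/eqP/piP; rewrite /= mulNr mulrN reprE.
Qed.
Canonical pi_opp_morph := PiMorph1 pi_opp.

Lemma pi_mul : {morph \pi : x y / mulf x y >-> mul x y}.
Proof.
by move=> x y; unlock mul; apply/eqP/piP; rewrite /= mulrACA !reprE; ring.
Qed.
Canonical pi_mul_morph := PiMorph2 pi_mul.

Lemma addA : associative add.
Proof.
elim/quotW=> x; elim/quotW=> y; elim/quotW=> z; rewrite !piE.
by apply/eqP/piP => /=; ring.
Qed.

Lemma addC : commutative add.
Proof.
by elim/quotW=> x; elim/quotW=> y; rewrite !piE; apply/eqP/piP => /=; ring.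
Qed.

Lemma add0 : left_id (tofrac 0) add.
Proof. by elim/quotW=> x; rewrite !piE; apply/eqP/piP => /=; ring. Qed.

Lemma addN : left_inverse (tofrac 0) opp add.
Proof. by elim/quotW=> x; rewrite !piE; apply/eqP/piP => /=; ring. Qed.

HB.instance Definition _ := GRing.isZmodule.Build type addA addC add0 addN.

Lemma mulA : associative mul.
Proof.
elim/quotW=> x; elim/quotW=> y; elim/quotW=> z; rewrite !piE.
by apply/eqP/piP => /=; ring.
Qed.

Lemma mulC : commutative mul.
Proof.
by elim/quotW=> x; elim/quotW=> y; rewrite !piE; apply/eqP/piP => /=; ring.
Qed.

Lemma mul1 : left_id (tofrac 1) mul.
Proof. by elim/quotW=> x; rewrite !piE; apply/eqP/piP => /=; ring. Qed.

Lemma mul_addl : left_distributive mul add.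
Proof.
elim/quotW=> x; elim/quotW=> y; elim/quotW=> z; rewrite !piE.
by apply/eqP/piP => /=; ring.
Qed.

Lemma nonzero1 : tofrac 1 != tofrac 0.
Proof. by apply/piP => /= /eqP; rewrite mulr1 mulr0 oner_eq0. Qed.

HB.instance Definition _ :=
  GRing.Zmodule_isComNzRing.Build type mulA mulC mul1 mul_addl nonzero1.

Definition unit : {pred type} := fun f => regular (repr f).1.

Definition inv (f : type) : type :=
  if insub ((repr f).2, (repr f).1) is Some x then \pi_type x else f.

Lemma mulV : {in unit, left_inverse (1 : type) inv *%R}.
Proof.
move=> f uf; rewrite /inv insubT //= -[f in _ * f]reprK -[_ * _]pi_mul.
by apply/eqP/piP => /=; ring.
Qed.

Lemma unitP (f g : type) : g * f = 1 -> unit f.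
Proof.
rewrite -[f]reprK -[g]reprK -[_ * _]pi_mul => /eqP/piP /=.
rewrite !mulr1 reprK => h; apply: (@regularMl _ (repr g).1).
by rewrite mulrC h regularM.
Qed.

Lemma inv_out : {in [predC unit], inv =1 id}.
Proof. by move=> f; rewrite !inE => nf; rewrite /inv insubN. Qed.

HB.instance Definition _ :=
  GRing.ComNzRing_hasMulInverse.Build type mulV unitP inv_out.

Lemma tofrac_zmod : zmod_morphism tofrac.
Proof.
move=> a b; have -> : - tofrac b = \pi_type (oppf (@mkRatio (b, 1) regular1)).
  exact/esym/pi_opp.
by rewrite -[RHS]pi_add; apply/eqP/piP => /=; ring.
Qed.
HB.instance Definition _ := GRing.isZmodMorphism.Build A type tofrac tofrac_zmod.

Lemma tofrac_monoid : monoid_morphism tofrac.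
Proof.
by split=> // a b; rewrite -[RHS]pi_mul; apply/eqP/piP => /=; ring.
Qed.
HB.instance Definition _ :=
  GRing.isMonoidMorphism.Build A type tofrac tofrac_monoid.

Lemma tofrac_inj : injective tofrac.
Proof. by move=> a b /eqP/piP /=; rewrite mulr1 mul1r. Qed.

Lemma tofrac_unit (a : A) : GRing.lreg a -> tofrac a \is a GRing.unit.
Proof.
move=> /regularP ra; apply/unitrPr; exists (\pi_type (@mkRatio (1, a) ra)).
by rewrite -[LHS]pi_mul; apply/eqP/piP => /=; ring.
Qed.

Lemma fracP (f : type) : exists p q, GRing.lreg q /\ f * tofrac q = tofrac p.
Proof.
exists (repr f).1, (repr f).2; split; first exact/regularP.
by rewrite -{1}[f]reprK -[LHS]pi_mul; apply/eqP/piP => /=; ring.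
Qed.

End TotFrac.
End TotFrac.
HB.export TotFrac.

Notation totfrac := (@TotFrac.tofrac _).

(* The ring R(x_1,...,x_n) of rational functions. *)
Notation ratfun R n := (TotFrac.type {mpoly R[n]}).

Section RationalFunctions.
Variable R : comNzRingType.

Definition rcst n (c : R) : ratfun R n := totfrac c%:MP.

Definition peval n m (x : 'I_n -> ratfun R m) (p : {mpoly R[n]}) : ratfun R m :=
  mmap (@rcst m) x p.

(* Substitution f(x_1,...,x_n): the value p(x)/q(x) for any representation
   f = p/q whose denominator satisfies "q(x) is invertible", and 0 if there is
   none.  The value does not depend on the representation (rsubst_frac).  All
   substitutions used below replace the variables by linear forms that are
   linearly independent over Q, or are applied to polynomials. *)
Definition rsubst n m (x : 'I_n -> ratfun R m) (f : ratfun R n) : ratfun R m :=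
  xget 0 [set y | exists p q : {mpoly R[n]},
    [/\ GRing.lreg q, f * totfrac q = totfrac p, peval x q \is a GRing.unit
      & y = peval x p / peval x q]]%classic.

Lemma rcst_is_zmod n : zmod_morphism (@rcst n).
Proof. by move=> a b; rewrite /rcst !rmorphB. Qed.
HB.instance Definition _ n :=
  GRing.isZmodMorphism.Build R (ratfun R n) (@rcst n) (@rcst_is_zmod n).

Lemma rcst_is_monoid n : monoid_morphism (@rcst n).
Proof. by split=> [|a b]; rewrite /rcst ?rmorph1 ?rmorphM. Qed.
HB.instance Definition _ n :=
  GRing.isMonoidMorphism.Build R (ratfun R n) (@rcst n) (@rcst_is_monoid n).

Lemma pevalM n m (x : 'I_n -> ratfun R m) p q :
  peval x (p * q) = peval x p * peval x q.
Proof. exact: rmorphM. Qed.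

Lemma rsubst_frac n m (x : 'I_n -> ratfun R m) (f : ratfun R n) p q :
    GRing.lreg q -> f * totfrac q = totfrac p -> peval x q \is a GRing.unit ->
  rsubst x f = peval x p / peval x q.
Proof.
move=> rq fq uq; rewrite /rsubst; case: xgetP => [y _|no]; last first.
  by exfalso; apply: (no (peval x p / peval x q)); exists p, q.
case=> p' [q' [rq' fq' uq' ->]].
apply: (mulIr uq'); rewrite divrK // mulrAC; apply: (mulIr uq); rewrite divrK //.
rewrite -!pevalM; congr peval; apply: (@TotFrac.tofrac_inj _).
by rewrite !rmorphM /= -fq -fq' mulrAC.
Qed.

Lemma rsubst_poly n m (x : 'I_n -> ratfun R m) (p : {mpoly R[n]}) :
  rsubst x (totfrac p) = peval x p.
Proof.
have e1 : peval x 1 = 1 by exact: rmorph1.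
rewrite (@rsubst_frac _ _ _ _ p 1) ?e1 ?divr1 ?unitr1 ?rmorph1 ?mulr1 //.
exact: lreg1.
Qed.

End RationalFunctions.

(* Letters are pairs (u, v).  The four flexions take both consecutive blocks:
   for ... b c ..., lceil b c is c with the u's of b added to its first u and
   rfloor b c is b with the first v of c subtracted from its v's; for
   ... a b ..., rceil a b is a with the u's of b added to its last u and
   lfloor a b is b with the last v of a subtracted from its v's. *)
Section Words.
Variable V : zmodType.
Local Notation word := (seq (V * V)).
Implicit Types a b c w : word.

Definition usum w : V := \sum_(l <- w) l.1.

Definition lceil b c : word :=
  if c is l :: c' then (usum b + l.1, l.2) :: c' else [::].

Definition rceil a b : word :=
  if a is l :: a' then
    rcons (belast l a') ((last l a').1 + usum b, (last l a').2)
  else [::].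

Definition rfloor b c : word :=
  if c is l :: _ then [seq (x.1, x.2 - l.2) | x <- b] else b.

Definition lfloor a b : word :=
  if a is l :: a' then [seq (x.1, x.2 - (last l a').2) | x <- b] else b.

(* all factorizations w = abc, empty blocks allowed *)
Definition factor3 w : seq (word * word * word) :=
  [seq (take i w, drop i (take j w), drop j w)
     | j <- iota 0 (size w).+1, i <- iota 0 j.+1].

(* All decompositions w = b_1 c_1 ... b_s c_s, as sequences of pairs
   (b_i, c_i), where only c_s may be empty; see mem_decomps. *)
Fixpoint decomps_rec n w : seq (seq (word * word)) :=
  if n is n'.+1 then
    if w is [::] then [:: [::]]
    else [seq (t.1.1, t.1.2) :: p
            | t <- [seq t <- factor3 w
                      | ~~ nilp t.1.1 && (~~ nilp t.1.2 || nilp t.2)],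
              p <- decomps_rec n' t.2]
  else [:: [::]].
Definition decomps w := decomps_rec (size w) w.

(* the words occurring in the shuffle product *)
Fixpoint shuffle x : word -> seq word :=
  if x is l :: x' then
    fix shuffle_x y := if y is l' :: y' then
        [seq l :: z | z <- shuffle x' y] ++ [seq l' :: z | z <- shuffle_x y']
      else [:: x]
  else fun y => [:: y].

Definition swap_word w : word :=
  let d := size w in
  (* for i = 0 the index d - i is out of range, and nothing is subtracted *)
  mkseq (fun i => ((nth 0 w (d - i.+1)).2 - (nth 0 w (d - i)).2,
                   \sum_(k < d - i) (nth 0 w k).1)) d.

End Words.

Section Stuffle.
Variable K : unitRingType.
Local Notation word := (seq (K * K)).

(* Formal linear combinations of words are lists of (coefficient, word). *)
Definition lcons (k : K) (l : K * K) (s : seq (K * word)) : seq (K * word) :=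
  [seq (k * t.1, l :: t.2) | t <- s].

Fixpoint stuffle (x : word) : word -> seq (K * word) :=
  if x is l :: x' then
    fix stuffle_x y := if y is l' :: y' then
        lcons 1 l (stuffle x' y) ++ lcons 1 l' (stuffle_x y')
        ++ lcons (l.2 - l'.2)^-1 (l.1 + l'.1, l.2) (stuffle x' y')
        ++ lcons (- (l.2 - l'.2)^-1) (l.1 + l'.1, l'.2) (stuffle x' y')
      else [:: (1, x)]
  else fun y => [:: (1, y)].

End Stuffle.

Section DecompsSpec.
Variable V : zmodType.
Local Notation word := (seq (V * V)).

Definition is_decomp (w : word) (p : seq (word * word)) : bool :=
  [&& flatten [seq bc.1 ++ bc.2 | bc <- p] == w,
      all (fun bc => ~~ nilp bc.1) p
    & all (fun bc => ~~ nilp bc.2) (take (size p).-1 p)].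

Lemma mem_factor3 (w a b c : word) :
  ((a, b, c) \in factor3 w) = (a ++ b ++ c == w).
Proof.
apply/allpairsPdep/eqP => [[j [i [hj hi [-> -> ->]]]]|<-].
  rewrite mem_iota /= add0n ltnS in hi.
  by rewrite catA -{1}(take_takel w hi) !cat_take_drop.
exists (size (a ++ b)), (size a); split.
- by rewrite mem_iota !size_cat /= add0n ltnS addnA leq_addr.
- by rewrite mem_iota size_cat /= add0n ltnS leq_addr.
rewrite catA [drop (size (a ++ b)) _]drop_size_cat //.
rewrite [take (size (a ++ b)) _]take_size_cat //.
by rewrite drop_size_cat // -catA take_size_cat.
Qed.

Lemma factor3_uniq (w : word) : uniq (factor3 w).
Proof.
apply: allpairs_uniq_dep; [exact: iota_uniq | by move=> *; apply: iota_uniq |].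
move=> u v /allpairsPdep [j1 [i1 [hj hi ->]]] /allpairsPdep
  [j2 [i2 [hj' hi' ->]]] /= [ei _ ej].
move: hj hi hj' hi'; rewrite !mem_iota /= !add0n !ltnS => hj hi hj' hi'.
have ? : j1 = j2.
  have := congr1 size ej; rewrite !size_drop => e.
  by rewrite -(subKn hj) e subKn.
subst j2; have := congr1 size ei.
by rewrite (size_takel (leq_trans hi hj)) (size_takel (leq_trans hi' hj)) => ->.
Qed.

Lemma is_decomp_nil p : is_decomp [::] p = (p == [::]).
Proof. by case: p => [|[[|? ?] ?] ?]; rewrite /is_decomp /= ?andbF. Qed.

Lemma is_decomp_cons w b c p :
  is_decomp w ((b, c) :: p) =
  [&& prefix (b ++ c) w, ~~ nilp b, ~~ nilp c || nilp (drop (size (b ++ c)) w)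
    & is_decomp (drop (size (b ++ c)) w) p].
Proof.
rewrite /is_decomp /=; case: prefixP => /= [[r ->]|no]; last first.
  apply/negP => /and3P[/eqP e _ _]; apply: no.
  by exists (flatten [seq bc.1 ++ bc.2 | bc <- p]); rewrite e.
rewrite drop_size_cat // eqseq_cat // eqxx /=.
case: eqP => /= [<-|]; last by rewrite !andbF.
case: (nilp b) => //=; case: p => [|[b' c'] p] /=; first by rewrite orbT.

by rewrite !cat_nilp; case: (nilp b') (nilp c) => [] [] //=; rewrite ?andbF.
Qed.

Lemma decomps_recS n l (w : word) :
  decomps_rec n.+1 (l :: w) =
  [seq (t.1.1, t.1.2) :: p
     | t <- [seq t <- factor3 (l :: w)
               | ~~ nilp t.1.1 && (~~ nilp t.1.2 || nilp t.2)],
       p <- decomps_rec n t.2].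
Proof. by []. Qed.

Lemma mem_decomps (w : word) (p : seq (word * word)) :
  (p \in decomps w) = is_decomp w p.
Proof.
rewrite /decomps; have := leqnn (size w).
move: {2 3}(size w) => n; elim: n w p => [|n IHn] [|l w] p // hw;
  rewrite ?is_decomp_nil ?inE // decomps_recS.
apply/allpairsPdep/idP => [[[[b c] r] [q [ht hq ->]]]|].
  move: ht; rewrite mem_filter mem_factor3 /= => /andP[/andP[hb hc] /eqP e].
  have hr : (size r <= n)%N.
    have : (size (l :: w) <= n.+1)%N by [].
    rewrite -e !size_cat; case: (b) hb => //= ? ? _.
    by rewrite addSn ltnS; apply: leq_trans; rewrite addnA leq_addl.
  rewrite is_decomp_cons -e catA drop_size_cat // prefix_prefix hb hc /=.
  by rewrite -IHn.
case: p => [|[b c] p]; first by rewrite /is_decomp.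
rewrite is_decomp_cons => /and4P[/prefixP[r e] hb hc hp].
exists (b, c, r), p; split=> //.
  rewrite mem_filter mem_factor3 /= hb e catA eqxx andbT.
  by rewrite e drop_size_cat in hc.
rewrite IHn /=; first by rewrite e drop_size_cat in hp.
have : (size (l :: w) <= n.+1)%N by [].
rewrite e !size_cat; case: (b) hb => //= ? ? _.
by rewrite !addSn ltnS; apply: leq_trans; rewrite leq_addl.
Qed.

Lemma decomps_uniq (w : word) : uniq (decomps w).
Proof.
rewrite /decomps; move: (size w) => n; elim: n w => [|n IHn] [|l w] //; rewrite decomps_recS.
apply: allpairs_uniq_dep; [by rewrite filter_uniq // factor3_uniq | by [] |].
move=> u v /allpairsPdep [[[a b] c] [p [hp _ ->]]] /allpairsPdep
  [[[a' b'] c'] [p' [hp' _ ->]]] /= [ea eb ep]; subst.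
move: hp hp'; rewrite !mem_filter !mem_factor3 => /andP[_ /eqP<-] /andP[_].
by rewrite !catA eqseq_cat // => /andP[_ /eqP->].
Qed.

End DecompsSpec.

Section Bimoulds.
Variable R : comNzRingType.

(* The depth d component is a rational function of u_1,...,u_d,v_1,...,v_d:
   the first d variables are the u_i, the last d the v_i. *)
Definition bimould := forall d : nat, ratfun R (d + d).

HB.instance Definition _ := Choice.on bimould.

Implicit Types A B C M : bimould.

Let badd A B : bimould := fun d => A d + B d.
Let bopp A : bimould := fun d => - A d.
Let bzero : bimould := fun d => 0.
Let bscale (k : R) A : bimould := fun d => rcst (d + d) k * A d.

Lemma baddA : associative badd.
Proof. by move=> *; apply: functional_extensionality_dep => d; apply: addrA. Qed.
Lemma baddC : commutative badd.
Proof. by move=> *; apply: functional_extensionality_dep => d; apply: addrC. Qed.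
Lemma badd0 : left_id bzero badd.
Proof. by move=> *; apply: functional_extensionality_dep => d; apply: add0r. Qed.
Lemma baddN : left_inverse bzero bopp badd.
Proof. by move=> *; apply: functional_extensionality_dep => d; apply: addNr. Qed.
HB.instance Definition _ :=
  GRing.isZmodule.Build bimould baddA baddC badd0 baddN.

Lemma bscaleA a b A : bscale a (bscale b A) = bscale (a * b) A.
Proof.
by apply: functional_extensionality_dep => d; rewrite /bscale rmorphM mulrA.
Qed.
Lemma bscale1 : left_id 1 bscale.
Proof.
by move=> A; apply: functional_extensionality_dep => d;
  rewrite /bscale rmorph1 mul1r.
Qed.
Lemma bscaleDr : right_distributive bscale +%R.
Proof.
by move=> a A B; apply: functional_extensionality_dep => d; apply: mulrDr.
Qed.
Lemma bscaleDl A : {morph bscale^~ A : a b / a + b}.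
Proof.
by move=> a b; apply: functional_extensionality_dep => d;
  rewrite /bscale rmorphD; apply: mulrDl.
Qed.
HB.instance Definition _ := GRing.Zmodule_isLmodule.Build R bimould
  bscaleA bscale1 bscaleDr bscaleDl.

Local Notation word n := (seq (ratfun R n * ratfun R n)).

Definition uvar d (i : 'I_d) : ratfun R (d + d) := totfrac 'X_(lshift d i).
Definition vvar d (i : 'I_d) : ratfun R (d + d) := totfrac 'X_(rshift d i).

Definition gword d : word (d + d) := [seq (uvar i, vvar i) | i <- enum 'I_d].

(* the value M(w) of a bimould on a word, in depth d = size w *)
Definition ev n M (w : word n) : ratfun R n :=
  rsubst (fun k : 'I_(size w + size w) => match split k with
            | inl i => (nth 0 w i).1
            | inr i => (nth 0 w i).2
          end) (M (size w)).

Definition swap M : bimould := fun d => ev M (swap_word (gword d)).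

(* Polynomial bimoulds are the rational ones with polynomial components. *)
Definition polynomial M : Prop :=
  forall d, exists p : {mpoly R[d + d]}, M d = totfrac p.

Definition BARI_pol M : Prop :=
  [/\ polynomial M, M 0%N = 0 & exists N, forall d, (N <= d)%N -> M d = 0].

Definition ARI_pol M : Prop :=
  BARI_pol M /\ forall d, exists p : {mpoly R[d]}, M d = peval (@uvar d) p.

Definition const_mould C : Prop :=
  C 0%N = 0 /\ forall d, exists c : R, C d = rcst (d + d) c.

Definition alternal M : Prop :=
  M 0%N = 0 /\ forall d n, (0 < n < d)%N ->
    \sum_(w <- shuffle (take n (gword d)) (drop n (gword d))) ev M w = 0.

Definition alternil M : Prop :=
  M 0%N = 0 /\ forall d n, (0 < n < d)%N ->
    \sum_(t <- stuffle (take n (gword d)) (drop n (gword d))) t.1 * ev M t.2 = 0.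

(* M_1(-u_1,-v_1) = M_1(u_1,v_1) *)
Definition even1 M : Prop :=
  ev M [:: (- uvar (@ord0 0), - vvar (@ord0 0))] = M 1%N.

Definition ARI_pol_al_il A : Prop :=
  [/\ ARI_pol A, alternal A,
      exists2 C, const_mould C & alternil (swap A + C),
      even1 A
    & exists2 p : {mpoly R[2]}, A 1%N = totfrac p & p@_0%MM = 0].

Definition BARI_pol_il_swap A : Prop :=
  [/\ BARI_pol A, alternil A, swap A = A & even1 A].

Definition mu A B : bimould := fun d =>
  \sum_(j < d.+1) ev A (take j (gword d)) * ev B (drop j (gword d)).

Definition lu A B : bimould := mu A B - mu B A.

Definition arit B A : bimould := fun d =>
  \sum_(t <- factor3 (gword d) | ~~ nilp t.1.2 && ~~ nilp t.2)
     (let: (a, b, c) := t in ev A (a ++ lceil b c) * ev B (rfloor b c))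
  - \sum_(t <- factor3 (gword d) | ~~ nilp t.1.1 && ~~ nilp t.1.2)
     (let: (a, b, c) := t in ev A (rceil a b ++ c) * ev B (lfloor a b)).

Definition ari A B : bimould := arit B A - arit A B + lu A B.

Definition ganit B A : bimould := fun d =>
  \sum_(p <- decomps (gword d))
    ev A (flatten [seq rceil bc.1 bc.2 | bc <- p])
    * \prod_(bc <- p) ev B (lfloor bc.1 bc.2).

Definition pic : bimould := fun d => \prod_(i < d) (vvar i)^-1.

Definition poc : bimould := fun d =>
  if d is d'.+1 then
    - (vvar (@ord0 d')
       * \prod_(i < d') (vvar (inord i : 'I_d'.+1) - vvar (inord i.+1)))^-1
  else 1.

Definition uri A B : bimould := ganit pic (ari (ganit poc A) (ganit poc B)).

(* The constant moulds C (vanishing in depth 1) such that swap(A) + C is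
   alternil; there is exactly one when A is in ARI_pol_al_il, called C_A. *)
Definition corr_const A : set bimould :=
  [set C | [/\ const_mould C, C 1%N = 0 & alternil (swap A + C)]]%classic.

Definition corr A : bimould := xget 0 (corr_const A).

Definition iota_al_il A : bimould := A + swap A + corr A.

End Bimoulds.

(* (L, br) is a Lie algebra over R: L is a submodule of V stable under br, on
   which br is bilinear, alternating and satisfies the Jacobi identity. *)
Definition lie_algebra (R : comNzRingType) (V : lmodType R) (L : set V)
    (br : V -> V -> V) : Prop :=
  [/\ L 0 /\ (forall (k : R) x y, L x -> L y -> L (k *: x + y)),
      forall x y, L x -> L y -> L (br x y),
      forall (k : R) x y z, L x -> L y -> L z ->
        br (k *: x + y) z = k *: br x z + br y z /\
        br z (k *: x + y) = k *: br z x + br z y,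
      forall x, L x -> br x x = 0
    & forall x y z, L x -> L y -> L z ->
        br x (br y z) + br y (br z x) + br z (br x y) = 0].

(* Main.v *)
Require Import Defs.
From mathcomp Require Import all_boot all_order all_algebra.
From mathcomp Require Import boolp classical_sets.
From mathcomp Require Import mpoly ring zify.
Import Order.TTheory GRing.Theory Num.Theory.
Local Open Scope ring_scope.

Set Implicit Arguments.
Unset Strict Implicit.

(* Evaluating bimoulds on words turns the statement into identities between
   functions of words.  There arit(B) is a derivation, and ganit_poc is the
   automorphism G = subst chain replacing a letter l by the sum over words c of
   1/((l - c_1)(c_1 - c_2)...) times l with the u's of c added, the differences
   being those of the v's; ganit_pic is its inverse.  G maps alternil moulds to
   alternal ones.

   Let N = B be a mould in the u's, or N = swap B + C.  Conjugating the
   derivation attached to G(N) by G gives again a derivation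
   l |-> N(l) l - l N'(l) on letters: N' = N in the first case, and N' is a
   cyclic shift of N (push) in the second.  The second case rests on the single
   identity der_chain, proved by induction from the vanishing of shuffles with
   one letter; it needs the constants C_d with d even to vanish, which follows
   by specializing alternility to the words 0...0 s 0...0.  Summing up,
   ari(G(iota A), G(iota B)) = G(ari(A, B) + E), and the antipode of alternal
   moulds identifies E with swap(ari(A, B)).  The left-hand side being alternal,
   and G being unitriangular for the depth, swap(ari(A, B)) is alternil.

   The Lie algebra axioms are transported from ari; its Jacobi identity says
   that B |-> arit(B) is compatible with brackets, which is checked on letters. *)

(** The splitting iota A = A + (swap A + C) separates the variables: A is a mould in the u's, swap A
    + C one in the v's. A derivation of the first kind acts on moulds in the v's as a commutator,
    and one of the second kind kills moulds in the u's. Hence the mixed terms of the bracket cancel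
    against those of lu, and the two halves can be treated apart. In the second half, passing to the
    successive differences of the v's turns the pushed derivation back into the one of ari. The
    obstacle is evaluation: a rational bimould has no value on words that kill its denominators,
    where [rsubst] returns 0, and R may have zero divisors. The identities are therefore proved for
    functions of words over a commutative unit ring K, where necessary on words whose v's have
    pairwise invertible differences ([pdiff]). The transfer to bimoulds rests on two facts: flexions
    commute with additive maps, and every word is a specialization of the generic word [gword],
    which satisfies [pdiff]. *)

Local Notation polynomial := Defs.polynomial.

(** * Sums over factorizations of words *)

Section Cuts.
Variables (T : Type) (K : comNzRingType).
Implicit Types (w a b c : seq T).

Fixpoint cuts_rec (F : seq T -> seq T -> K) w : K :=
  F [::] w + (if w is l :: w' then cuts_rec (fun a b => F (l :: a) b) w' else 0).

Fixpoint cutl_rec (F : seq T -> T -> seq T -> K) w : K :=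
  if w is l :: w' then F [::] l w' + cutl_rec (fun a m b => F (l :: a) m b) w'
  else 0.

(* The sums over the factorizations w = ab, resp. w = amb with m a letter; locked
   to keep unification from unfolding them. *)
Definition cuts := locked cuts_rec.
Definition cutl := locked cutl_rec.

Lemma cuts_nil F : cuts F [::] = F [::] [::].
Proof. by rewrite /cuts -lock /= addr0. Qed.

Lemma cuts_cons F l w :
  cuts F (l :: w) = F [::] (l :: w) + cuts (fun a b => F (l :: a) b) w.
Proof. by rewrite /cuts -lock. Qed.

Lemma cutl_nil F : cutl F [::] = 0.
Proof. by rewrite /cutl -lock. Qed.

Lemma cutl_cons F l w :
  cutl F (l :: w) = F [::] l w + cutl (fun a m b => F (l :: a) m b) w.
Proof. by rewrite /cutl -lock. Qed.

Definition cutsE := (cuts_nil, cuts_cons).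
Definition cutlE := (cutl_nil, cutl_cons).

Lemma eq_cuts F F' w :
  (forall a b, a ++ b = w -> F a b = F' a b) -> cuts F w = cuts F' w.
Proof.
elim: w F F' => [|l w IH] F F' h; rewrite !cutsE; first by rewrite h.
by rewrite h //; congr (_ + _); apply: IH => a b e; rewrite h //= e.
Qed.

Lemma eq_cutl F F' w :
  (forall a m b, a ++ m :: b = w -> F a m b = F' a m b) -> cutl F w = cutl F' w.
Proof.
elim: w F F' => [|l w IH] F F' h; rewrite !cutlE //.
by rewrite h //; congr (_ + _); apply: IH => a m b e; rewrite h //= e.
Qed.

Lemma cutsD F F' w :
  cuts (fun a b => F a b + F' a b) w = cuts F w + cuts F' w.
Proof.
by elim: w F F' => [|l w IH] F F'; rewrite !cutsE // IH; ring.
Qed.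

Lemma cutlD F F' w :
  cutl (fun a m b => F a m b + F' a m b) w = cutl F w + cutl F' w.
Proof.
by elim: w F F' => [|l w IH] F F'; rewrite !cutlE ?IH; ring.
Qed.

Lemma cutsM (k : K) F w : cuts (fun a b => k * F a b) w = k * cuts F w.
Proof. by elim: w F => [|l w IH] F; rewrite !cutsE // IH; ring. Qed.

Lemma cutlM (k : K) F w : cutl (fun a m b => k * F a m b) w = k * cutl F w.
Proof. by elim: w F => [|l w IH] F; rewrite !cutlE ?IH; ring. Qed.

Lemma cutsMr (k : K) F w : cuts (fun a b => F a b * k) w = cuts F w * k.
Proof. by elim: w F => [|l w IH] F; rewrite !cutsE // IH; ring. Qed.

Lemma cutsN F w : cuts (fun a b => - F a b) w = - cuts F w.
Proof. by elim: w F => [|l w IH] F; rewrite !cutsE // IH; ring. Qed.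

Lemma cutlN F w : cutl (fun a m b => - F a m b) w = - cutl F w.
Proof. by elim: w F => [|l w IH] F; rewrite !cutlE ?IH; ring. Qed.

Lemma cutsB F F' w :
  cuts (fun a b => F a b - F' a b) w = cuts F w - cuts F' w.
Proof. by rewrite cutsD cutsN. Qed.

Lemma cutlB F F' w :
  cutl (fun a m b => F a m b - F' a m b) w = cutl F w - cutl F' w.
Proof. by rewrite cutlD cutlN. Qed.

Lemma cuts0 w : cuts (fun _ _ => 0) w = 0.
Proof. by elim: w => [|l w IH]; rewrite !cutsE ?IH ?addr0. Qed.

Lemma cutl0 w : cutl (fun _ _ _ => 0) w = 0.
Proof. by elim: w => [|l w IH]; rewrite !cutlE ?IH ?addr0. Qed.

(** Coassociativity of deconcatenation: both sides run over the factorizations of w into three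
    blocks. *)
Lemma cuts_cuts (F : seq T -> seq T -> seq T -> K) w :
  cuts (fun a b => cuts (fun x y => F x y b) a) w =
  cuts (fun x c => cuts (fun y b => F x y b) c) w.
Proof.
elim: w F => [|l w IH] F; first by rewrite !cutsE.
rewrite !cutsE -IH -[RHS]addrA; congr (_ + _).
by rewrite -cutsD; apply: eq_cuts => a b _; rewrite cutsE.
Qed.

Lemma cuts_cutl (F : seq T -> seq T -> T -> seq T -> K) w :
  cuts (fun a b => cutl (fun x m y => F a x m y) b) w =
  cutl (fun x m y => cuts (fun a b => F a b m y) x) w.
Proof.
elim: w F => [|l w IH] F; first by rewrite cutsE !cutlE.
rewrite !cutsE !cutlE IH cutsE -[LHS]addrA; congr (_ + _).
by rewrite -cutlD; apply: eq_cutl => a m b _; rewrite cutsE.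
Qed.

Lemma cutl_cuts (F : seq T -> T -> seq T -> seq T -> K) w :
  cutl (fun x m y => cuts (fun a b => F x m a b) y) w =
  cuts (fun a b => cutl (fun x m y => F x m y b) a) w.
Proof.
elim: w F => [|l w IH] F; first by rewrite cutsE !cutlE.
rewrite !cutsE !cutlE IH add0r -cutsD.
by apply: eq_cuts => a b _; rewrite cutlE.
Qed.

Lemma cuts_rcons F w :
  cuts F w = F [::] w + cutl (fun a m b => F (rcons a m) b) w.
Proof.
elim: w F => [|l w IH] F; rewrite !(cutsE, cutlE) ?addr0 //.
by rewrite IH.
Qed.

Lemma cuts_rcons_arg F w m :
  cuts F (rcons w m) = cuts (fun a b => F a (rcons b m)) w + F (rcons w m) [::].
Proof.
elim: w F => [|l w IH] F; first by rewrite /= !cutsE.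
by rewrite rcons_cons !cutsE IH addrA.
Qed.

Lemma cuts_last F w :
  (forall a b, a ++ b = w -> b <> [::] -> F a b = 0) -> cuts F w = F w [::].
Proof.
elim: w F => [|l w IH] F h; rewrite !cutsE // h // add0r IH // => a b e nb.
by rewrite h //= e.
Qed.

Lemma cutl_rcons_arg (F : seq T -> T -> seq T -> K) w m :
  cutl F (rcons w m) = cutl (fun a k b => F a k (rcons b m)) w + F w m [::].
Proof.
elim: w F => [|l w IH] F; first by rewrite /= !cutlE addrC.
by rewrite rcons_cons !cutlE IH addrA.
Qed.

Lemma cuts_rev F w : cuts F (rev w) = cuts (fun a b => F (rev b) (rev a)) w.
Proof.
elim: w F => [|l w IH] F; first by rewrite !cutsE.
rewrite rev_cons cuts_rcons_arg IH cutsE addrC -rev_cons; congr (_ + _).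
by apply: eq_cuts => a b _; rewrite rev_cons.
Qed.

Lemma cutl_rev (F : seq T -> T -> seq T -> K) w :
  cutl F (rev w) = cutl (fun a m b => F (rev b) m (rev a)) w.
Proof.
elim: w F => [|l w IH] F; first by rewrite !cutlE.
rewrite rev_cons cutl_rcons_arg IH cutlE addrC; congr (_ + _).
by apply: eq_cutl => a m b _; rewrite rev_cons.
Qed.

Lemma cuts_split F w :
  cuts F w = cutl (fun a m b => F a (m :: b)) w + F w [::].
Proof.
by elim: w F => [|l w IH] F; rewrite !(cutsE, cutlE) ?add0r // IH addrA.
Qed.

End Cuts.

Lemma exchange_cuts (S T : Type) (K : comNzRingType)
    (G : seq S -> seq S -> seq T -> seq T -> K) x y :
  cuts (fun a b => cuts (fun c d => G a b c d) y) x =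
  cuts (fun c d => cuts (fun a b => G a b c d) x) y.
Proof.
elim: x G => [|l x IH] G; rewrite !cutsE.
  by apply: eq_cuts => a b _; rewrite cutsE.
by rewrite IH -cutsD; apply: eq_cuts => a b _; rewrite cutsE.
Qed.

Lemma cuts_map (S T : Type) (K : comNzRingType) (f : S -> T)
    (F : seq T -> seq T -> K) w :
  cuts F (map f w) = cuts (fun a b => F (map f a) (map f b)) w.
Proof. by elim: w F => [|l w IH] F; rewrite /= !cutsE // IH. Qed.

Lemma cutl_map (S T : Type) (K : comNzRingType) (f : S -> T)
    (F : seq T -> T -> seq T -> K) w :
  cutl F (map f w) = cutl (fun a m b => F (map f a) (f m) (map f b)) w.
Proof. by elim: w F => [|l w IH] F; rewrite /= !cutlE // IH. Qed.

(** * Substitutions and derivations of moulds *)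

Section Flexions.
Variable K : comUnitRingType.
Local Notation letter := (K * K)%type.
Local Notation word := (seq (K * K)).
Implicit Types (l m : letter) (w a b c x y z : word) (M N : word -> K).

Definition addu l (e : K) : letter := (l.1 + e, l.2).
Definition shv (e : K) w : word := [seq (l.1, l.2 - e) | l <- w].

Lemma usum_nil : usum ([::] : word) = 0.
Proof. by rewrite /usum big_nil. Qed.
Lemma usum_cons l w : usum (l :: w) = l.1 + usum w.
Proof. by rewrite /usum big_cons. Qed.
Lemma usum_cat a b : usum (a ++ b) = usum a + usum b.
Proof. by rewrite /usum big_cat. Qed.

Lemma adduA l (e f : K) : addu (addu l e) f = addu l (e + f).
Proof. by rewrite /addu /= addrA. Qed.
Lemma adduAC l (e f : K) : addu (addu l e) f = addu (addu l f) e.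
Proof. by rewrite !adduA addrC. Qed.
Lemma addu0 l : addu l 0 = l.
Proof. by case: l => u v; rewrite /addu addr0. Qed.

Lemma usum_shv e w : usum (shv e w) = usum w.
Proof. by rewrite /usum big_map. Qed.
Lemma shv_shv e f w : shv e (shv f w) = shv (f + e) w.
Proof. by rewrite /shv -map_comp; apply: eq_map => l /=; rewrite opprD addrA. Qed.
Lemma shv0 w : shv 0 w = w.
Proof. by elim: w => //= -[u v] w ->; rewrite subr0. Qed.
Lemma shv_cat e a b : shv e (a ++ b) = shv e a ++ shv e b.
Proof. exact: map_cat. Qed.

(* The automorphism of the algebra of moulds substituting for a letter l the
   sum of all q l.2 c * (l with usum c added), over the words c following l. *)
Section Subst.
Variable q : K -> word -> K.

(** The recursive call is on a suffix r of w', which is not a structural subterm; n is fuel, and any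
    n at least [size w] gives the same value ([subst_recE]). *)
Fixpoint subst_rec n M w : K :=
  if n is n'.+1 then
    if w is l :: w' then
      cuts (fun c r =>
        q l.2 c * subst_rec n' (fun z => M (addu l (usum c) :: z)) r) w'
    else M [::]
  else M [::].

Definition subst M w := subst_rec (size w) M w.

Lemma subst_recE n M w : (size w <= n)%N -> subst_rec n M w = subst M w.
Proof.
rewrite /subst; move: {2}(size w) (leqnn (size w)) => k.
elim: k n M w => [|k IH] [|n] M [|l w] //= hk hn.
apply: eq_cuts => c r e; congr (_ * _).
have hr : (size r <= size w)%N by rewrite -e size_cat leq_addl.
by rewrite !IH // ?(leq_trans hr) // ?hk.
Qed.

Lemma subst_nil M : subst M [::] = M [::].
Proof. by []. Qed.

Lemma subst_cons M l w :
  subst M (l :: w) =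
  cuts (fun c r => q l.2 c * subst (fun z => M (addu l (usum c) :: z)) r) w.
Proof.
rewrite {1}/subst /=; apply: eq_cuts => c r e.
by rewrite subst_recE // -e size_cat leq_addl.
Qed.

Lemma size_cut l w c r : c ++ r = w -> (size r < size (l :: w))%N.
Proof. by move=> <-; rewrite /= size_cat ltnS leq_addl. Qed.

Lemma eq_subst M M' w : (forall z, M z = M' z) -> subst M w = subst M' w.
Proof. by move=> h; congr subst; apply: funext. Qed.

Lemma word_ind (P : word -> Prop) :
  (forall w, (forall z, (size z < size w)%N -> P z) -> P w) -> forall w, P w.
Proof.
move=> h w; have [n] := ubnP (size w); elim: n w => // n IH w hw.
by apply: h => z hz; apply: IH; rewrite -ltnS (leq_trans _ hw).
Qed.

Lemma substD M M' w :
  subst (fun z => M z + M' z) w = subst M w + subst M' w.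
Proof.
elim/word_ind: w M M' => -[|l w] IH M M' //; rewrite !subst_cons -cutsD.
apply: eq_cuts => c r e; rewrite IH ?mulrDr //.
exact: size_cut e.
Qed.

Lemma substM (k : K) M w : subst (fun z => k * M z) w = k * subst M w.
Proof.
elim/word_ind: w M => -[|l w] IH M //; rewrite !subst_cons -cutsM.
apply: eq_cuts => c r e; rewrite mulrCA; congr (_ * _).
by apply: IH; apply: size_cut e.
Qed.

Lemma substMr (k : K) M w : subst (fun z => M z * k) w = subst M w * k.
Proof.
by rewrite mulrC -substM; apply: eq_subst => z; rewrite mulrC.
Qed.

Lemma substN M w : subst (fun z => - M z) w = - subst M w.
Proof.
by rewrite -mulN1r -substM; apply: eq_subst => z; rewrite mulN1r.
Qed.

Lemma substB M M' w :
  subst (fun z => M z - M' z) w = subst M w - subst M' w.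
Proof. by rewrite substD substN. Qed.

(** The letters of an absorbed block disappear, but their u's are added to the absorbing letter; so
    the total u is constant and can be frozen at its value on w. *)
Lemma subst_usum (F : K -> word -> K) w :
  subst (fun z => F (usum z) z) w = subst (F (usum w)) w.
Proof.
elim/word_ind: w F => -[|l w] IH F //; rewrite !subst_cons.
apply: eq_cuts => c r e; congr (_ * _).
rewrite -e usum_cons usum_cat.
rewrite -(IH r _ (fun s z => F (l.1 + (usum c + s)) (addu l (usum c) :: z))).
  by apply: eq_subst => z; rewrite usum_cons /= addrA.
exact: size_cut e.
Qed.

(** A cut of the substituted word falls between two blocks of w; it amounts to a cut w = ab together
    with block decompositions of a and of b. *)
Lemma subst_cuts (F : word -> word -> K) w :
  subst (cuts F) w = cuts (fun a b => subst (fun x => subst (F x) b) a) w.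
Proof.
elim/word_ind: w F => -[|l w] IH F; first by rewrite subst_nil !cuts_nil.
rewrite subst_cons cuts_cons subst_nil subst_cons.
under eq_cuts => c r e.
  rewrite (eq_subst r (cuts_cons F (addu l (usum c)))) substD mulrDr.
  rewrite [subst (cuts _) r]IH; last exact: size_cut e.
  rewrite -cutsM.
  over.
rewrite cutsD; congr (_ + _).
rewrite -cuts_cuts; apply: eq_cuts => a b _.
by rewrite subst_cons.
Qed.

Lemma subst_cutl (F : word -> letter -> word -> K) w :
  subst (cutl F) w =
  cutl (fun b m c => cuts (fun c1 r => q m.2 c1 *
    subst (fun x => subst (F x (addu m (usum c1))) r) b) c) w.
Proof.
elim/word_ind: w F => -[|l w] IH F; first by rewrite subst_nil !cutl_nil.
rewrite subst_cons cutl_cons.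
under eq_cuts => c r e.
  rewrite (eq_subst r (cutl_cons F (addu l (usum c)))) substD mulrDr.
  rewrite [subst (cutl _) r]IH; last exact: size_cut e.
  rewrite -cutlM.
  over.
rewrite cutsD; congr (_ + _).
rewrite cuts_cutl; apply: eq_cutl => b m c _.
under [LHS]eq_cuts => a b' _ do rewrite -cutsM.
under [RHS]eq_cuts => a b' _ do rewrite subst_cons -cutsM.
rewrite exchange_cuts; apply: eq_cuts => x y _; apply: eq_cuts => s t _.
by rewrite mulrCA.
Qed.

End Subst.

(* The derivation of the algebra of moulds substituting N(l) l - l N'(l) for a
   letter l, where N(l) is N with the first v of l subtracted from all v's. *)
Fixpoint der N N' M w : K :=
  if w is l :: w' then
    der N N' (fun z => M (l :: z)) w'
    - cuts (fun b c => N' (shv l.2 b) * M (addu l (usum b) :: c)) w'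
    + cutl (fun b m c => N (shv m.2 b) * M (addu m (usum b) :: c)) w
  else 0.

Lemma der_cons N N' M l w :
  der N N' M (l :: w) = der N N' (fun z => M (l :: z)) w
    - cuts (fun b c => N' (shv l.2 b) * M (addu l (usum b) :: c)) w
    + cutl (fun b m c => N (shv m.2 b) * M (addu m (usum b) :: c)) (l :: w).
Proof. by []. Qed.

Lemma eq_der N N' M M' w :
  (forall z, M z = M' z) -> der N N' M w = der N N' M' w.
Proof. by move=> h; congr der; apply: funext. Qed.

Lemma derD N N' M M' w :
  der N N' (fun z => M z + M' z) w = der N N' M w + der N N' M' w.
Proof.
elim: w M M' => [|l w IH] M M'; first by rewrite addr0.
rewrite !der_cons IH.
under eq_cuts => b c _ do rewrite mulrDr.
under eq_cutl => b m c _ do rewrite mulrDr.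
rewrite cutsD cutlD; ring.
Qed.

Lemma derM N N' (k : K) M w : der N N' (fun z => k * M z) w = k * der N N' M w.
Proof.
elim: w M => [|l w IH] M; first by rewrite mulr0.
rewrite !der_cons IH.
under eq_cuts => b c _ do rewrite mulrCA.
under eq_cutl => b m c _ do rewrite mulrCA.
rewrite cutsM cutlM; ring.
Qed.

Lemma derMr N N' (k : K) M w : der N N' (fun z => M z * k) w = der N N' M w * k.
Proof. by rewrite mulrC -derM; apply: eq_der => z; rewrite mulrC. Qed.

Lemma derN N N' M w : der N N' (fun z => - M z) w = - der N N' M w.
Proof. by rewrite -mulN1r -derM; apply: eq_der => z; rewrite mulN1r. Qed.

Lemma derB N N' M M' w :
  der N N' (fun z => M z - M' z) w = der N N' M w - der N N' M' w.
Proof. by rewrite derD derN. Qed.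

(** As for substitutions, the u's of an erased block go to the letter absorbing it, so the total u
    is constant. *)
Lemma der_usum N N' (F : K -> word -> K) w :
  der N N' (fun z => F (usum z) z) w = der N N' (F (usum w)) w.
Proof.
elim: w F => [|l w IH] F //; rewrite !der_cons; congr (_ - _ + _).
- have := IH (fun s z => F (l.1 + s) (l :: z)); rewrite /= usum_cons => <-.
  by apply: eq_der => z; rewrite usum_cons.
- apply: eq_cuts => b c <-.
  by rewrite !usum_cons usum_cat addrA.
- apply: eq_cutl => b m c <-.
  rewrite usum_cat !usum_cons /=; congr (_ * F _ _); ring.
Qed.

(** Leibniz rule: an erased block is adjacent to the letter absorbing it, so a cut of the resulting
    word leaves both on the same side. *)
Lemma der_cuts N N' (F : word -> word -> K) w :
  der N N' (cuts F) w =
  cuts (fun a b => der N N' (fun x => F x b) a + der N N' (F a) b) w.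
Proof.
elim: w F => [|l w IH] F; first by rewrite cuts_nil /= addr0.
rewrite der_cons cuts_cons [X in _ = X + _ + _]/= add0r !der_cons.
have -> : der N N' (fun z => cuts F (l :: z)) w =
  der N N' (fun z => F [::] (l :: z)) w +
  cuts (fun a b => der N N' (fun x => F (l :: x) b) a + der N N' (F (l :: a)) b) w.
  rewrite -IH -derD; apply: eq_der => z; exact: cuts_cons.
under [X in _ - X + _ = _]eq_cuts => b c _ do rewrite cuts_cons mulrDr -cutsM.
under [X in _ - _ + X = _]eq_cutl => b m c _ do rewrite cuts_cons mulrDr -cutsM.
under [X in _ = _ + X]eq_cuts => a b _ do rewrite der_cons.
have := cuts_cuts (fun b a d => N' (shv l.2 b) * F (addu l (usum b) :: a) d) w.
have := cutl_cuts
  (fun b m a d => N (shv m.2 b) * F (addu m (usum b) :: a) d) (l :: w).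
cbv beta => e1 e2.
rewrite !cutsD cutlD cutsN -e2 e1 cuts_cons cutl_nil; ring.
Qed.

(** Differences of v's are the only denominators of stuffles and of G. The condition concerns the
    v's alone and passes to subsequences, permutations and common shifts, hence survives all
    flexions. *)
Definition pdiff : pred word :=
  pairwise (fun l m => l.2 - m.2 \is a GRing.unit).

Lemma pdiff_catl a b : pdiff (a ++ b) -> pdiff a.
Proof. by rewrite /pdiff pairwise_cat => /and3P[]. Qed.
Lemma pdiff_catr a b : pdiff (a ++ b) -> pdiff b.
Proof. by rewrite /pdiff pairwise_cat => /and3P[]. Qed.
Lemma pdiff_cons l w : pdiff (l :: w) -> pdiff w.
Proof. by rewrite /pdiff /= => /andP[]. Qed.
Lemma pdiff_cons_catl l a b : pdiff (l :: a ++ b) -> pdiff (l :: a).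
Proof. by rewrite -cat_cons; apply: pdiff_catl. Qed.
Lemma pdiff_cons_catr l a b : pdiff (l :: a ++ b) -> pdiff (l :: b).
Proof.
by rewrite /pdiff /= all_cat pairwise_cat => /andP[/andP[_ ->] /and3P[_ _ ->]].
Qed.

Lemma pdiff_shv e w : pdiff (shv e w) = pdiff w.
Proof.
elim: w => //= l w; rewrite /pdiff /= => ->; congr (_ && _).
elim: w => //= m w ->; congr ((_ \is a _) && _); ring.
Qed.

Lemma pdiff_perm a b : perm_eq a b -> pdiff a -> pdiff b.
Proof.
move: a b; apply: catCA_perm_ind => x y z.
rewrite /pdiff !pairwise_cat !allrel_catr.
have -> : allrel (fun l m : letter => l.2 - m.2 \is a GRing.unit) x y =
          allrel (fun l m : letter => l.2 - m.2 \is a GRing.unit) y x.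
  rewrite allrelC; apply: eq_allrel => l m.
  by rewrite -[LHS]unitrN opprB.
by case/and3P => /andP[-> ->] -> /and3P[-> -> ->].
Qed.

Variable q : K -> word -> K.
Hypothesis q_shv : forall e p c, q (p - e) (shv e c) = q p c.

Lemma subst_shv e M w :
  subst q (fun z => M (shv e z)) w = subst q M (shv e w).
Proof.
elim/word_ind: w M => -[|l w] IH M //; rewrite [shv e _]/= !subst_cons.
rewrite cuts_map; apply: eq_cuts => c r h; rewrite usum_shv q_shv; congr (_ * _).
by rewrite -IH //; apply: size_cut h.
Qed.

(** A substitution and a derivation are compared letter by letter. The left factors N(l) are carried
    to X(l) by the substitution itself. The hypothesis is the comparison that remains, that of the
    terms to the right of a letter l, where the derivation also acts on the coefficients q. *)
Lemma subst_der N N' M w :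
  let X := subst q N in
  (forall l z, pdiff (l :: z) ->
     cuts (fun c y => q l.2 c * subst q N' (shv l.2 y)) z =
     cuts (fun b c => X (shv l.2 b) * q l.2 c) z - der X X (q l.2) z) ->
  pdiff w -> subst q (der N N' M) w = der X X (subst q M) w.
Proof.
move=> X hN; elim/word_ind: w M => -[|l w] IH M hw //.
rewrite subst_cons.
under eq_cuts => c r e.
  rewrite (eq_subst q r (der_cons N N' M (addu l (usum c)))) /=.
  rewrite substD substB [subst q (der _ _ _) r]IH; last 2 first.
  - exact: size_cut e.
  - by move: hw; rewrite -e => /pdiff_cons/pdiff_catr.
  rewrite subst_cuts mulrDr mulrBr.
  over.
rewrite cutsD cutsB.
(* Left factors: N is evaluated on the substituted block before m, and the shift by the v of m
   commutes with the substitution since q is invariant under common shifts. *)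
have -> : cuts (fun c r => q l.2 c * subst q (fun z => cutl (fun b m d =>
      N (shv m.2 b) * M (addu m (usum b) :: d)) (addu l (usum c) :: z)) r) w
   = cutl (fun b m c => X (shv m.2 b) * subst q M (addu m (usum b) :: c))
       (l :: w).
  rewrite -(subst_cons q (cutl _)) subst_cutl; apply: eq_cutl => b m c _.
  rewrite subst_cons -cutsM; apply: eq_cuts => c1 r _.
  rewrite mulrCA; congr (_ * _).
  under eq_subst => z do rewrite substM.
  rewrite (subst_usum q (fun s z => N (shv m.2 z) *
     subst q (fun z0 => M (addu (addu m (usum c1)) s :: z0)) r)).
  rewrite substMr subst_shv; congr (_ * _).
  by apply: eq_subst => z; rewrite adduAC.
rewrite der_cons; congr (_ + _).
have -> : der X X (fun z => subst q M (l :: z)) w =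
    cuts (fun c r => q l.2 c *
      der X X (subst q (fun z => M (addu l (usum c) :: z))) r) w
    + cuts (fun c r => der X X (q l.2) c *
      subst q (fun z => M (addu l (usum c) :: z)) r) w.
  under eq_der => z do rewrite subst_cons.
  rewrite der_cuts addrC -cutsD; apply: eq_cuts => a b _.
  rewrite (der_usum X X (fun s x => q l.2 x *
    subst q (fun z => M (addu l s :: z)) b)) derMr derM.
  by congr (_ * _ + _).
(* The right factors are regrouped by the whole block s = cy that l absorbs in the two
   operations. *)
have -> : cuts (fun c r => q l.2 c * cuts (fun a b => subst q (fun x =>
      subst q (fun d => N' (shv l.2 x)
        * M (addu (addu l (usum c)) (usum x) :: d)) b) a) r) w =
    cuts (fun s r => cuts (fun c y => q l.2 c * subst q N' (shv l.2 y)) s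
      * subst q (fun z => M (addu l (usum s) :: z)) r) w.
  under eq_cuts => c r _ do rewrite -cutsM.
  rewrite -(cuts_cuts (fun c a b => q l.2 c * subst q (fun x => subst q (fun d =>
     N' (shv l.2 x) * M (addu (addu l (usum c)) (usum x) :: d)) b) a)).
  apply: eq_cuts => s r _; rewrite -cutsMr; apply: eq_cuts => c y <-.
  rewrite -mulrA; congr (_ * _).
  rewrite (eq_subst q y (fun x => substM q _ _ r)).
  rewrite (subst_usum q (fun t x => N' (shv l.2 x)
    * subst q (fun d => M (addu (addu l (usum c)) t :: d)) r)).
  rewrite substMr subst_shv; congr (_ * _); apply: eq_subst => z.
  by rewrite adduA usum_cat.
have -> : cuts (fun b c => X (shv l.2 b) * subst q M (addu l (usum b) :: c)) w =
    cuts (fun s r => cuts (fun b c => X (shv l.2 b) * q l.2 c) s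
      * subst q (fun z => M (addu l (usum s) :: z)) r) w.
  under eq_cuts => b c _ do rewrite subst_cons -cutsM.
  rewrite -(cuts_cuts (fun b c r => X (shv l.2 b) * (q (addu l (usum b)).2 c *
    subst q (fun z => M (addu (addu l (usum b)) (usum c) :: z)) r))).
  apply: eq_cuts => s r _; rewrite -cutsMr; apply: eq_cuts => b c <-.
  by rewrite mulrA adduA usum_cat.
rewrite -!addrA; congr (_ + _); rewrite -!cutsN -cutsD.
apply: eq_cuts => s r e.
(* For fixed s the coefficients agree by the hypothesis applied to l and s. *)
rewrite hN; last by move: hw; rewrite -e => /pdiff_cons_catl.
ring.
Qed.

End Flexions.
Arguments pdiff {K}.

(** * Shuffle sums and alternality *)

Section Shuffles.
Variable K : comUnitRingType.
Local Notation letter := (K * K)%type.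
Local Notation word := (seq (K * K)).
Implicit Types (l m k : letter) (w a b c x y z : word) (M N X F : word -> K).

Definition shsum F x y : K := \sum_(z <- shuffle x y) F z.

Lemma shsum_nill F y : shsum F [::] y = F y.
Proof. by rewrite /shsum big_seq1. Qed.

Lemma shsum_nilr F x : shsum F x [::] = F x.
Proof. by case: x => [|l x]; rewrite /shsum big_seq1. Qed.

Lemma shsum_cons F l x k y : shsum F (l :: x) (k :: y) =
  shsum (fun z => F (l :: z)) x (k :: y) + shsum (fun z => F (k :: z)) (l :: x) y.
Proof. by rewrite /shsum /= big_cat !big_map. Qed.

Definition shsumE := (shsum_nill, shsum_nilr, shsum_cons).

Lemma shsumD F F' x y :
  shsum (fun z => F z + F' z) x y = shsum F x y + shsum F' x y.
Proof. exact: big_split. Qed.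

Lemma shsumM (e : K) F x y : shsum (fun z => e * F z) x y = e * shsum F x y.
Proof. by rewrite /shsum big_distrr. Qed.

Lemma shsumMr (e : K) F x y : shsum (fun z => F z * e) x y = shsum F x y * e.
Proof. by rewrite /shsum big_distrl. Qed.

Lemma shsumN F x y : shsum (fun z => - F z) x y = - shsum F x y.
Proof. by rewrite /shsum sumrN. Qed.

Lemma shsumB F F' x y :
  shsum (fun z => F z - F' z) x y = shsum F x y - shsum F' x y.
Proof. by rewrite shsumD shsumN. Qed.

Lemma eq_shsum F F' x y :
  (forall z, F z = F' z) -> shsum F x y = shsum F' x y.
Proof. by move=> h; apply: eq_bigr => z _. Qed.

Lemma eq_shsum_perm F F' x y :
    (forall z, perm_eq z (x ++ y) -> F z = F' z) ->
  shsum F x y = shsum F' x y.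
Proof.
elim: x F F' y => [|l x IHx] F F' y h; first by rewrite !shsumE h.
elim: y F F' h => [|k y IHy] F F' h; first by rewrite !shsumE h ?cats0.
rewrite !shsumE; congr (_ + _).
  by apply: IHx => z hz; apply: h; rewrite /= perm_cons.
apply: IHy => z hz; apply: h.
by rewrite perm_sym (perm_catCA (l :: x) [:: k] y) perm_sym /= perm_cons.
Qed.

Lemma shsum_usum (F : K -> word -> K) x y :
  shsum (fun z => F (usum z) z) x y = shsum (F (usum x + usum y)) x y.
Proof.
apply: eq_shsum_perm => z hz; congr F.
by rewrite /usum -big_cat; apply: perm_big.
Qed.

Lemma shsum_shv e F x y :
  shsum (fun z => F (shv e z)) x y = shsum F (shv e x) (shv e y).
Proof.
elim: x F y => [|l x IHx] F y; first by rewrite !shsumE.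
elim: y F => [|k y IHy] F; first by rewrite /= !shsumE.
rewrite [shv e (l :: x)]/= [shv e (k :: y)]/= !shsumE; congr (_ + _).
  exact: (IHx (fun z => F ((l.1, l.2 - e) :: z)) (k :: y)).
exact: (IHy (fun z => F ((k.1, k.2 - e) :: z))).
Qed.

(** Deconcatenation is a morphism for the shuffle product: the first part of a cut shuffle is a
    shuffle of prefixes of x and y, the second part a shuffle of the remaining suffixes. *)
Lemma shsum_cuts (F : word -> word -> K) x y :
  shsum (cuts F) x y =
  cuts (fun x1 x2 => cuts (fun y1 y2 =>
    shsum (fun a => shsum (F a) x2 y2) x1 y1) y) x.
Proof.
set C := fun (G : word -> word -> K) x y =>
  cuts (fun x1 x2 => cuts (fun y1 y2 =>
    shsum (fun a => shsum (G a) x2 y2) x1 y1) y) x.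
rewrite -/(C F x y).
have Cr G u k v : C G u (k :: v) = cuts (fun x1 x2 => shsum (G x1) x2 (k :: v)) u
   + cuts (fun x1 x2 => cuts (fun y1 y2 =>
      shsum (fun a => shsum (G a) x2 y2) x1 (k :: y1)) v) u.
  rewrite /C -cutsD; apply: eq_cuts => x1 x2 _.
  by rewrite cutsE shsumE.
have Cl G l u v : C G (l :: u) v = cuts (fun y1 y2 => shsum (G y1) (l :: u) y2) v
   + cuts (fun x1 x2 => cuts (fun y1 y2 =>
      shsum (fun a => shsum (G a) x2 y2) (l :: x1) y1) v) u.
  rewrite /C cuts_cons; congr (_ + _).
  by apply: eq_cuts => x1 x2 _; rewrite shsumE.
have e1 G u v t : shsum (fun z => cuts G (u :: z)) v t =
    shsum (fun z => G [::] (u :: z)) v t + shsum (cuts (fun a => G (u :: a))) v t.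
  by rewrite -shsumD; apply: eq_shsum => z; rewrite cutsE.
elim: x F y => [|l x IHx] F y.
  by rewrite /C cuts_nil shsumE; apply: eq_cuts => a b _; rewrite !shsumE.
elim: y F => [|k y IHy] F.
  by rewrite shsumE; apply: eq_cuts => a b _; rewrite !cutsE !shsumE.
rewrite shsum_cons !e1 IHx IHy Cr !Cl cuts_cons shsum_cons.
under [X in _ = _ + X]eq_cuts => x1 x2 _.
  rewrite cutsE shsumE.
  under eq_cuts => y1 y2 _ do rewrite shsumE.
  rewrite cutsD; over.
by rewrite !cutsD; ring.
Qed.

(** The same with a marked letter, which comes either from x or from y. *)
Lemma shsum_cutl (F : word -> letter -> word -> K) x y :
  shsum (cutl F) x y =
  cutl (fun x1 m x2 => cuts (fun y1 y2 =>
    shsum (fun a => shsum (F a m) x2 y2) x1 y1) y) x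
  + cutl (fun y1 m y2 => cuts (fun x1 x2 =>
    shsum (fun a => shsum (F a m) x2 y2) x1 y1) x) y.
Proof.
have e1 G u v t : shsum (fun z => cutl G (u :: z)) v t =
    shsum (G [::] u) v t + shsum (cutl (fun a => G (u :: a))) v t.
  by rewrite -shsumD; apply: eq_shsum => z; rewrite cutlE.
elim: x F y => [|l x IHx] F y.
  rewrite cutl_nil shsumE add0r; apply: eq_cutl => a m b _.
  by rewrite !cutsE !shsumE.
elim: y F => [|k y IHy] F.
  rewrite shsumE cutl_nil addr0; apply: eq_cutl => a m b _.
  by rewrite !cutsE !shsumE.
rewrite shsum_cons !e1 IHx IHy !cutl_cons.
rewrite [cuts _ (k :: y)]cuts_cons [cuts _ (l :: x)]cuts_cons !shsum_nill.
under [cuts _ y]eq_cuts => y1 y2 _ do rewrite shsum_nill.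
under [X in _ = _ + X + _]eq_cutl => x1 m x2 _.
  rewrite cutsE shsumE.
  under eq_cuts => y1 y2 _ do rewrite shsumE.
  rewrite cutsD addrA -[X in X + _ + _](shsum_nilr
    (fun a => shsum (F (l :: a) m) x2 (k :: y)) x1).
  rewrite -(cuts_cons (fun y1 y2 =>
    shsum (fun a => shsum (F (l :: a) m) x2 y2) x1 y1)).
  over.
under [X in _ = _ + (_ + X)]eq_cutl => y1 m y2 _.
  rewrite cutsE shsumE.
  under eq_cuts => x1 x2 _ do rewrite shsumE.
  rewrite cutsD addrCA -[X in _ + (X + _)](shsum_nill
    (fun a => shsum (F (k :: a) m) (l :: x) y2) y1).
  rewrite -(cuts_cons (fun x1 x2 =>
    shsum (fun a => shsum (F (k :: a) m) x2 y2) x1 y1)).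
  over.
under [X in _ = _ + (_ + X + _)]eq_cuts => x1 x2 _ do rewrite shsum_nilr.
under [X in _ + (_ + (X + _)) + _ = _]eq_cuts => x1 x2 _ do rewrite shsum_nilr.
under [X in _ = _ + X + _ + _]eq_cuts => y1 y2 _ do rewrite shsum_nill.
rewrite !cutlD; ring.
Qed.

End Shuffles.

Section Collapse.
Variables (S T : Type) (K : comNzRingType).

Lemma cuts_head (F : seq T -> seq T -> K) w :
  (forall a b, a ++ b = w -> a <> [::] -> F a b = 0) -> cuts F w = F [::] w.
Proof.
case: w => [|l w] h; rewrite cutsE // (eq_cuts (F' := fun _ _ => 0)) ?cuts0 ?addr0 //.
by move=> a b e; rewrite h //= e.
Qed.

(** The surviving terms have a or c empty. The two families share the term with both empty, whence
    the second hypothesis. *)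
Lemma cuts_collapse (F : seq S -> seq S -> seq T -> seq T -> K) x y :
    (forall a b c d, a ++ b = x -> c ++ d = y -> a <> [::] -> c <> [::] ->
       F a b c d = 0) -> F [::] x [::] y = 0 ->
  cuts (fun a b => cuts (F a b) y) x =
  cuts (fun a b => F a b [::] y) x + cuts (F [::] x) y.
Proof.
case: x => [|l x] h h0; first by rewrite !(cuts_nil _ : @cuts S K _ [::] = _) h0 add0r.
rewrite !(cuts_cons _ l x) h0 add0r addrC; congr (_ + _); apply: eq_cuts => a b e.
by apply: cuts_head => c d e' nc; apply: h => //=; rewrite e.
Qed.

Lemma cutl_collapse (F : seq S -> S -> seq S -> seq T -> seq T -> K) l x y :
    (forall a m b c d, a ++ m :: b = l :: x -> c ++ d = y ->
       a <> [::] -> c <> [::] -> F a m b c d = 0) -> F [::] l x [::] y = 0 ->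
  cutl (fun a m b => cuts (F a m b) y) (l :: x) =
  cutl (fun a m b => F a m b [::] y) (l :: x) + cuts (F [::] l x) y.
Proof.
move=> h h0; rewrite !cutl_cons h0 add0r addrC; congr (_ + _).
apply: eq_cutl => a m b e.
by apply: cuts_head => c d e' nc; apply: h => //=; rewrite e.
Qed.

End Collapse.

(** * Alternal functions of words, their derivations and brackets *)

Section Alternal.
Variable K : comUnitRingType.
Local Notation letter := (K * K)%type.
Local Notation word := (seq (K * K)).
Implicit Types (l m k : letter) (w a b c x y z : word) (M N X F : word -> K).

Variable P : pred word.
Hypothesis P_perm : forall a b, perm_eq a b -> P a -> P b.
Hypothesis P_sub : forall a b, subseq (unzip2 a) (unzip2 b) -> P b -> P a.

Lemma P_catr a b : P (a ++ b) -> P b.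
Proof. by apply: P_sub; rewrite /unzip2 map_cat suffix_subseq. Qed.

(** P selects the words on which M has a meaning: all words for polynomial moulds, [pdiff] for their
    images under G. *)
Definition falternal M := forall x y,
  P (x ++ y) -> x <> [::] -> y <> [::] -> shsum M x y = 0.

(** A block mixing letters of x and y contributes a proper shuffle in X, which vanishes. A letter of
    one word may absorb a block of the other from its right, with sign -, or from its left, with
    sign +; both factors of the derivation being the same X, these terms cancel. What remains acts
    inside x or inside y. *)
Lemma shsum_der X M x y : X [::] = 0 ->
  (forall m a b, P (m :: a ++ b) -> a <> [::] -> b <> [::] ->
     shsum (fun z => X (shv m.2 z)) a b = 0) ->
  P (x ++ y) ->
  shsum (der X X M) x y =
  der X X (fun z => shsum M z y) x + der X X (fun z => shsum M x z) y.
Proof.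
move=> X0 hX.
pose R M l := cuts (fun b c => X (shv l.2 b) * M (addu l (usum b) :: c)).
pose L M := cutl (fun b m c => X (shv m.2 b) * M (addu m (usum b) :: c)).
have dE F l z : der X X F (l :: z) =
  der X X (fun z => F (l :: z)) z - R F l z + L F (l :: z) by [].
have e1 F m u1 u2 v1 v2 : shsum (fun a => shsum (fun z => X (shv m.2 a) *
    F (addu m (usum a) :: z)) u2 v2) u1 v1 =
    shsum (fun z => X (shv m.2 z)) u1 v1 *
    shsum (fun z => F (addu m (usum u1 + usum v1) :: z)) u2 v2.
  rewrite -shsumMr -(shsum_usum (fun s z => X (shv m.2 z) *
    shsum (fun z => F (addu m s :: z)) u2 v2)).
  by apply: eq_shsum => z; rewrite shsumM.
(* Blocks absorbed by l from its right come from u alone or from v alone. *)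
have hR F l u v : P (l :: u ++ v) -> shsum (R F l) u v =
    cuts (fun a b => X (shv l.2 a) * shsum (fun z => F (addu l (usum a) :: z)) b v) u
  + cuts (fun a b => X (shv l.2 a) * shsum (fun z => F (addu l (usum a) :: z)) u b) v.
  move=> hP; rewrite shsum_cuts.
  rewrite cuts_collapse.
  - congr (_ + _); apply: eq_cuts => a b _; rewrite e1.
      by rewrite shsum_nilr usum_nil addr0.
    by rewrite shsum_nill usum_nil add0r.
  - move=> a b c d e e' na nc; rewrite e1 hX ?mul0r //.
    apply: (@P_catr (b ++ d)); apply: P_perm hP; rewrite -e -e'.
    by apply/permP => p; rewrite /= ?count_cat /= ?count_cat; lia.
  - by rewrite e1 shsum_nill /= X0 mul0r.
(* Blocks absorbed from the left. The second and fourth summands, where a head letter absorbs a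
   block of the other word, are the terms that cancel against those of [hR]. *)
have hL F l u k v : P ((l :: u) ++ (k :: v)) ->
  shsum (L F) (l :: u) (k :: v) =
    cutl (fun a m b => X (shv m.2 a) *
       shsum (fun z => F (addu m (usum a) :: z)) b (k :: v)) (l :: u)
  + cuts (fun a b => X (shv l.2 a) *
       shsum (fun z => F (addu l (usum a) :: z)) u b) (k :: v)
  + (cutl (fun a m b => X (shv m.2 a) *
       shsum (fun z => F (addu m (usum a) :: z)) (l :: u) b) (k :: v)
  + cuts (fun a b => X (shv k.2 a) *
       shsum (fun z => F (addu k (usum a) :: z)) b v) (l :: u)).
  move=> hP; rewrite shsum_cutl.
  rewrite !cutl_collapse; first last.
  - by rewrite e1 shsum_nill /= X0 mul0r.
  - move=> a m b c d e e' na nc; rewrite e1 hX ?mul0r //.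
    apply: (@P_catr (b ++ d)); apply: P_perm hP; rewrite -e -e'.
    by apply/permP => p; rewrite ?(count_cat, cat_cons) /= ?count_cat /=; lia.
  - by rewrite e1 shsum_nill /= X0 mul0r.
  - move=> a m b c d e e' na nc; rewrite e1 hX ?mul0r //.
    apply: (@P_catr (b ++ d)); apply: P_perm hP; rewrite -e -e'.
    by apply/permP => p; rewrite ?(count_cat, cat_cons) /= ?count_cat /=; lia.
  congr (_ + _ + (_ + _)).
  - by apply: eq_cutl => a m b _; rewrite e1 shsum_nilr usum_nil addr0.
  - by apply: eq_cuts => a b _; rewrite e1 shsum_nill usum_nil add0r.
  - by apply: eq_cutl => a m b _; rewrite e1 shsum_nill usum_nil add0r.
  - by apply: eq_cuts => a b _; rewrite e1 shsum_nilr usum_nil addr0.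
elim: x M y => [|l x IHx] M y hP.
  rewrite shsum_nill add0r; apply: eq_der => z; exact/esym/shsum_nill.
elim: y M hP => [|k y IHy] M hP.
  rewrite shsum_nilr addr0; apply: eq_der => z; exact/esym/shsum_nilr.
have hPl : P (l :: x ++ (k :: y)) by [].
have hPk : P (k :: (l :: x) ++ y).
  apply: P_perm hP; rewrite perm_sym.
  by apply/permP => p; rewrite ?(count_cat, cat_cons) /= ?count_cat /=; lia.
have d1 u v : shsum (fun z => der X X M (u :: z)) v = fun t =>
   shsum (der X X (fun z => M (u :: z))) v t - shsum (R M u) v t
   + shsum (fun z => L M (u :: z)) v t.
  apply: funext => t; rewrite -shsumB -shsumD; apply: eq_shsum => z.
  exact: dE.
rewrite shsum_cons !d1.
rewrite IHx; last exact: (@P_catr [:: l]).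
rewrite IHy; last exact: (@P_catr [:: k]).
rewrite !hR // !dE.
have := hL M l x k y hP; rewrite shsum_cons => hL1.
have -> : forall a b c d e f : K, a - b + c + (d - e + f) = a - b + (d - e) + (c + f).
  by move=> *; ring.
rewrite hL1.
have D1 : der X X (fun z => shsum M (l :: z) (k :: y)) x =
   der X X (fun z => shsum (fun t => M (l :: t)) z (k :: y)) x
 + der X X (fun z => shsum (fun t => M (k :: t)) (l :: z) y) x.
  by rewrite -derD; apply: eq_der => z; rewrite shsum_cons.
have D2 : der X X (fun z => shsum M (l :: x) (k :: z)) y =
   der X X (fun z => shsum (fun t => M (l :: t)) x (k :: z)) y
 + der X X (fun z => shsum (fun t => M (k :: t)) (l :: x) z) y.
  by rewrite -derD; apply: eq_der => z; rewrite shsum_cons.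
rewrite D1 D2.
have RR a : R (fun z => shsum M z (k :: y)) l a =
  cuts (fun b c => X (shv l.2 b) * shsum (fun z => M (addu l (usum b) :: z)) c (k :: y)) a
  + R (fun z => shsum (fun t => M (k :: t)) z y) l a.
  by rewrite -cutsD; apply: eq_cuts => b c _; rewrite shsum_cons mulrDr.
have RR' a : R (fun z => shsum M (l :: x) z) k a =
  R (fun z => shsum (fun t => M (l :: t)) x z) k a
  + cuts (fun b c => X (shv k.2 b) * shsum (fun z => M (addu k (usum b) :: z)) (l :: x) c) a.
  by rewrite -cutsD; apply: eq_cuts => b c _; rewrite shsum_cons mulrDr.
have LL a : L (fun z => shsum M z (k :: y)) a =
  cutl (fun b m c => X (shv m.2 b) * shsum (fun z => M (addu m (usum b) :: z)) c (k :: y)) a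
  + L (fun z => shsum (fun t => M (k :: t)) z y) a.
  by rewrite -cutlD; apply: eq_cutl => b m c _; rewrite shsum_cons mulrDr.
have LL' a : L (fun z => shsum M (l :: x) z) a =
  L (fun z => shsum (fun t => M (l :: t)) x z) a
  + cutl (fun b m c => X (shv m.2 b) * shsum (fun z => M (addu m (usum b) :: z)) (l :: x) c) a.
  by rewrite -cutlD; apply: eq_cutl => b m c _; rewrite shsum_cons mulrDr.
rewrite RR RR' LL LL'.
ring.
Qed.

Definition fmul M N w := cuts (fun a b => M a * N b) w.
Definition flie M N w := fmul M N w - fmul N M w.

(** Only the cuts separating x from y survive. The value is symmetric in M and N, which makes the
    bracket of alternal functions alternal. *)
Lemma shsum_fmul M N x y : M [::] = 0 -> N [::] = 0 ->
  falternal M -> falternal N -> P (x ++ y) -> x <> [::] -> y <> [::] ->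
  shsum (fmul M N) x y = M x * N y + M y * N x.
Proof.
move=> M0 N0 hM hN hP nx ny.
rewrite shsum_cuts.
have e1 u1 u2 v1 v2 : shsum (fun a => shsum (fun b => M a * N b) u2 v2) u1 v1 =
    shsum M u1 v1 * shsum N u2 v2.
  by rewrite -shsumMr; apply: eq_shsum => z; rewrite shsumM.
rewrite cuts_collapse; first last.
- by rewrite e1 shsumE M0 mul0r.
- move=> a b c d e e' na nc; rewrite e1 hM ?mul0r //.
  apply: (@P_catr (b ++ d)); apply: P_perm hP; rewrite -e -e'.
  by apply/permP => p; rewrite !count_cat; lia.
rewrite !cuts_split [X in X + _ + _](eq_cutl (F' := fun _ _ _ => 0)); last first.
  move=> a m b e; rewrite e1 hN ?mulr0 //.
  apply: (@P_catr a); apply: P_perm hP; rewrite -e -catA; exact: perm_refl.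
rewrite [X in _ + (X + _)](eq_cutl (F' := fun _ _ _ => 0)); last first.
  move=> a m b e; rewrite e1 hN ?mulr0 //.
  apply: (@P_catr a); apply: P_perm hP; rewrite -e.
  by apply/permP => p; rewrite !count_cat; lia.
by rewrite !cutl0 !add0r !e1 !shsumE.
Qed.

Lemma falternal_flie M N : M [::] = 0 -> N [::] = 0 ->
  falternal M -> falternal N -> falternal (flie M N).
Proof.
move=> M0 N0 hM hN x y hP nx ny.
rewrite shsumB !shsum_fmul //; ring.
Qed.

(** The words on which [der] evaluates M are nonempty, and their v's form a subsequence of those of
    w. *)
Lemma der_eq0 N N' M w :
    (forall z, z <> [::] -> subseq (unzip2 z) (unzip2 w) -> M z = 0) ->
  der N N' M w = 0.
Proof.
elim: w M => // l w IH M h.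
rewrite der_cons IH; last first.
  by move=> z nz sz; apply: h => //=; rewrite eqxx.
rewrite (eq_cuts (F' := fun _ _ => 0)); last first.
  move=> b c e; rewrite h ?mulr0 //= -e eqxx /unzip2 map_cat.
  exact: suffix_subseq.
rewrite (eq_cutl (F' := fun _ _ _ => 0)); last first.
  move=> b m c e; rewrite h ?mulr0 // -e /unzip2 map_cat.
  exact: suffix_subseq.
by rewrite cuts0 cutl0 subr0 add0r.
Qed.

Lemma falternal_der X M : X [::] = 0 ->
  (forall m a b, P (m :: a ++ b) -> a <> [::] -> b <> [::] ->
     shsum (fun z => X (shv m.2 z)) a b = 0) ->
  falternal M -> falternal (der X X M).
Proof.
move=> X0 hX hM x y hP nx ny; rewrite shsum_der // !der_eq0 ?addr0 //.
- move=> z nz sz; apply: hM => //; apply: P_sub hP.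
  by rewrite /unzip2 !map_cat cat_subseq.
- move=> z nz sz; apply: hM => //; apply: P_sub hP.
  by rewrite /unzip2 !map_cat cat_subseq.
Qed.

End Alternal.

(** * Chains, and stuffle sums *)

Section Chains.
Variable K : comUnitRingType.
Local Notation letter := (K * K)%type.
Local Notation word := (seq (K * K)).
Implicit Types (l m k : letter) (w a b c x y z : word) (M N X : word -> K).
Implicit Types (p e : K).

Lemma invr_sub_sub (a b c : K) :
  a - b \is a GRing.unit -> a - c \is a GRing.unit -> b - c \is a GRing.unit ->
  (a - b)^-1 * (b - c)^-1 - (a - c)^-1 * (b - c)^-1 = (a - b)^-1 * (a - c)^-1.
Proof.
move=> /mulVr; set A := (a - b)^-1 => hA /mulVr; set B := (a - c)^-1 => hB.
move=> /mulVr; set C := (b - c)^-1 => hC.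
transitivity (A * C * (B * (a - c)) - B * C * (A * (a - b))).
  by rewrite hA hB !mulr1.
by rewrite -[RHS]mulr1 -hC; ring.
Qed.

Lemma invr_subC (a b : K) : (a - b)^-1 = - (b - a)^-1.
Proof. by rewrite -invrN opprB. Qed.

(** At p = 0 this is [poc]. A general p is the v that the flexion subtracts, that of the letter to
    which the block is attached. *)
Fixpoint chain p w : K := if w is l :: w' then (p - l.2)^-1 * chain l.2 w' else 1.

Lemma chain_shv e p w : chain (p - e) (shv e w) = chain p w.
Proof.
elim: w p => //= l w IH p; rewrite IH; congr (_^-1 * _); ring.
Qed.

(** At p = 0 this is [pic]. *)
Definition pprod p w : K := \prod_(l <- w) (l.2 - p)^-1.

Lemma pprod_shv e p w : pprod (p - e) (shv e w) = pprod p w.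
Proof.
rewrite /pprod big_map; apply: eq_bigr => l _ /=; congr _^-1; ring.
Qed.

(** In the induction step the two possible first letters, with v's l and k, give 1/((p-l)(l-k)) +
    1/((p-k)(k-l)) = 1/((p-l)(p-k)), which is [invr_sub_sub]. *)
Lemma shsum_chain p x y : pdiff ((0, p) :: x ++ y) ->
  shsum (chain p) x y = chain p x * chain p y.
Proof.
elim: x p y => [|l x IHx] p y hP; first by rewrite shsumE mul1r.
elim: y p hP => [|k y IHy] p hP; first by rewrite shsumE mulr1.
have hl : pdiff (l :: x ++ (k :: y)) by move: hP => /pdiff_cons.
have hk : pdiff (k :: (l :: x) ++ y).
  apply: pdiff_perm hl; apply/permP => q.
  by rewrite /= ?count_cat /= ?count_cat; lia.
rewrite shsum_cons /= -/(shsum _ _ _).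
rewrite [shsum (fun z => _) x _]shsumM IHx; last first.
  by move: hl; rewrite /pdiff.
rewrite [shsum (fun z => _) _ y]shsumM IHy; last first.
  by move: hk; rewrite /pdiff.
move: hP; rewrite /pdiff /= all_cat /= => /andP[/and3P[ul _ /andP[uk _]]].
rewrite all_cat /= => /andP[/and3P[_ ulk _] _].
have := invr_sub_sub ul uk ulk.
set A := (p - l.2)^-1; set B := (p - k.2)^-1.
rewrite [(k.2 - _)^-1]invr_subC.
set C := (l.2 - k.2)^-1; set D := chain l.2 x; set E := chain k.2 y => h.
transitivity ((A * C - B * C) * D * E); first ring.
by rewrite h; ring.
Qed.

Definition stsum M x y : K := \sum_(t <- stuffle x y) t.1 * M t.2.

Lemma stsum_nill M y : stsum M [::] y = M y.
Proof. by rewrite /stsum big_seq1 mul1r. Qed.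

Lemma stsum_nilr M x : stsum M x [::] = M x.
Proof. by case: x => [|l x]; rewrite /stsum big_seq1 mul1r. Qed.

Lemma stsum_cons M l x k y : stsum M (l :: x) (k :: y) =
  stsum (fun z => M (l :: z)) x (k :: y) + stsum (fun z => M (k :: z)) (l :: x) y
  + (l.2 - k.2)^-1 * (stsum (fun z => M (addu l k.1 :: z)) x y
                    - stsum (fun z => M (addu k l.1 :: z)) x y).
Proof.
have e (c : K) h s : \sum_(t <- lcons c h s) t.1 * M t.2 =
    c * \sum_(t <- s) t.1 * M (h :: t.2).
  by rewrite big_map big_distrr; apply: eq_bigr => t _ /=; rewrite mulrA.
rewrite /stsum /= !big_cat /= !e !mul1r mulrBr mulNr !addrA /addu.
by rewrite [k.1 + _]addrC.
Qed.

Lemma stsumD M N x y :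
  stsum (fun z => M z + N z) x y = stsum M x y + stsum N x y.
Proof. by rewrite -big_split; apply: eq_bigr => t _; rewrite mulrDr. Qed.

Lemma stsumB M N x y :
  stsum (fun z => M z - N z) x y = stsum M x y - stsum N x y.
Proof.
by rewrite /stsum -sumrB; apply: eq_bigr => t _; rewrite mulrBr.
Qed.

Section Fubini.
Variable q : K -> word -> K.

Lemma subst_sum_cuts (T : Type) (F : word -> seq T -> seq T -> K) x (y : seq T) :
  subst q (fun z => cuts (F z) y) x =
  cuts (fun a b : seq T => subst q (fun z => F z a b) x) y.
Proof.
elim/word_ind: x F => -[|l x] IH F //; rewrite subst_cons.
under eq_cuts => c r e.
  by rewrite IH; [rewrite -cutsM; over | exact: size_cut e].
by rewrite exchange_cuts; apply: eq_cuts => a b _; rewrite subst_cons.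
Qed.

Definition subst2 (F : word -> word -> K) x y :=
  subst q (fun z => subst q (F z) y) x.

Lemma subst2_consl F l x y : subst2 F (l :: x) y =
  cuts (fun a b => q l.2 a
    * subst2 (fun z => F (addu l (usum a) :: z)) b y) x.
Proof. by rewrite /subst2 subst_cons. Qed.

Lemma subst2_consr F x k y : subst2 F x (k :: y) =
  cuts (fun a b => q k.2 a
    * subst2 (fun z t => F z (addu k (usum a) :: t)) x b) y.
Proof.
rewrite /subst2.
under eq_subst => z do rewrite subst_cons.
by rewrite subst_sum_cuts; apply: eq_cuts => a b _; rewrite substM.
Qed.

Lemma subst2D F G x y : subst2 (fun z t => F z t + G z t) x y =
  subst2 F x y + subst2 G x y.
Proof.
by rewrite /subst2 -substD; apply: eq_subst => z; rewrite substD.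
Qed.

Lemma subst2M e F x y : subst2 (fun z t => e * F z t) x y = e * subst2 F x y.
Proof.
by rewrite /subst2 -substM; apply: eq_subst => z; rewrite substM.
Qed.

Lemma subst2B F G x y : subst2 (fun z t => F z t - G z t) x y =
  subst2 F x y - subst2 G x y.
Proof.
by rewrite /subst2 -substB; apply: eq_subst => z; rewrite substB.
Qed.

End Fubini.

(** G carries stuffles to shuffles. The first letter l of a shuffle absorbs a shuffle of prefixes a
    and c of the two remaining words, with coefficient [chain l.2 a * chain l.2 c] by [shsum_chain].
    If c begins with the head k of the other word, its chain splits off 1/(l - k); the cases of l
    and of k as first letter together form the divided difference in the stuffle product. *)
Lemma shsum_subst_chain M x y : pdiff (x ++ y) ->
  shsum (subst chain M) x y = subst2 chain (stsum M) x y.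
Proof.
move: {2}(size x + size y)%N (leqnn (size x + size y)) => n.
elim: n M x y => [|n IH] M x y.
  case: x y => [|l x] [|k y] // _ _.
  by rewrite shsumE /subst2 !subst_nil stsum_nill.
case: x => [|l x] hn hP.
  rewrite shsumE /subst2 subst_nil; apply: eq_subst => z; exact/esym/stsum_nill.
case: y hn hP => [|k y] hn hP.
  rewrite shsumE /subst2; apply: eq_subst => z.
  rewrite subst_nil; exact/esym/stsum_nilr.
have hk : pdiff (k :: (l :: x) ++ y).
  apply: pdiff_perm hP; apply/permP => q.
  by rewrite /= ?count_cat /= ?count_cat; lia.
pose S h := subst2 chain (stsum (fun z => M (h :: z))).
have half u v w : (size v + size w <= n)%N -> pdiff (u :: v ++ w) ->
  shsum (fun z => subst chain M (u :: z)) v w =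
  cuts (fun a b => cuts (fun c d => chain u.2 a * chain u.2 c
     * S (addu u (usum a + usum c)) b d) w) v.
  move=> hs hu.
  under eq_shsum => z do rewrite subst_cons.
  rewrite shsum_cuts; apply: eq_cuts => a b e; apply: eq_cuts => c d e'.
  have h : pdiff ((u :: a ++ c) ++ (b ++ d)).
    apply: pdiff_perm hu; rewrite -e -e'; apply/permP => q.
    by rewrite /= ?count_cat /= ?count_cat; lia.
  have hac := pdiff_catl h; have hbd := pdiff_catr h.
  have hs' : (size b + size d <= n)%N.
    apply: leq_trans hs; rewrite -e -e' !size_cat; lia.
  rewrite -shsum_chain; last by move: hac; rewrite /pdiff.
  under eq_shsum => z do rewrite shsumM.
  rewrite (shsum_usum (fun s z => chain u.2 z * shsum (subst chain
    (fun t => M (addu u s :: t))) b d)).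
  by rewrite shsumMr /S IH.
rewrite shsum_cons !half //; try by move: hn => /=; lia.
rewrite [RHS]subst2_consl.
(* Either c is empty and l alone begins the stuffle, or c begins with k and l has merged with k. *)
have -> : cuts (fun a b => cuts (fun c d => chain l.2 a * chain l.2 c
     * S (addu l (usum a + usum c)) b d) (k :: y)) x =
  cuts (fun a b => cuts (fun c d => chain l.2 a * (chain k.2 c
     * subst2 chain (fun z t => stsum (fun w => M (addu l (usum a) :: w))
         z (addu k (usum c) :: t)) b d)
    + chain l.2 a * chain k.2 c * (l.2 - k.2)^-1
     * S (addu l (usum a + (k.1 + usum c))) b d) y) x.
  apply: eq_cuts => a b _; rewrite cuts_cons cutsD; congr (_ + _).
    rewrite usum_nil addr0 /= mulr1 /S subst2_consr -cutsM.
    by apply: eq_cuts => c d _.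
  apply: eq_cuts => c d _; rewrite usum_cons /=; ring.
have -> : cuts (fun a b => cuts (fun c d => chain k.2 a * chain k.2 c
     * S (addu k (usum a + usum c)) b d) y) (l :: x) =
  cuts (fun a b => cuts (fun c d => chain l.2 a * (chain k.2 c
     * subst2 chain (fun z t => stsum (fun w => M (addu k (usum c) :: w))
         (addu l (usum a) :: z) t) b d)
    - chain l.2 a * chain k.2 c * (l.2 - k.2)^-1
     * S (addu k (l.1 + usum a + usum c)) b d) y) x.
  rewrite cuts_cons; under [RHS]eq_cuts => a b _ do rewrite cutsB.
  rewrite cutsB -cutsN; congr (_ + _).
    rewrite exchange_cuts; apply: eq_cuts => c d _.
    rewrite usum_nil add0r /= mul1r /S subst2_consl -cutsM.
    by apply: eq_cuts => a b _; rewrite mulrCA.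
  apply: eq_cuts => a b _; rewrite -cutsN; apply: eq_cuts => c d _.
  by rewrite usum_cons /= [(k.2 - _)^-1]invr_subC; ring.
rewrite -cutsD; apply: eq_cuts => a b _.
rewrite -cutsD subst2_consr -cutsM; apply: eq_cuts => c d _.
have -> : (fun z t => stsum M (addu l (usum a) :: z) (addu k (usum c) :: t)) =
  (fun z t => stsum (fun w => M (addu l (usum a) :: w)) z (addu k (usum c) :: t)
   + stsum (fun w => M (addu k (usum c) :: w)) (addu l (usum a) :: z) t
   + (l.2 - k.2)^-1
     * (stsum (fun w => M (addu l (usum a + (k.1 + usum c)) :: w)) z t
      - stsum (fun w => M (addu k (l.1 + usum a + usum c) :: w)) z t)).
  apply: funext => z; apply: funext => t; rewrite stsum_cons !adduA /=.
  by rewrite [usum c + _]addrC.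
by rewrite !subst2D subst2M subst2B /S; ring.
Qed.

(** The inverse of [pprod p] for the product [fmul]: [pprod p] is the geometric series of the depth
    1 function 1/(v - p), so its inverse is 1 minus that function. *)
Let inv_chain p w : K :=
  if w is l :: w' then if w' is [::] then (p - l.2)^-1 else 0 else 1.

Lemma cuts_pprod_inv_chain p w :
  cuts (fun x y => pprod p x * inv_chain p y) w = (w == [::])%:R.
Proof.
case/lastP: w => [|w m]; first by rewrite cutsE /pprod big_nil mulr1.
rewrite cuts_rcons_arg cuts_last => [|a b e nb]; last first.
  by case: b nb {e} => [|? []] //=; rewrite mulr0.
rewrite /= mulr1 /pprod -cats1 big_cat big_seq1 [(p - _)^-1]invr_subC.
by rewrite mulrN addNr; case: (w).
Qed.

(** By induction, what follows the factor of the first letter is the product of [pprod] and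
    [inv_chain] based at that letter, which vanishes on nonempty words. *)
Lemma subst_pprod_chain p w : pdiff ((0, p) :: w) ->
  subst pprod (chain p) w = inv_chain p w.
Proof.
elim/word_ind: w p => -[|l w] IH p hP //; rewrite subst_cons.
have hl : pdiff (l :: w) by apply: pdiff_cons hP.
under eq_cuts => c r _ do rewrite substM mulrCA /=.
rewrite cutsM (eq_cuts (F' := fun x y => pprod l.2 x * inv_chain l.2 y)).
  by rewrite cuts_pprod_inv_chain; case: (w) => [|? ?]; rewrite /= ?mulr1 ?mulr0.
move=> a b e; rewrite IH //; first exact: size_cut e.
suff : pdiff (l :: b) by rewrite /pdiff.
by move: hl; rewrite -e => /pdiff_cons_catr.
Qed.

(** The composite attaches to the first letter a block a = xy whose coefficient is again the product
    of [pprod] with its inverse, so only the empty block survives. *)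
Lemma substK M w : pdiff w -> subst pprod (subst chain M) w = M w.
Proof.
elim/word_ind: w M => -[|l w] IH M hP //; rewrite subst_cons.
under eq_cuts => c r _.
  rewrite (eq_subst _ r (subst_cons chain M (addu l (usum c)))).
  rewrite subst_cuts -cutsM; over.
rewrite -(cuts_cuts (fun c x y => pprod l.2 c * subst pprod (fun z =>
  subst pprod (fun t => chain (addu l (usum c)).2 z * subst chain
   (fun z0 => M (addu (addu l (usum c)) (usum z) :: z0)) t) y) x)).
rewrite (eq_cuts (F' := fun a b => cuts (fun x y => pprod l.2 x
   * subst pprod (chain l.2) y) a * M (addu l (usum a) :: b))); last first.
  move=> a b e; rewrite -cutsMr; apply: eq_cuts => x y e'.
  rewrite -mulrA; congr (_ * _).
  under eq_subst => z do rewrite substM /=.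
  rewrite (subst_usum pprod (fun s z => chain l.2 z * subst pprod (subst chain
   (fun z0 => M (addu (addu l (usum x)) s :: z0))) b)) substMr IH.
  - by rewrite adduA -e' usum_cat.
  - exact: size_cut e.
  - by move: hP; rewrite -e => /pdiff_cons/pdiff_catr.
have kap a : pdiff (l :: a) -> cuts (fun x y => pprod l.2 x
    * subst pprod (chain l.2) y) a = (a == [::])%:R.
  move=> ha; rewrite -(cuts_pprod_inv_chain l.2); apply: eq_cuts => x y e.
  rewrite subst_pprod_chain //.
  suff : pdiff (l :: y) by rewrite /pdiff.
  by move: ha; rewrite -e => /pdiff_cons_catr.
rewrite cuts_head => [|a b e na].
  by rewrite kap // mul1r usum_nil addu0.
rewrite kap; first by case: a na {e} => // ? ? _; rewrite mul0r.
by move: hP; rewrite -e => /pdiff_cons_catl.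
Qed.

End Chains.
Arguments chain {K} p w.
Arguments pprod {K} p w.

(** * The identity for chains *)

Section ChainIdentity.
Variable K : comUnitRingType.
Local Notation letter := (K * K)%type.
Local Notation word := (seq (K * K)).
Implicit Types (l m k t z : letter) (w a b c x y : word) (M N X : word -> K).

Lemma subst_eq0 q M w : w <> [::] ->
  (forall z : word, z <> [::] -> subseq (unzip2 z) (unzip2 w) -> M z = 0) ->
  subst q M w = 0.
Proof.
elim/word_ind: w M => -[|l w] IH M // _ h; rewrite subst_cons.
rewrite (eq_cuts (F' := fun _ _ => 0)) ?cuts0 // => c r e.
case: r e => [|k r] e.
  by rewrite subst_nil h ?mulr0 //= eqxx sub0seq.
rewrite IH ?mulr0 //; first exact: size_cut e.
move=> z nz sz; apply: h => //=; rewrite eqxx -e /unzip2 map_cat.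
exact: subseq_trans sz (suffix_subseq _ _).
Qed.

Lemma pdiff_unzip2 w : pdiff w = pairwise (fun e f : K => e - f \is a GRing.unit) (unzip2 w).
Proof. by rewrite /pdiff /unzip2 pairwise_map. Qed.

Lemma pdiff_sub a b : subseq (unzip2 a) (unzip2 b) -> pdiff b -> pdiff a.
Proof.
rewrite !pdiff_unzip2 => /subseqP[s _ ->]; exact: pairwise_mask.
Qed.

Definition falternil M := forall x y,
  pdiff (x ++ y) -> x <> [::] -> y <> [::] -> stsum M x y = 0.

Lemma subst2_eq0 q (F : word -> word -> K) x y : x <> [::] -> y <> [::] ->
  (forall a b, a <> [::] -> b <> [::] -> subseq (unzip2 a) (unzip2 x) ->
     subseq (unzip2 b) (unzip2 y) -> F a b = 0) ->
  subst2 q F x y = 0.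
Proof.
move=> nx ny h; apply: subst_eq0 => // a na sa.
by apply: subst_eq0 => // b nb sb; apply: h.
Qed.

Lemma falternal_subst M : falternil M -> falternal pdiff (subst chain M).
Proof.
move=> hM x y hP nx ny; rewrite shsum_subst_chain //.
apply: subst2_eq0 => // a b na nb sa sb; apply: hM => //.
by apply: pdiff_sub hP; rewrite /unzip2 !map_cat cat_subseq.
Qed.

Lemma falternal_shv X : falternal pdiff X -> forall m a b,
  pdiff (m :: a ++ b) -> a <> [::] -> b <> [::] ->
  shsum (fun z : word => X (shv m.2 z)) a b = 0.
Proof.
move=> hX m a b /pdiff_cons hP na nb; rewrite shsum_shv; apply: hX.
- by rewrite -shv_cat pdiff_shv.
- by case: (a) na.
- by case: (b) nb.
Qed.

Lemma stsum_letter M t y : stsum M [:: t] y =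
  cuts (fun a b => M (a ++ t :: b)) y
  + cutl (fun a l b => (t.2 - l.2)^-1
      * (M (a ++ addu t l.1 :: b) - M (a ++ addu l t.1 :: b))) y.
Proof.
elim: y M => [|k y IH] M; first by rewrite stsum_nilr cutsE cutlE addr0.
by rewrite stsum_cons IH !stsum_nill cutsE cutlE; ring.
Qed.

Section DerChain.
Variables (X L : word -> K).

(** In the application X and L are the images under G of N and of [push N]. Then Y is the image of
    the function sending b m to N on b shifted by m, and [Y_L] holds because the value of that
    function on z w is [push N] on w shifted by z. *)
Let Y := cutl (fun b m c => X (shv m.2 b) * chain m.2 c).
(** The chain based at its own first letter; [der_chain] is the vanishing of its derivative,
    unfolded at that letter. *)
Let path w := if w is l :: c then chain l.2 c else 0.

Hypothesis X_nil : X [::] = 0.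
Hypothesis X_alt : falternal pdiff X.
Hypothesis X_even : forall t z, pdiff [:: t; z] ->
  X (shv z.2 [:: t]) = X (shv t.2 [:: z]).
Hypothesis L_alt : forall z t w, pdiff (z :: t :: w) -> w <> [::] ->
  shsum (fun x => L (shv z.2 x)) [:: t] w = 0.
Hypothesis Y_L : forall z w,
  Y (z :: w) = cuts (fun a b => chain z.2 a * L (shv z.2 b)) w.

(* Evaluation in two ways of the sum of the Y(z x), x ranging over the
   shuffles of t and w. *)
Lemma Y_insert z t w : pdiff (z :: t :: w) ->
  cuts (fun a b => X (shv t.2 (z :: a)) * chain t.2 b) w
  + cutl (fun a m b => X (shv m.2 (z :: a)) * (chain m.2 [:: t] * chain m.2 b)
                     - X (shv m.2 (t :: z :: a)) * chain m.2 b) w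
  = X (shv t.2 [:: z]) * chain z.2 w + chain z.2 [:: t] * Y (z :: w).
Proof.
move=> hP.
have Lnil : L [::] = 0.
  have := Y_L z [::]; rewrite /Y cutlE cutlE cutsE /= X_nil mul0r addr0 mul1r.
  by move=> <-.
have Ltz : L (shv z.2 [:: t]) = X (shv t.2 [:: z]).
  have := Y_L z [:: t]; rewrite /Y !cutlE !cutsE /= Lnil X_nil.
  by rewrite mul0r mulr0 mul1r mulr1 add0r !addr0 => <-.
have hzw : pdiff (z :: w).
  by apply: pdiff_sub hP; apply: (cat_subseq (subseq_refl [:: z.2])); apply: subseq_cons.
transitivity (shsum (fun x => Y (z :: x)) [:: t] w); last first.
  under eq_shsum => x do rewrite Y_L.
  rewrite shsum_cuts !cutsE.
  have e1 u1 u2 v1 v2 : shsum (fun x => shsum (fun x0 => chain z.2 x *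
    L (shv z.2 x0)) u2 v2) u1 v1 =
     shsum (chain z.2) u1 v1 * shsum (fun x => L (shv z.2 x)) u2 v2.
    by rewrite -shsumMr; apply: eq_shsum => x; rewrite shsumM.
  congr (_ + _).
    rewrite cuts_last; first by rewrite e1 !shsumE mulrC Ltz.
    move=> a b e nb; rewrite e1 L_alt ?mulr0 //.
    apply: pdiff_sub hP; rewrite /= !eqxx -e /unzip2 map_cat.
    exact: suffix_subseq.
  rewrite Y_L -cutsM; apply: eq_cuts => a b e.
  rewrite e1 shsum_chain ?shsumE ?mulrA //.
  suff : pdiff (z :: [:: t] ++ a) by rewrite /pdiff.
  apply: pdiff_sub hP; rewrite /= !eqxx -e /unzip2 map_cat.
  exact: prefix_subseq.
have -> : (fun x => Y (z :: x)) =
    cutl (fun b m c => X (shv m.2 (z :: b)) * chain m.2 c).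
  by apply: funext => x; rewrite /Y cutlE X_nil mul0r add0r.
rewrite shsum_cutl !cutlE addr0; congr (_ + _).
  by apply: eq_cuts => a b _; rewrite !shsumE.
apply: eq_cutl => a m b e; rewrite !cutsE !shsum_nill; congr (_ + _).
  rewrite shsumM shsum_chain //.
  suff : pdiff (m :: [:: t] ++ b) by rewrite /pdiff.
  have : pdiff (t :: m :: b).
    by move: (pdiff_cons hP); rewrite -e; apply: pdiff_cons_catr.
  apply: pdiff_perm; apply/permP => p; rewrite /=; lia.
under eq_shsum => x do rewrite shsum_nill.
rewrite shsumMr -mulNr; congr (_ * _).
(* Alternality of X on the shuffles of t with z a: the sum of those beginning with z is minus the
   one beginning with t. *)
have hm : pdiff (m :: [:: t] ++ z :: a).
  have : pdiff (z :: t :: rcons a m).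
    apply: pdiff_sub hP; rewrite /= !eqxx -e -cat_rcons /unzip2 map_cat.
    exact: prefix_subseq.
  apply: pdiff_perm; apply/permP => p.
  by rewrite /= -cats1 ?count_cat /= ?count_cat /=; lia.
have := falternal_shv X_alt hm.
rewrite shsum_cons shsum_nill => h.
by apply/esym/eqP; rewrite -addr_eq0 addrC; apply/eqP/h.
Qed.

(** Since [path (t :: z :: x)] is 1/(t - z) times [path (z :: x)], the induction hypothesis at z w
    eliminates the derivative of the chain based at z. What is left is [Y_insert], after the
    exchange of t and z in depth 1 allowed by [X_even]. *)
Lemma der_path w : pdiff w -> der X X path w = 0.
Proof.
elim: w => // t [|z w] IH hP.
  by rewrite !der_cons cutsE !cutlE /= X_nil !mul0r subr0 !addr0.
have hzw := pdiff_cons hP.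
have {IH} := IH hzw; rewrite !der_cons.
have eY x : cutl (fun b m c => X (shv m.2 b) * path (addu m (usum b) :: c)) x = Y x.
  by [].
rewrite !eY /path /=.
have -> : der X X (fun x => (t.2 - z.2)^-1 * chain z.2 x) w =
  (t.2 - z.2)^-1 * der X X (chain z.2) w by rewrite derM.
have -> : cuts (fun b c => X (shv z.2 b) * ((t.2 - z.2)^-1 * chain z.2 c)) w =
    (t.2 - z.2)^-1 * cuts (fun b c => X (shv z.2 b) * chain z.2 c) w.
  by rewrite -cutsM; apply: eq_cuts => b c _; rewrite mulrCA.
move=> IH.
have hP' : pdiff (z :: t :: w).
  by apply: pdiff_perm hP; apply/permP => p; rewrite /=; lia.
have {hP'} := Y_insert hP'.
rewrite cutlB -X_even; last first.
  by apply: pdiff_sub hP; rewrite /= !eqxx sub0seq.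
have -> : Y (t :: z :: w) = X (shv z.2 [:: t]) * chain z.2 w +
    cutl (fun a m b => X (shv m.2 (t :: z :: a)) * chain m.2 b) w.
  by rewrite /Y !cutlE X_nil mul0r add0r.
rewrite cutlE cutsE /= X_nil !mul0r !add0r.
have -> : cutl (fun a m b => X (shv m.2 (z :: a)) * ((m.2 - t.2)^-1 * 1 * chain m.2 b)) w
  = - cutl (fun a m b => X (shv m.2 (z :: a)) * ((t.2 - m.2)^-1 * chain m.2 b)) w.
  rewrite -cutlN; apply: eq_cutl => a m b _.
  by rewrite [(m.2 - _)^-1]invr_subC; ring.
rewrite [(z.2 - _)^-1]invr_subC => E.
set A := cuts (fun a b => X (shv t.2 (z :: a)) * chain t.2 b) w in E *.
set B := cutl (fun a m b => X (shv m.2 (t :: z :: a)) * _) w in E *.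
set C := cutl (fun a m b => X (shv m.2 (z :: a)) * _) w in E *.
set U := X _ * _ in E *; set e := (t.2 - z.2)^-1 in E *.
have -> : der X X (chain z.2) w = cuts (fun b c => X (shv z.2 b) * chain z.2 c) w
   - Y (z :: w).
  by apply/eqP; rewrite -subr_eq0; apply/eqP; rewrite -[RHS]IH; ring.
move/eqP: E; rewrite -subr_eq0 => /eqP E.
by rewrite -[RHS]oppr0 -E; ring.
Qed.

Lemma der_chain l w : pdiff (l :: w) ->
  cuts (fun a b => chain l.2 a * L (shv l.2 b)) w =
  cuts (fun b c => X (shv l.2 b) * chain l.2 c) w - der X X (chain l.2) w.
Proof.
move=> hP; have := der_path hP; rewrite der_cons.
have -> : cutl (fun b m c => X (shv m.2 b) * path (addu m (usum b) :: c))
  (l :: w) = Y (l :: w) by [].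
rewrite Y_L /= => h; apply/eqP; rewrite -subr_eq0 -[0]h; apply/eqP; ring.
Qed.

End DerChain.

End ChainIdentity.

(** * Conjugation of the derivations *)

Section IlModel.
Variable K : comUnitRingType.
Local Notation letter := (K * K)%type.
Local Notation word := (seq (K * K)).
Implicit Types (l m k t : letter) (w a b c x y z : word) (M N X : word -> K).

Definition vfree M := forall w w', unzip1 w = unzip1 w' -> M w = M w'.
Definition ufree M := forall w w', unzip2 w = unzip2 w' -> M w = M w'.

Lemma unzip1_shv e w : unzip1 (shv e w) = unzip1 w.
Proof. by rewrite /unzip1 /shv -map_comp. Qed.

Lemma unzip2_shv e w : unzip2 (shv e w) = [seq v - e | v <- unzip2 w].
Proof. by rewrite /unzip2 /shv -!map_comp. Qed.

Lemma derDN N1 N1' N2 N2' M w :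
  der (fun z => N1 z + N2 z) (fun z => N1' z + N2' z) M w =
  der N1 N1' M w + der N2 N2' M w.
Proof.
elim: w M => [|l w IH] M; first by rewrite addr0.
rewrite !der_cons IH.
under eq_cuts => b c _ do rewrite mulrDl.
under eq_cutl => b m c _ do rewrite mulrDl.
rewrite cutsD cutlD; ring.
Qed.

(** M does not see the added u's, so inserting N after a letter cancels against inserting it before
    the next one; only the insertions at the two ends of the word remain. *)
Lemma der_flie N M w : (forall e z, N (shv e z) = N z) -> ufree M ->
  der N N M w = flie N M w.
Proof.
move=> hN; rewrite /flie /fmul; elim: w M => [|l w IH] M hM.
  by rewrite !cutsE mulrC subrr.
rewrite der_cons IH; last by move=> z z' e; apply: hM => /=; rewrite e.
have -> : cuts (fun b c => N (shv l.2 b) * M (addu l (usum b) :: c)) w =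
          cuts (fun b c => N b * M (l :: c)) w.
  by apply: eq_cuts => b c _; rewrite hN (hM _ (l :: c)).
have -> : cutl (fun b m c => N (shv m.2 b) * M (addu m (usum b) :: c)) (l :: w) =
          cuts (fun b c => N b * M c) (l :: w) - N (l :: w) * M [::].
  rewrite cuts_split addrK; apply: eq_cutl => b m c _.
  by rewrite hN (hM _ (m :: c)).
rewrite [cuts (fun a b => M a * N b) _]cutsE.
by rewrite [M [::] * _]mulrC; ring.
Qed.

(** A block l b m collapses to one letter, either into m through N or into l through N'. M sees only
    the total u of the block, so the two terms cancel as soon as their coefficients agree. *)
Lemma der_eq0_push N N' M w : N [::] = 0 -> N' [::] = 0 ->
  (forall l b m, N' (shv l.2 (rcons b m)) = N (shv m.2 (l :: b))) ->
  vfree M -> der N N' M w = 0.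
Proof.
move=> N0 N'0 hN; elim: w M => // l w IH M hM.
rewrite der_cons IH; last by move=> z z' e; apply: hM => /=; rewrite e.
rewrite cuts_rcons cutlE /= N0 N'0 !mul0r !add0r.
rewrite addrC -cutlB (eq_cutl (F' := fun _ _ _ => 0)) ?cutl0 // => b m c _.
rewrite hN (hM _ (addu m (usum (l :: b)) :: c)) ?subrr //=.
congr (_ :: _); rewrite -cats1 usum_cat !usum_cons usum_nil /=; ring.
Qed.

(** For M in the v's only: the v's v_1, ..., v_n become -v_n, v_1 - v_n, ..., v_(n-1) - v_n, the
    cyclic shift of the points 0, v_1, ..., v_n up to translation. The letter 0 in front is supplied
    by [belast 0]. *)
Definition push M w := M (shv (last 0 w).2 (belast 0 w)).

Lemma push_shv M l w : ufree M ->
  push M (shv l.2 w) = M (shv (last l w).2 (belast l w)).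
Proof.
move=> hM; apply: hM; case/lastP: w => [|w m] //.
rewrite [shv l.2 _]map_rcons -/(shv l.2 w) !last_rcons !belast_rcons /=.
rewrite shv_shv /unzip2 /= -/(unzip2 _) -/(unzip2 _) !unzip2_shv.
congr (_ :: _); first by ring.
by apply: eq_map => v; ring.
Qed.

Lemma push_rcons M l b m : ufree M ->
  push M (shv l.2 (rcons b m)) = M (shv m.2 (l :: b)).
Proof. by move=> hM; rewrite push_shv // last_rcons belast_rcons. Qed.

Lemma push_nil M : push M [::] = M [::].
Proof. by []. Qed.

Lemma subst_if_nil q (e : K) w :
  subst q (fun d => if d is [::] then e else 0) w = if w is [::] then e else 0.
Proof.
case: w => // l w; rewrite subst_cons -[RHS](cuts0 K w).
apply: eq_cuts => c r _; rewrite (eq_subst q r (M' := fun z => 0 * 0)) ?substM.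
  by rewrite mul0r mulr0.
by move=> z; rewrite mul0r.
Qed.

(** Both sides are the image under G of one function, expanded along the last letter on the left and
    along the first letter on the right. *)
Lemma subst_push M l w : ufree M ->
  cutl (fun b m c => subst chain M (shv m.2 b) * chain m.2 c) (l :: w) =
  cuts (fun a b => chain l.2 a * subst chain (push M) (shv l.2 b)) w.
Proof.
move=> hM.
pose N := cutl (fun b m d => if d is [::] then M (shv m.2 b) else 0).
have NE k z : N (k :: z) = M (shv (last k z).2 (belast k z)).
  rewrite /N; case/lastP: z => [|z m].
    by rewrite !cutlE addr0.
  rewrite last_rcons belast_rcons -rcons_cons cutl_rcons_arg.
  rewrite (eq_cutl (F' := fun _ _ _ => 0)) ?cutl0 ?add0r // => b u v _.
  by case: v.
transitivity (subst chain N (l :: w)).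
  rewrite subst_cutl; apply: eq_cutl => b m c _.
  (* Nothing may follow the marked letter in the support of the function, so m absorbs all of c. *)
  rewrite cuts_last => [|a r e nr].
    rewrite mulrC; congr (_ * _); rewrite -subst_shv; last exact: chain_shv.
    by apply: eq_subst => z; rewrite subst_nil.
  under eq_subst => z do rewrite subst_if_nil.
  rewrite (eq_subst chain b (M' := fun z => 0 * 0)) ?substM ?mul0r ?mulr0 //.
  by move=> z; case: (r) nr.
rewrite subst_cons; apply: eq_cuts => a b _; congr (_ * _).
rewrite -subst_shv; last exact: chain_shv.
apply: eq_subst => z; rewrite push_shv // NE; apply: hM.
case/lastP: z => [|z m]; first by [].
by rewrite !last_rcons !belast_rcons.
Qed.

Definition sgw w : K := (-1) ^+ size w.

Lemma sgw_cons l w : sgw (l :: w) = - sgw w.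
Proof. by rewrite /sgw /= exprS mulN1r. Qed.

Lemma sgw_cat a b : sgw (a ++ b) = sgw a * sgw b.
Proof. by rewrite /sgw size_cat exprD. Qed.

Lemma sgw_sq w : sgw w * sgw w = 1.
Proof. by rewrite /sgw -expr2 sqrr_sign. Qed.

Definition negv l : letter := (l.1, - l.2).

Lemma pdiff_negv w : pdiff (map negv w) = pdiff w.
Proof.
rewrite /pdiff pairwise_map; apply: eq_pairwise => l m /=.
by rewrite -[RHS]unitrN; congr (_ \is a _); ring.
Qed.

(** By the assumed relation [push M] is M after reversal of the word and negation of the v's, which
    preserve stuffles with a letter. Negation changes the sign of the divided differences; the words
    in them are shorter by one letter, so the sign [sgw] compensates. *)
Lemma stsum_push M t y : falternil M ->
  (forall w, push M w = - sgw w * M (map negv (rev w))) ->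
  pdiff (t :: y) -> y <> [::] -> stsum (push M) [:: t] y = 0.
Proof.
move=> hM hp hP ny.
have -> : stsum (push M) [:: t] y = sgw y * stsum M [:: negv t] (map negv (rev y)).
  rewrite !stsum_letter cuts_map cutl_map cuts_rev cutl_rev mulrDr -cutsM -cutlM.
  congr (_ + _).
    apply: eq_cuts => a b <-; rewrite hp !sgw_cat sgw_cons mulrN opprK.
    by rewrite rev_cat rev_cons map_cat map_rcons cat_rcons.
  apply: eq_cutl => a m b <-.
  rewrite !hp !(sgw_cat, sgw_cons) !rev_cat !rev_cons !map_cat !map_rcons !cat_rcons.
  have -> : (negv t).2 - (negv m).2 = - (t.2 - m.2) by rewrite /=; ring.
  rewrite invrN; set A := M (_ ++ negv (addu t _) :: _).
  set B := M (_ ++ negv (addu m _) :: _); rewrite -/A -/B.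
  ring.
rewrite hM ?mulr0 //; last by case: (y) ny => // k z _; rewrite rev_cons map_rcons; case: (map _ _).
suff : pdiff (map negv (t :: rev y)) by [].
rewrite pdiff_negv; apply: pdiff_perm hP.
by rewrite perm_cons perm_sym perm_rev.
Qed.

Lemma subst_push_alt M : ufree M -> falternil M ->
  (forall w, push M w = - sgw w * M (map negv (rev w))) ->
  forall l t w, pdiff (l :: t :: w) -> w <> [::] ->
  shsum (fun x => subst chain (push M) (shv l.2 x)) [:: t] w = 0.
Proof.
move=> uM hM hp l t w hP nw; rewrite shsum_shv.
have hP' : pdiff (shv l.2 (t :: w)) by rewrite pdiff_shv; apply: pdiff_cons hP.
rewrite shsum_subst_chain; last by [].
rewrite subst2_consl cutsE /subst2 subst_nil mul1r.
rewrite usum_nil addu0; apply: subst_eq0 => [|z nz sz]; first by case: (w) nw.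
apply: stsum_push => //; apply: pdiff_sub hP'.
by rewrite /= eqxx.
Qed.

(* The derivation attached by uri to a summand of iota A: N is A itself and N'
   = N, or N is swap A + C and N' its push. *)
Lemma subst_der_ufree N M w : vfree N -> pdiff w ->
  subst chain (der N N M) w =
  der (subst chain N) (subst chain N) (subst chain M) w.
Proof.
move=> hN hP; apply: subst_der hP; first exact: chain_shv.
have hX e z : subst chain N (shv e z) = subst chain N z.
  rewrite -subst_shv; last exact: chain_shv.
  by apply: eq_subst => x; apply: hN; rewrite unzip1_shv.
move=> l z _; rewrite der_flie; last 2 first.
- exact: hX.
- move=> x x' e; elim: x x' e (l.2) => [|k x IH] [|k' x'] //= [e1 e2] p.
  by rewrite e1 (IH x').
rewrite /flie /fmul.
under eq_cuts => a b _ do rewrite hX.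
under [X in _ = X - _]eq_cuts => a b _ do rewrite hX.
by rewrite opprB addrC subrK.
Qed.

(** The hypothesis of [subst_der] is here [der_chain], with L the image under G of [push N]. *)
Lemma subst_der_push N M w :
    ufree N -> falternil N -> N [::] = 0 ->
    (forall w, push N w = - sgw w * N (map negv (rev w))) ->
    (forall l m, l.2 = - m.2 -> N [:: l] = N [:: m]) ->
  pdiff w -> subst chain (der N (push N) M) w =
  der (subst chain N) (subst chain N) (subst chain M) w.
Proof.
move=> uN hN N0 hp he hP; apply: subst_der hP; first exact: chain_shv.
apply: (@der_chain _ _ (subst chain (push N))).
- by rewrite subst_nil.
- exact: falternal_subst.
- move=> t z _; rewrite /= !subst_cons !cutsE !subst_nil /= !mul1r.
  by apply: he => /=; ring.
- by move=> z t x hP nx; apply: subst_push_alt.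
- by move=> z x; apply: subst_push.
Qed.

Definition fari M N w := der N N M w - der M M N w + flie M N w.

Lemma fmulDl M M' N w : fmul (fun z => M z + M' z) N w = fmul M N w + fmul M' N w.
Proof. by rewrite /fmul -cutsD; apply: eq_cuts => a b _; rewrite mulrDl. Qed.
Lemma fmulDr M N N' w : fmul M (fun z => N z + N' z) w = fmul M N w + fmul M N' w.
Proof. by rewrite /fmul -cutsD; apply: eq_cuts => a b _; rewrite mulrDr. Qed.

Lemma subst_fmul q M N w :
  subst q (fmul M N) w = fmul (subst q M) (subst q N) w.
Proof.
rewrite subst_cuts; apply: eq_cuts => a b _.
by under eq_subst => z do rewrite substM; rewrite substMr.
Qed.

(* A functional model of an element A of ARI_al*il: M and M' stand for the
   values of A and of swap A + C. *)
Record al_il M M' : Prop := AlIl {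
  al_vfree : vfree M;
  al_nil : M [::] = 0;
  il_ufree : ufree M';
  il_nil : M' [::] = 0;
  il_alternil : falternil M';
  il_push : forall w, push M' w = - sgw w * M' (map negv (rev w));
  il_even : forall l m, l.2 = - m.2 -> M' [:: l] = M' [:: m] }.

(** The term E of the overview: what the moulds in the v's contribute to the bracket. *)
Definition il_part M' N' w :=
  der N' (push N') M' w - der M' (push M') N' w + flie M' N' w.

(** The derivation of N maps M' to the commutator of N and M' ([der_flie]), and that of N' kills M
    ([der_eq0_push]); likewise with the roles exchanged. The commutators so obtained cancel the
    mixed terms of [flie]. *)
Lemma subst_fari M M' N N' w : al_il M M' -> al_il N N' -> pdiff w ->
  fari (subst chain (fun z => M z + M' z)) (subst chain (fun z => N z + N' z)) w =
  subst chain (fun z => fari M N z + il_part M' N' z) w.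
Proof.
move=> hM hN hP.
have half A A' B B' : al_il A A' -> al_il B B' ->
  der (subst chain (fun z => B z + B' z)) (subst chain (fun z => B z + B' z))
    (subst chain (fun z => A z + A' z)) w =
  subst chain (fun z => der B B A z + flie B A' z + der B' (push B') A' z) w.
  move=> [vA A0 uA' A'0 altA hpA eA] [vB B0 uB' B'0 altB hpB eB].
  have -> : subst chain (fun z => B z + B' z) =
     fun z => subst chain B z + subst chain B' z.
    by apply: funext => z; rewrite substD.
  rewrite derDN -subst_der_ufree // -subst_der_push // -substD.
  apply: eq_subst => z; rewrite !derD (der_flie _ _ uA'); last first.
    by move=> e x; apply: vB; rewrite unzip1_shv.
  rewrite (der_eq0_push _ B'0) ?add0r ?push_nil // => l b m.
  exact: push_rcons.
rewrite /fari !half // -substB.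
have -> : flie (subst chain (fun z => M z + M' z))
    (subst chain (fun z => N z + N' z)) w =
  subst chain (flie (fun z => M z + M' z) (fun z => N z + N' z)) w.
  by rewrite /flie substB !subst_fmul.
rewrite -substD; apply: eq_subst => z.
rewrite /il_part /flie !fmulDl !fmulDr; ring.
Qed.

End IlModel.

(** * Swap *)

Section Swap.
Variable K : comUnitRingType.
Local Notation letter := (K * K)%type.
Local Notation word := (seq (K * K)).
Implicit Types (l m k t : letter) (w a b c x y z : word) (M N X : word -> K).
Implicit Types (p e : K).

(** The shape in which [arit] is defined, used to identify the two in [arit_nice]. *)
Lemma der_global N N' M w : der N N' M w =
  cuts (fun a z => cutl (fun b m c =>
    N (shv m.2 b) * M (a ++ addu m (usum b) :: c)) z) w
  - cutl (fun a l z => cuts (fun b c =>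
    N' (shv l.2 b) * M (a ++ addu l (usum b) :: c)) z) w.
Proof.
elim: w M => [|l w IH] M; first by rewrite cutsE !cutlE subrr.
by rewrite der_cons IH [in RHS]cutsE [X in _ = _ - X]cutlE; ring.
Qed.

Definition hdv p w : K := (head (0, p) w).2.

(* The u's of swap_word w, in reverse order: see swap_word_steps. *)
Fixpoint steps p w : word :=
  if w is l :: w' then (l.2 - hdv p w', 0) :: steps p w' else [::].

Lemma hdv_cat p a b : hdv p (a ++ b) = hdv (hdv p b) a.
Proof. by case: a. Qed.

Lemma steps_cat p a b : steps p (a ++ b) = steps (hdv p b) a ++ steps p b.
Proof. by elim: a => //= l a ->; rewrite hdv_cat. Qed.

Lemma size_steps p w : size (steps p w) = size w.
Proof. by elim: w => //= l w ->. Qed.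

Lemma usum_steps p w : usum (steps p w) = hdv p w - p.
Proof.
elim: w => [|l w IH]; first by rewrite usum_nil /hdv /= subrr.
by rewrite usum_cons IH /hdv /=; ring.
Qed.

Lemma steps_shv e p w : steps (p - e) (shv e w) = steps p w.
Proof.
elim: w => //= l w ->; congr ((_, _) :: _); case: w => [|k w]; rewrite /hdv /=; ring.
Qed.

Lemma steps0_shv p w : steps 0 (shv p w) = steps p w.
Proof. by rewrite -[in RHS](steps_shv p) subrr. Qed.

Lemma steps_ufree p w w' : unzip2 w = unzip2 w' -> steps p w = steps p w'.
Proof.
elim: w w' => [|l w IH] [|l' w'] //= [-> e]; rewrite (IH w') //.
by congr ((_ - _, _) :: _); case: w w' {IH} e => [|k w] [|k' w'] //= [].
Qed.

Lemma cuts_steps (F : word -> word -> K) p w :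
  cuts F (steps p w) = cuts (fun a b => F (steps (hdv p b) a) (steps p b)) w.
Proof.
elim: w F => [|l w IH] F; rewrite /= !cutsE // IH; congr (_ + _).
by apply: eq_cuts => a b e; rewrite /= -e hdv_cat.
Qed.

Lemma cutl_steps (F : word -> letter -> word -> K) p w :
  cutl F (steps p w) =
  cutl (fun a m b => F (steps m.2 a) (m.2 - hdv p b, 0) (steps p b)) w.
Proof.
elim: w F => [|l w IH] F; rewrite /= !cutlE // IH; congr (_ + _).
by apply: eq_cutl => a m b e; rewrite /= -e hdv_cat.
Qed.

(** Erasing letters merges the corresponding differences. Passing from the v's to their differences
    thus exchanges absorption by the letter after a block with absorption by the letter before it,
    whence the sign; the two products are the boundary terms, where the block begins or ends the
    word. *)
Lemma der_steps M N w : vfree N -> M [::] = 0 -> N [::] = 0 ->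
  let M' z := M (steps 0 z) in let N' z := N (steps 0 z) in
  der N' (push N') M' w =
  - der N N M (steps 0 w) + fmul N M (steps 0 w) - fmul M' N' w.
Proof.
move=> vN M0 N0 M' N'.
have uM' : ufree M' by move=> z z' e; rewrite /M' (steps_ufree 0 e).
have uN' : ufree N' by move=> z z' e; rewrite /N' (steps_ufree 0 e).
have M'E x m e c : M' (x ++ addu m e :: c) = M' (x ++ m :: c).
  by apply: uM'; rewrite /unzip2 !map_cat.
rewrite !der_global.
(* The erased block b either begins w or follows a letter l; in the second case the difference of l
   absorbs those of b. *)
have -> : cuts (fun a z => cutl (fun b m c => N' (shv m.2 b)
     * M' (a ++ addu m (usum b) :: c)) z) w =
  cutl (fun b m c => N' (shv m.2 b) * M' (m :: c)) w
  + cutl (fun a l z => cutl (fun b m c =>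
     N' (shv m.2 b) * M' (a ++ l :: m :: c)) z) w.
  rewrite cuts_rcons; congr (_ + _).
  apply: eq_cutl => a l z _; apply: eq_cutl => b m c _.
  by rewrite M'E cat_rcons.
have -> : cutl (fun a l z => cuts (fun b c => push N' (shv l.2 b)
     * M' (a ++ addu l (usum b) :: c)) z) w =
  cutl (fun a l z => cutl (fun b m c => N' (shv m.2 (l :: b))
     * M' (a ++ l :: c)) z) w.
  apply: eq_cutl => a l z _; rewrite cuts_rcons push_nil [N' [::]]N0 mul0r add0r.
  by apply: eq_cutl => b m c _; rewrite push_rcons // M'E.
have -> : cuts (fun a z => cutl (fun b m c => N (shv m.2 b)
     * M (a ++ addu m (usum b) :: c)) z) (steps 0 w) =
  cutl (fun a l z => cutl (fun b m c => N' (shv m.2 (l :: b))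
     * M' (a ++ l :: c)) z) w.
  rewrite cuts_steps cuts_split [X in _ + X]cutl_nil addr0.
  apply: eq_cutl => a l z _; rewrite cutl_steps cutlE N0 mul0r add0r.
  apply: eq_cutl => b m c _; congr (_ * _).
    rewrite /N' steps0_shv; apply: vN; exact: unzip1_shv.
  rewrite /addu usum_steps /M' steps_cat /= /hdv /=; congr (M (_ ++ (_, _) :: _)).
  by ring.
have -> : cutl (fun a l z => cuts (fun b c => N (shv l.2 b)
     * M (a ++ addu l (usum b) :: c)) z) (steps 0 w) =
  cutl (fun a l z => cutl (fun b m c =>
     N' (shv m.2 b) * M' (a ++ l :: m :: c)) z) w
  + fmul M' N' w.
  rewrite /fmul cuts_rcons [M' [::]]M0 mul0r add0r cutl_steps -cutlD.
  apply: eq_cutl => a l z _; rewrite cuts_steps.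
  have e1 b c : b ++ c = z ->
    N (shv (l.2 - hdv 0 z, 0 : K).2 (steps (hdv 0 c) b)) * M (steps l.2 a ++
      addu (l.2 - hdv 0 z, 0) (usum (steps (hdv 0 c) b)) :: steps 0 c) =
    N' (shv (hdv 0 c) b) * M' (a ++ l :: c).
    move=> <-; congr (_ * _).
      rewrite /N' steps0_shv; apply: vN; exact: unzip1_shv.
    rewrite /M' steps_cat /=; congr (M (_ ++ _ :: _)).
    by rewrite /addu usum_steps hdv_cat /=; congr (_, _); ring.
  rewrite (eq_cuts e1) cuts_split; congr (_ + _).
  by rewrite [hdv 0 [::]]/hdv /= shv0 cats1 mulrC.
have -> : fmul N M (steps 0 w) = cutl (fun b m c => N' (shv m.2 b) * M' (m :: c)) w.
  rewrite /fmul cuts_steps cuts_split M0 mulr0 addr0.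
  by apply: eq_cutl => b m c _; rewrite /N' steps0_shv.
ring.
Qed.

Lemma il_part_steps M N w : vfree M -> vfree N -> M [::] = 0 -> N [::] = 0 ->
  il_part (fun z => M (steps 0 z)) (fun z => N (steps 0 z)) w =
  - fari M N (steps 0 w).
Proof.
move=> vM vN M0 N0; rewrite /il_part !der_steps // /fari /flie; ring.
Qed.

Definition fconst M := forall w w', size w = size w' -> M w = M w'.

Lemma fconst_vfree M : fconst M -> vfree M.
Proof.
by move=> h w w' e; apply: h; rewrite -(size_map fst) -[RHS](size_map fst) -/(unzip1 w) e.
Qed.

Lemma fconst_ufree M : fconst M -> ufree M.
Proof.
by move=> h w w' e; apply: h; rewrite -(size_map snd) -[RHS](size_map snd) -/(unzip2 w) e.
Qed.

Lemma fconst_shv M e w : fconst M -> M (shv e w) = M w.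
Proof. by apply; rewrite size_map. Qed.

Lemma der_fconst N M w : fconst N -> N [::] = 0 -> vfree M -> der N N M w = 0.
Proof.
move=> cN N0 vM; apply: der_eq0_push => // l b m; apply: cN.
by rewrite !size_map size_rcons.
Qed.

Lemma flieC M N w : flie M N w = - flie N M w.
Proof. by rewrite /flie opprB. Qed.

(** Constants equal their own cyclic shifts, so their derivations kill moulds in the u's. The
    derivation of a mould in the u's maps a constant to a commutator, which cancels one from
    [flie]. *)
Lemma fari_const M N C D w : vfree M -> vfree N -> fconst C -> fconst D ->
  C [::] = 0 -> D [::] = 0 ->
  fari (fun z => M z + C z) (fun z => N z + D z) w = fari M N w.
Proof.
move=> vM vN cC cD C0 D0.
have shM e z : M (shv e z) = M z by apply: vM; rewrite unzip1_shv.
have shN e z : N (shv e z) = N z by apply: vN; rewrite unzip1_shv.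
have CD : flie D C w = 0.
  rewrite -der_flie; first exact/der_fconst/fconst_vfree.
    by move=> e z; apply: fconst_shv.
  exact: fconst_ufree.
rewrite /fari !derDN !derD !(@der_fconst C) // ?(@der_fconst D) //;
  try exact: fconst_vfree.
rewrite !(@der_flie _ _ C) ?(@der_flie _ _ D) //; try exact: fconst_ufree.
have -> : flie (fun z => M z + C z) (fun z => N z + D z) w =
   flie M N w + flie M D w - flie N C w - flie D C w.
  by rewrite /flie !fmulDl !fmulDr; ring.
rewrite CD; ring.
Qed.

Lemma der_sgw N N' M w :
  der (fun z => - sgw z * N z) (fun z => - sgw z * N' z)
    (fun z => - sgw z * M z) w = sgw w * der N N' M w.
Proof.
elim: w M => [|l w IH] M; first by rewrite mulr0.
rewrite !der_cons.
have -> : der (fun z => - sgw z * N z) (fun z => - sgw z * N' z)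
   (fun z => - sgw (l :: z) * M (l :: z)) w = - (sgw w * der N N' (fun z => M (l :: z)) w).
  by rewrite -IH -derN; apply: eq_der => z; rewrite sgw_cons; ring.
rewrite sgw_cons mulrDr mulrBr -cutsM -cutlM; congr (_ - _ + _).
- by ring.
- apply: eq_cuts => b c <-; rewrite sgw_cat !sgw_cons.
  by rewrite /sgw size_map; ring.
- apply: eq_cutl => b m c e; rewrite -(sgw_cons l w) -e sgw_cat !sgw_cons.
  by rewrite /sgw size_map; ring.
Qed.

Lemma fmul_sgw M N w :
  fmul (fun z => - sgw z * M z) (fun z => - sgw z * N z) w = sgw w * fmul M N w.
Proof.
by rewrite /fmul -cutsM; apply: eq_cuts => a b <-; rewrite sgw_cat; ring.
Qed.

Lemma fari_sgw M N w :
  fari (fun z => - sgw z * M z) (fun z => - sgw z * N z) w = sgw w * fari M N w.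
Proof. by rewrite /fari /flie !der_sgw !fmul_sgw; ring. Qed.

(** The sum telescopes: a shuffle of rev a x with b begins with the head of one of the two, and
    moving that head from b to rev a changes the sign. The word x carries the induction; at x = [::]
    this is the antipode identity. *)
Lemma shsum_antipode M x y :
  cuts (fun a b => sgw a * shsum M (rev a ++ x) b) y =
  if x is l :: x' then shsum (fun z => M (l :: z)) x' y
  else if y is [::] then M [::] else 0.
Proof.
elim: y x => [|k y IH] x.
  rewrite cutsE /sgw expr0 mul1r /rev /=.
  by case: x => [|l x]; rewrite !shsumE.
rewrite cutsE.
have -> : cuts (fun a b => sgw (k :: a) * shsum M (rev (k :: a) ++ x) b) y =
  - cuts (fun a b => sgw a * shsum M (rev a ++ k :: x) b) y.
  rewrite -cutsN; apply: eq_cuts => a b _.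
  by rewrite sgw_cons rev_cons cat_rcons mulNr.
rewrite IH /sgw expr0 mul1r /rev /=.
by case: x => [|l x]; rewrite !shsumE ?subrr ?addrK.
Qed.

(** All proper shuffles in the antipode identity vanish, which leaves its two extreme cuts. *)
Lemma falternal_rev M w : falternal xpredT M -> M [::] = 0 ->
  M (rev w) = - sgw w * M w.
Proof.
move=> hM M0; case: w => [|l w]; first by rewrite /rev /= M0 mulr0.
have := shsum_antipode M [::] (l :: w); rewrite cutsE.
rewrite cuts_last => [|a b e nb]; last first.
  rewrite hM ?mulr0 // cats0 rev_cons.
  by case: (rev a).
rewrite shsumE /= !shsumE cats0 /sgw expr0 mul1r -/(sgw _) => /eqP.
rewrite addrC addr_eq0 => /eqP h.
by rewrite mulNr -[in RHS](opprK (M _)) -h mulrN mulrA sgw_sq mul1r opprK.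
Qed.

Lemma falternal_fari (P : pred word) M N :
  (forall a b, perm_eq a b -> P a -> P b) ->
  (forall a b, subseq (unzip2 a) (unzip2 b) -> P b -> P a) ->
  M [::] = 0 -> N [::] = 0 ->
  (forall m a b, P (m :: a ++ b) -> a <> [::] -> b <> [::] ->
     shsum (fun z => M (shv m.2 z)) a b = 0) ->
  (forall m a b, P (m :: a ++ b) -> a <> [::] -> b <> [::] ->
     shsum (fun z => N (shv m.2 z)) a b = 0) ->
  falternal P M -> falternal P N -> falternal P (fari M N).
Proof.
move=> hp hs M0 N0 sM sN hM hN x y hP nx ny.
rewrite /fari shsumD shsumB (falternal_der hp hs N0) //.
by rewrite (falternal_der hp hs M0) // (falternal_flie hp hs) // subrr addr0.
Qed.

Lemma falternal_fari_vfree M N : vfree M -> vfree N ->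
  M [::] = 0 -> N [::] = 0 ->
  falternal xpredT M -> falternal xpredT N -> falternal xpredT (fari M N).
Proof.
move=> vM vN M0 N0 hM hN; apply: falternal_fari => // m a b _ na nb.
- rewrite -(hM a b) //; apply: eq_shsum => z; apply: vM; exact: unzip1_shv.
- rewrite -(hN a b) //; apply: eq_shsum => z; apply: vN; exact: unzip1_shv.
Qed.

(* M stands for an alternal mould, swap_part M C for swap M + C. *)
Definition swap_part M C w := - sgw w * M (steps 0 w) + C w.

(** In terms of differences the constants drop out ([fari_const]) and the signs combine into one
    ([fari_sgw]), which the antipode of the alternal function [fari M N] turns into a reversal. *)
Lemma il_part_swap M N C D w : vfree M -> vfree N ->
  M [::] = 0 -> N [::] = 0 -> C [::] = 0 -> D [::] = 0 ->
  fconst C -> fconst D -> falternal xpredT M -> falternal xpredT N ->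
  il_part (swap_part M C) (swap_part N D) w = fari M N (rev (steps 0 w)).
Proof.
move=> vM vN M0 N0 C0 D0 cC cD hM hN.
pose M1 z := - sgw z * M z + C z; pose N1 z := - sgw z * N z + D z.
have sgE z : sgw (steps 0 z) = sgw z by rewrite /sgw size_steps.
have -> : swap_part M C = fun z => M1 (steps 0 z).
  apply: funext => z; rewrite /M1 /swap_part sgE; congr (_ + _).
  by apply: cC; rewrite size_steps.
have -> : swap_part N D = fun z => N1 (steps 0 z).
  apply: funext => z; rewrite /N1 /swap_part sgE; congr (_ + _).
  by apply: cD; rewrite size_steps.
have v1 E : vfree E -> vfree (fun z => - sgw z * E z).
  move=> vE z z' e; rewrite (vE _ z') //; congr (- _ * _).
  by rewrite /sgw -(size_map fst z) -/(unzip1 z) e size_map.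
have v2 E F : vfree E -> fconst F -> vfree (fun z => - sgw z * E z + F z).
  move=> vE cF z z' e; congr (_ + _); first exact: v1.
  exact: (fconst_vfree cF).
rewrite il_part_steps; first last.
- by rewrite /N1 N0 mulr0 D0 addr0.
- by rewrite /M1 M0 mulr0 C0 addr0.
- exact: v2.
- exact: v2.
rewrite (fari_const _ (v1 _ vM) (v1 _ vN)) // fari_sgw -mulNr.
rewrite falternal_rev //; first exact: falternal_fari_vfree.
by rewrite /fari /flie /fmul !cutsE /= M0 N0 !mul0r !subrr addr0.
Qed.

Fixpoint drops p w : word :=
  if w is l :: w' then (p - l.2, 0) :: drops l.2 w' else [::].

Lemma steps_drops p l w : steps p (l :: w) = drops l.2 (rcons w (0, p)).
Proof.
elim: w l => [|k w IH] l //=.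
by rewrite -/(steps p (k :: w)) IH.
Qed.

Lemma size_drops p w : size (drops p w) = size w.
Proof. by elim: w p => //= l w IH p; rewrite IH. Qed.

Lemma drops_shv e p w : drops (p - e) (shv e w) = drops p w.
Proof. elim: w p => //= l w IH p; rewrite IH; congr ((_, _) :: _); ring. Qed.

Lemma drops_ufree p w w' : unzip2 w = unzip2 w' -> drops p w = drops p w'.
Proof. by elim: w w' p => [|l w IH] [|l' w'] p //= [-> e]; rewrite (IH w'). Qed.

Lemma drops_rev p q w : rev (drops p (rcons w (0, q))) =
  drops (- q) (rcons (map (@negv K) (rev w)) (0, - p)).
Proof.
elim: w p => [|l w IH] p; first by rewrite /= /rev /=; congr [:: (_, _)]; ring.
rewrite /= rev_cons IH rev_cons map_rcons.
have e r x s : drops r (rcons (rcons x (negv l)) (0, s)) =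
  rcons (drops r (rcons x (0, - l.2))) (- l.2 - s, 0).
  by elim: x r => //= k x IHx r; rewrite IHx.
rewrite e; congr (rcons _ (_, _)); ring.
Qed.

(** The differences of the pushed word and those of the reversed, negated word are reversals of each
    other ([drops_rev]), so the relation for M is the antipode. For constants the sign -(-1)^d is
    right only in odd depth d, which is why they have to vanish in even depth. *)
Lemma push_swap_part M C w : falternal xpredT M -> M [::] = 0 ->
  fconst C -> (forall z, sgw z = 1 -> C z = 0) ->
  (forall z, sgw z = 1 \/ sgw z = -1) ->
  push (swap_part M C) w =
  - sgw w * swap_part M C (map (@negv K) (rev w)).
Proof.
move=> hM M0 cC hC hs.
have C0 : C [::] = 0 by apply: hC.
have CE : - sgw w * C w = C w.
  by case: (hs w) => h; [rewrite hC ?mulr0 | rewrite h opprK mul1r].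
case/lastP: w CE => [|w m] CE.
  by rewrite push_nil /swap_part /rev /= M0 C0 !mulr0 addr0 mulr0.
rewrite /push last_rcons belast_rcons /swap_part mulrDr.
rewrite !(cC _ (rcons w m)) ?size_map ?size_rev ?size_rcons // CE; congr (_ + _).
rewrite rev_rcons.
have -> : sgw (map (@negv K) (m :: rev w)) = sgw (rcons w m).
  by rewrite /sgw size_map /= size_rev size_rcons.
have -> : sgw (shv m.2 (0 :: w)) = sgw (rcons w m).
  by rewrite /sgw size_map /= size_rcons.
rewrite mulrA mulrNN sgw_sq mul1r.
have -> : steps 0 (shv m.2 (0 :: w)) = drops 0 (rcons w (0, m.2)).
  rewrite [shv _ _]/= steps_drops -(drops_shv m.2 0); apply: drops_ufree.
  by rewrite /unzip2 /shv !map_rcons /= subrr.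
have -> : steps 0 (map (@negv K) (m :: rev w)) = rev (drops 0 (rcons w (0, m.2))).
  by rewrite drops_rev [map _ _]/= steps_drops oppr0.
rewrite (falternal_rev _ hM) //; congr (- _ * _).
by rewrite /sgw size_drops !size_rcons.
Qed.

Lemma swap_word_steps w : unzip1 (swap_word w) = rev (unzip1 (steps 0 w)).
Proof.
have nthE (s : word) i : (nth 0 (steps 0 s) i).1 =
   if (i < size s)%N then (nth 0 s i).2 - (nth 0 s i.+1).2 else 0.
  elim: s i => [|l s IH] [|i]; rewrite /= ?nth_nil ?IH //.
rewrite /swap_word; apply: (@eq_from_nth _ 0).
  by rewrite size_map size_mkseq size_rev size_map size_steps.
rewrite size_map size_mkseq => i hi.
rewrite (nth_map 0) ?size_mkseq // nth_mkseq //=.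
have hj : (size w - i.+1 < size w)%N.
  by rewrite ltn_subrL (leq_ltn_trans (leq0n i) hi).
rewrite nth_rev ?size_map ?size_steps // (nth_map 0) ?size_steps // nthE hj.
by rewrite subnSK.
Qed.

End Swap.

(** * The Jacobi identity *)

Section Jacobi.
Variable K : comUnitRingType.
Local Notation letter := (K * K)%type.
Local Notation word := (seq (K * K)).
Implicit Types (l m k t : letter) (w a b c x y z : word) (M N A B C : word -> K).

Definition erase w : word := [seq (l.1, 0) | l <- w].

Lemma unzip1_erase w : unzip1 (erase w) = unzip1 w.
Proof. by rewrite /unzip1 -map_comp. Qed.

Lemma vfreeP M : vfree M <-> forall w, M (erase w) = M w.
Proof.
split=> [vM w|h w w' e]; first by apply: vM; rewrite unzip1_erase.
have e1 z : erase z = [seq (u, 0) | u <- unzip1 z] by rewrite -map_comp.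
by rewrite -h -[RHS]h !e1 e.
Qed.

Lemma vfree_shv M e w : vfree M -> M (shv e w) = M w.
Proof. by apply; rewrite unzip1_shv. Qed.

Lemma vfree_der N M : vfree N -> vfree M -> vfree (der N N M).
Proof.
move=> vN vM; apply/vfreeP => w; elim: w M vM => // l w IH M vM.
rewrite [erase _]/= !der_cons -[((l.1, 0) :: erase w)]/(erase (l :: w)).
rewrite cuts_map cutl_map; congr (_ - _ + _).
- rewrite (@eq_der _ _ _ _ (fun z => M (l :: z))); last first.
    by move=> z; apply: vM.
  by apply: IH => z z' e; apply: vM; rewrite /= e.
- apply: eq_cuts => b c _; rewrite !vfree_shv //; congr (_ * _).
    by apply: vN; rewrite unzip1_erase.
  apply: vM; rewrite /= -/(erase c) unzip1_erase; congr (_ + _ :: _).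
  by rewrite /usum big_map.
- apply: eq_cutl => b m c _; rewrite !vfree_shv //; congr (_ * _).
    by apply: vN; rewrite unzip1_erase.
  apply: vM; rewrite /= -/(erase c) unzip1_erase; congr (_ + _ :: _).
  by rewrite /usum big_map.
Qed.

Lemma vfree_fmul M N : vfree M -> vfree N -> vfree (fmul M N).
Proof.
move=> vM vN; apply/vfreeP => w; rewrite /fmul cuts_map.
by apply: eq_cuts => a b _; rewrite -!/(erase _) !(proj1 (vfreeP _)).
Qed.

Lemma vfree_fari M N : vfree M -> vfree N -> vfree (fari M N).
Proof.
move=> vM vN w w' e; rewrite /fari /flie.
by rewrite !(vfree_der _ _ e) // !(vfree_fmul _ _ e).
Qed.

Lemma fmulA A B C w : fmul (fmul A B) C w = fmul A (fmul B C) w.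
Proof.
rewrite /fmul.
under eq_cuts => a b _ do rewrite -cutsMr.
rewrite (cuts_cuts (fun x y b => A x * B y * C b)); apply: eq_cuts => a b _.
by rewrite -cutsM; apply: eq_cuts => c d _; rewrite mulrA.
Qed.

Lemma fmulNl A B w : fmul (fun z => - A z) B w = - fmul A B w.
Proof. by rewrite /fmul -cutsN; apply: eq_cuts => a b _; rewrite mulNr. Qed.
Lemma fmulNr A B w : fmul A (fun z => - B z) w = - fmul A B w.
Proof. by rewrite /fmul -cutsN; apply: eq_cuts => a b _; rewrite mulrN. Qed.

Lemma flie_jacobi A B C w :
  flie A (flie B C) w + flie B (flie C A) w + flie C (flie A B) w = 0.
Proof.
rewrite /flie !fmulDl !fmulDr !fmulNl !fmulNr !fmulA; ring.
Qed.

Lemma flieDr A B C w : flie A (fun z => B z + C z) w = flie A B w + flie A C w.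
Proof. by rewrite /flie fmulDl fmulDr; ring. Qed.
Lemma flieNr A B w : flie A (fun z => - B z) w = - flie A B w.
Proof. by rewrite /flie fmulNl fmulNr; ring. Qed.

Lemma der_fmul N N' A B w :
  der N N' (fmul A B) w = fmul (der N N' A) B w + fmul A (der N N' B) w.
Proof.
rewrite der_cuts -cutsD; apply: eq_cuts => a b _.
by rewrite derMr derM.
Qed.

Lemma der_lie N N' A B w :
  der N N' (flie A B) w = flie (der N N' A) B w + flie A (der N N' B) w.
Proof. by rewrite derB !der_fmul /flie; ring. Qed.

Lemma der_sum_cuts N N' (F : word -> word -> word -> K) x y :
  der N N' (fun z => cuts (F z) x) y = cuts (fun a b => der N N' (fun z => F z a b) y) x.
Proof.
elim: x F => [|l x IH] F.
  by rewrite cutsE; apply: eq_der => z; rewrite cutsE.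
rewrite cutsE -IH -derD; apply: eq_der => z; exact: cuts_cons.
Qed.

Lemma der_sum_cutl N N' (F : word -> word -> letter -> word -> K) x y :
  der N N' (fun z => cutl (F z) x) y =
  cutl (fun a m b => der N N' (fun z => F z a m b) y) x.
Proof.
elim: x F => [|l x IH] F.
  rewrite cutlE -[RHS](mul0r (der N N' (fun=> 0) y)) -derM.
  by apply: eq_der => z; rewrite cutlE mul0r.
rewrite cutlE -IH -derD; apply: eq_der => z; exact: cutl_cons.
Qed.

Lemma exchange_der N N' A B (F : word -> word -> K) x y :
  der N N' (fun a => der A B (F a) y) x = der A B (fun b => der N N' (F^~ b) x) y.
Proof.
elim: x F => [|l x IH] F.
  rewrite -[LHS](mul0r (der A B (fun=> 0) y)) -derM.
  by apply: eq_der => z; rewrite mul0r.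
rewrite der_cons IH.
under [RHS]eq_der => b do rewrite der_cons.
rewrite derD derB der_sum_cuts der_sum_cutl.
by congr (_ - _ + _); [apply: eq_cuts => b c _ | apply: eq_cutl => b m c _];
  rewrite derM.
Qed.

Section Commutator.
Variables B C : word -> K.
Hypotheses (vB : vfree B) (vC : vfree C).

Let E := fari B C.
(** The defect of the commutator formula is itself a derivation ([D_cuts]), so it is controlled by
    depth 1. *)
Let D M w := der C C (der B B M) w - der B B (der C C M) w - der E E M w.

Let D_cuts F w : D (cuts F) w = cuts (fun a b => D (F^~ b) a + D (F a) b) w.
Proof.
have e A A' : der A A (cuts F) =
    cuts (fun a b => der A A (F^~ b) a + der A A (F a) b).
  by apply: funext => z; rewrite der_cuts.
rewrite /D !der_cuts !e // !der_cuts -!cutsB; apply: eq_cuts => a b _.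
rewrite !derD (exchange_der C C B B F a b) (exchange_der B B C C F a b); ring.
Qed.

(** Being independent of the u's, this constant is mapped to commutators by the derivations in
    question, which reduces [D_one] to the Jacobi identity of [flie]. *)
Let one w : K := (size w == 1)%:R.

Let D_one w : D one w = 0.
Proof.
have cone : ufree one.
  by apply: fconst_ufree => z z' e; rewrite /one e.
have h A : vfree A -> der A A one = flie A one.
  move=> vA; apply: funext => z; apply: der_flie => // e x.
  exact: vfree_shv.
have vE : vfree E by apply: vfree_fari.
rewrite /D !h // !der_lie !h //.
have -> : flie E one w = flie (der C C B) one w - flie (der B B C) one w
    + flie (flie B C) one w.
  by rewrite /E /fari /flie !fmulDl !fmulDr !fmulNl !fmulNr; ring.
have := flie_jacobi B C one w.
rewrite (flieC one) => /eqP; rewrite subr_eq0 => /eqP <-.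
have -> : flie C (flie one B) w = - flie C (flie B one) w.
  by rewrite -flieNr; congr flie; apply: funext => z; rewrite flieC.
ring.
Qed.

(** Off the empty word, M is cut into its first letter and the rest. On one letter a mould in the
    u's is a function of the total u times [one]; the total u is preserved, so D vanishes there by
    [D_one], and the rest is shorter. *)
Lemma der_commutator M w : vfree M ->
  der C C (der B B M) w - der B B (der C C M) w = der (fari B C) (fari B C) M w.
Proof.
move=> vM; apply/eqP; rewrite -subr_eq0; apply/eqP; rewrite -/E -/(D M w).
elim/word_ind: w M vM => w IH M vM.
pose F a b : K := if a is [:: l] then M (l :: b) else 0.
have D_nil a N : (forall z, z <> [::] -> N z = 0) -> D N a = 0.
  move=> hN; have h A1 z : der A1 A1 N z = 0 by apply: der_eq0 => x nx _; apply: hN.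
  by rewrite /D h !der_eq0 ?subrr.
have D0 a : D (fun=> 0) a = 0 by apply: D_nil.
have DD M1 M2 a : D (fun z => M1 z + M2 z) a = D M1 a + D M2 a.
  have e A : der A A (fun z => M1 z + M2 z) = fun z => der A A M1 z + der A A M2 z.
    by apply: funext => z; rewrite derD.
  by rewrite /D !e !derD; ring.
have -> : M = fun z => cuts F z + (if z is [::] then M z else 0).
  apply: funext => -[|l z]; rewrite cutsE [F [::] _]/F add0r //.
  by rewrite addr0 cuts_head // => -[].
rewrite DD [X in _ + X]D_nil ?addr0; last by case.
rewrite D_cuts -[RHS](cuts0 K w); apply: eq_cuts => a b e.
have -> : D (F^~ b) a = 0.
  have -> : F^~ b = fun z => M ((usum z, 0) :: b) * one z.
    apply: funext => -[|l [|k z]]; rewrite /F /one ?mulr0 //= mulr1.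
    by apply: vM; rewrite /= usum_cons usum_nil addr0.
  have e1 A1 (N : word -> K) : der A1 A1 (fun z => M ((usum z, 0) :: b) * N z) =
      fun z => M ((usum z, 0) :: b) * der A1 A1 N z.
    apply: funext => z.
    by rewrite (der_usum A1 A1 (fun s x => M ((s, 0) :: b) * N x)) derM.
  by rewrite /D !e1 -!mulrBr -/(D one a) D_one mulr0.
rewrite add0r; case: a e => [|l [|k a]] e; rewrite /F ?D0 //.
apply: IH => [|z z' e']; first by rewrite -e.
by apply: vM; rewrite /= e'.
Qed.

End Commutator.

(** After [der_commutator] the second derivatives cancel in the cyclic sum, and the terms without
    derivative form the Jacobi identity of [flie]. *)
Lemma fari_jacobi A B C w : vfree A -> vfree B -> vfree C ->
  fari A (fari B C) w + fari B (fari C A) w + fari C (fari A B) w = 0.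
Proof.
move=> vA vB vC.
have e P Q R : vfree P -> vfree Q -> vfree R -> fari P (fari Q R) w =
  (der R R (der Q Q P) w - der Q Q (der R R P) w)
  - (der P P (der R R Q) w - der P P (der Q Q R) w
      + (flie (der P P Q) R w + flie Q (der P P R) w))
  + (flie P (der R R Q) w - flie P (der Q Q R) w + flie P (flie Q R) w).
  move=> vP vQ vR; rewrite [LHS]/fari -der_commutator //.
  rewrite -[X in _ - X + _]/(der P P (fun z => der R R Q z - der Q Q R z + flie Q R z) w).
  rewrite derD derB der_lie.
  rewrite -[X in _ + X = _]/(flie P (fun z => der R R Q z - der Q Q R z + flie Q R z) w).
  by rewrite flieDr flieDr flieNr.
rewrite !e //.
have := flie_jacobi A B C w => /eqP; rewrite addr_eq0 => /eqP h.
rewrite -[flie C (flie A B) w]opprK -h.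
rewrite ![flie (der _ _ _) _ _]flieC; ring.
Qed.

End Jacobi.

(** * Substitution in rational functions *)

Section Points.
Variable R : comNzRingType.

Section DefinedOn.
Variables (m : nat) (X : forall n, ('I_m -> ratfun R n) -> Prop).

(* On the fractions f that are rdef, rsubst is a ring morphism at the points of
   X; elsewhere it may take the junk value 0. *)
Definition rdef (f : ratfun R m) := exists p q : {mpoly R[m]},
  [/\ GRing.lreg q, f * totfrac q = totfrac p
    & forall n (x : 'I_m -> ratfun R n), X x -> peval x q \is a GRing.unit].

Lemma rdef_poly p : rdef (totfrac p).
Proof.
exists p, 1; split=> [||n x _]; first exact: lreg1.
  by rewrite rmorph1 mulr1.
by rewrite (_ : peval x 1 = 1) ?unitr1 //; exact: rmorph1.
Qed.

Lemma rdefD f g : rdef f -> rdef g -> rdef (f + g).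
Proof.
move=> [p [q [rq fq uq]]] [p' [q' [rq' gq' uq']]].
exists (p * q' + p' * q), (q * q'); split; first exact: lregM.
  by rewrite rmorphD !rmorphM /= -fq -gq'; ring.
by move=> n x Xx; rewrite pevalM unitrM uq // uq'.
Qed.

Lemma rdefM f g : rdef f -> rdef g -> rdef (f * g).
Proof.
move=> [p [q [rq fq uq]]] [p' [q' [rq' gq' uq']]].
exists (p * p'), (q * q'); split; first exact: lregM.
  by rewrite !rmorphM /= -fq -gq'; ring.
by move=> n x Xx; rewrite pevalM unitrM uq // uq'.
Qed.

Lemma rdefN f : rdef f -> rdef (- f).
Proof.
move=> [p [q [rq fq uq]]]; exists (- p), q; split=> //.
by rewrite rmorphN /= -fq mulNr.
Qed.

Lemma rdefB f g : rdef f -> rdef g -> rdef (f - g).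
Proof. by move=> hf hg; apply: rdefD => //; apply: rdefN. Qed.

Lemma rdefV q : totfrac q \is a GRing.unit ->
  (forall n (x : 'I_m -> ratfun R n), X x -> peval x q \is a GRing.unit) ->
  rdef (totfrac q)^-1.
Proof.
move=> uq hq; exists 1, q; split=> //; last by rewrite mulVr // rmorph1.
apply: mulrI0_lreg => a ea.
apply: (@TotFrac.tofrac_inj _); rewrite rmorph0.
by apply: (mulrI uq); rewrite mulr0 -rmorphM ea rmorph0.
Qed.

Variables (n : nat) (x : 'I_m -> ratfun R n).
Hypothesis Xx : X x.

Lemma rsubstD f g : rdef f -> rdef g ->
  rsubst x (f + g) = rsubst x f + rsubst x g.
Proof.
move=> [p [q [rq fq /(_ _ _ Xx) uq]]] [p' [q' [rq' gq' /(_ _ _ Xx) uq']]].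
rewrite (rsubst_frac rq fq uq) (rsubst_frac rq' gq' uq').
have e : (f + g) * totfrac (q * q') = totfrac (p * q' + p' * q).
  by rewrite rmorphD !rmorphM /= -fq -gq'; ring.
rewrite (rsubst_frac (lregM rq rq') e) ?pevalM ?unitrM ?uq ?uq' //.
have -> : peval x (p * q' + p' * q) = peval x p * peval x q' + peval x p' * peval x q.
  by rewrite -!pevalM; apply: rmorphD.
move: (peval x p) (peval x p') (peval x q) (peval x q') uq uq' => a c b d ub ud.
apply: (mulIr (_ : b * d \is a GRing.unit)); first by rewrite unitrM ub.
rewrite divrK ?unitrM ?ub // mulrDl mulrA divrK // mulrCA divrK //; ring.
Qed.

Lemma rsubstM f g : rdef f -> rdef g ->
  rsubst x (f * g) = rsubst x f * rsubst x g.
Proof.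
move=> [p [q [rq fq /(_ _ _ Xx) uq]]] [p' [q' [rq' gq' /(_ _ _ Xx) uq']]].
rewrite (rsubst_frac rq fq uq) (rsubst_frac rq' gq' uq').
have e : (f * g) * totfrac (q * q') = totfrac (p * p').
  by rewrite !rmorphM /= -fq -gq'; ring.
rewrite (rsubst_frac (lregM rq rq') e) ?pevalM ?unitrM ?uq ?uq' //.
move: (peval x p) (peval x p') (peval x q) (peval x q') uq uq' => a c b d ub ud.
by rewrite invrM // [RHS]mulrACA [_^-1 * _^-1]mulrC.
Qed.

Lemma rsubst0 : rsubst x 0 = 0.
Proof. by rewrite -(rmorph0 (@TotFrac.tofrac _)) rsubst_poly; apply: rmorph0. Qed.

Lemma rsubst1 : rsubst x 1 = 1.
Proof. by rewrite -(rmorph1 (@TotFrac.tofrac _)) rsubst_poly; apply: rmorph1. Qed.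

Lemma rsubst_rcst c : rsubst x (rcst m c) = rcst n c.
Proof. by rewrite rsubst_poly /peval mmapC. Qed.

Lemma rsubstN f : rdef f -> rsubst x (- f) = - rsubst x f.
Proof.
move=> hf; apply/eqP; rewrite -addr_eq0 -rsubstD //; last exact: rdefN.
by rewrite addNr rsubst0.
Qed.

Lemma rsubstB f g : rdef f -> rdef g ->
  rsubst x (f - g) = rsubst x f - rsubst x g.
Proof. by move=> hf hg; rewrite rsubstD ?rsubstN //; apply: rdefN. Qed.

Lemma rdef_sum (I : eqType) (s : seq I) F :
  {in s, forall i, rdef (F i)} -> rdef (\sum_(i <- s) F i).
Proof.
move=> h; rewrite big_seq; apply: big_ind => //; last exact: rdefD.
by rewrite -(rmorph0 (@TotFrac.tofrac _)); apply: rdef_poly.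
Qed.

Lemma rdef_prod (I : eqType) (s : seq I) F :
  {in s, forall i, rdef (F i)} -> rdef (\prod_(i <- s) F i).
Proof.
move=> h; rewrite big_seq; apply: big_ind => //; last exact: rdefM.
by rewrite -(rmorph1 (@TotFrac.tofrac _)); apply: rdef_poly.
Qed.

Lemma rsubst_sum (I : eqType) (s : seq I) F : {in s, forall i, rdef (F i)} ->
  rsubst x (\sum_(i <- s) F i) = \sum_(i <- s) rsubst x (F i).
Proof.
elim: s => [|i s IH] h; first by rewrite !big_nil rsubst0.
have hs : {in s, forall i, rdef (F i)} by move=> j hj; apply: h; rewrite inE hj orbT.
by rewrite !big_cons rsubstD ?IH //; [apply: h (mem_head _ _) | apply: rdef_sum].
Qed.

Lemma rsubst_prod (I : eqType) (s : seq I) F : {in s, forall i, rdef (F i)} ->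
  rsubst x (\prod_(i <- s) F i) = \prod_(i <- s) rsubst x (F i).
Proof.
elim: s => [|i s IH] h; first by rewrite !big_nil rsubst1.
have hs : {in s, forall i, rdef (F i)} by move=> j hj; apply: h; rewrite inE hj orbT.
by rewrite !big_cons rsubstM ?IH //; [apply: h (mem_head _ _) | apply: rdef_prod].
Qed.

Lemma rsubstV q : totfrac q \is a GRing.unit -> peval x q \is a GRing.unit ->
  rsubst x (totfrac q)^-1 = (peval x q)^-1.
Proof.
move=> uq hq.
have lq : GRing.lreg q.
  apply: mulrI0_lreg => a ea.
  apply: (@TotFrac.tofrac_inj _); rewrite rmorph0.
  by apply: (mulrI uq); rewrite mulr0 -rmorphM ea rmorph0.
rewrite (@rsubst_frac _ _ _ _ _ 1 q) //; last by rewrite mulVr // rmorph1.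
by rewrite (_ : peval x 1 = 1) ?mul1r //; exact: rmorph1.
Qed.

End DefinedOn.

Lemma lreg_var m (i : 'I_m) : GRing.lreg ('X_i : {mpoly R[m]}).
Proof.
by apply: lreg_mleadc; rewrite mleadXm mcoeffX eqxx; apply: lreg1.
Qed.

(** As R may have zero divisors, being nonzero is not enough; regularity comes from the leading
    coefficient, which is 1 once the two variables are ordered. *)
Lemma lreg_subvar m (i j : 'I_m) : i != j ->
  GRing.lreg ('X_i - 'X_j : {mpoly R[m]}).
Proof.
move=> nij.
have lt (k l : 'I_m) : (U_(k)%MM < U_(l)%MM)%O -> GRing.lreg ('X_l - 'X_k : {mpoly R[m]}).
  move=> h; apply: lreg_mleadc; rewrite mleadDl ?mleadN ?mleadXm //.
  rewrite mcoeffB !mcoeffX eqxx (lt_eqF h) subr0; exact: lreg1.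
have : U_(i)%MM != U_(j)%MM :> 'X_{1..m}.
  apply: contraNneq nij => /(congr1 (fun u : 'X_{1..m} => u i)).
  by rewrite !mnm1E eqxx eq_sym; case: eqP.
case/lt_total/orP => h; last exact: lt.
by rewrite -opprB; apply: lregN; apply: lt.
Qed.

End Points.

(** * Bimoulds as functions of words *)

Definition mapl (U U' : Type) (g : U -> U') (w : seq (U * U)) :=
  [seq (g l.1, g l.2) | l <- w].

Lemma mapl_take (U U' : Type) (g : U -> U') i w : take i (mapl g w) = mapl g (take i w).
Proof. by rewrite /mapl map_take. Qed.
Lemma mapl_drop (U U' : Type) (g : U -> U') i w : drop i (mapl g w) = mapl g (drop i w).
Proof. by rewrite /mapl map_drop. Qed.
Lemma mapl_cat (U U' : Type) (g : U -> U') a b : mapl g (a ++ b) = mapl g a ++ mapl g b.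
Proof. exact: map_cat. Qed.

(** * Compatibility of flexions and swap with additive maps *)

Section Naturality.
Variables (V V' : zmodType) (f : {additive V -> V'}).
Implicit Types (w a b c : seq (V * V)).

Lemma size_mapl w : size (mapl f w) = size w.
Proof. exact: size_map. Qed.

Lemma usum_mapl w : usum (mapl f w) = f (usum w).
Proof. by rewrite /usum big_map raddf_sum. Qed.

Lemma lceil_mapl a b : lceil (mapl f a) (mapl f b) = mapl f (lceil a b).
Proof. by case: b => //= l b; rewrite usum_mapl raddfD. Qed.

Lemma rceil_mapl a b : rceil (mapl f a) (mapl f b) = mapl f (rceil a b).
Proof.
case: a => //= l a; rewrite usum_mapl /mapl map_rcons; congr rcons.
  elim: a l => //= k a IH l; by rewrite IH.
by rewrite -/(mapl f a) (last_map (fun l => (f l.1, f l.2))) /= raddfD.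
Qed.

Lemma rfloor_mapl a b : rfloor (mapl f a) (mapl f b) = mapl f (rfloor a b).
Proof.
by case: b => //= l b; rewrite /mapl -!map_comp; apply: eq_map => k /=; rewrite raddfB.
Qed.

Lemma lfloor_mapl a b : lfloor (mapl f a) (mapl f b) = mapl f (lfloor a b).
Proof.
case: a => //= l a; rewrite (last_map (fun l => (f l.1, f l.2))) /= /mapl -!map_comp.
by apply: eq_map => k /=; rewrite raddfB.
Qed.

Lemma factor3_mapl w : factor3 (mapl f w) =
  [seq (mapl f t.1.1, mapl f t.1.2, mapl f t.2) | t <- factor3 w].
Proof.
rewrite /factor3 size_mapl map_allpairs; apply: eq_allpairs => // j i.
by rewrite !mapl_take !mapl_drop.
Qed.

Lemma nilp_mapl w : nilp (mapl f w) = nilp w.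
Proof. by rewrite /nilp size_mapl. Qed.

Lemma decomps_mapl w : decomps (mapl f w) =
  [seq [seq (mapl f bc.1, mapl f bc.2) | bc <- p] | p <- decomps w].
Proof.
rewrite /decomps size_mapl; move: (size w) => n; elim: n w => // n IH [|l w] //.
rewrite [mapl f _]/= !decomps_recS -[_ :: _]/(mapl f (l :: w)) factor3_mapl.
rewrite filter_map map_allpairs allpairs_mapl.
rewrite (eq_filter (a2 := fun t => ~~ nilp t.1.1 && (~~ nilp t.1.2 || nilp t.2))).
  elim: (filter _ _) => //= t s IHs; rewrite IHs; congr (_ ++ _).
  by rewrite IH -!map_comp; apply: eq_map => p.
by move=> t /=; rewrite !nilp_mapl.
Qed.

Lemma swap_word_mapl w : swap_word (mapl f w) = mapl f (swap_word w).
Proof.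
have nthE i : nth 0 (mapl f w) i = (f (nth 0 w i).1, f (nth 0 w i).2).
  have [h|h] := ltnP i (size w); first by rewrite (nth_map 0).
  by rewrite !nth_default ?size_mapl //= !raddf0.
rewrite /swap_word /mapl /mkseq -map_comp size_map; apply: eq_map => i /=.
rewrite -!/(mapl f w) !nthE raddfB raddf_sum; congr (_, _).
by apply: eq_bigr => k _; rewrite nthE.
Qed.

End Naturality.

(** * Evaluation of bimoulds on words and its compatibility with substitutions *)

Section Transport.
Variable R : comNzRingType.
Local Notation word n := (seq (ratfun R n * ratfun R n)).
Local Notation wpred := (forall n, pred (word n)).
Implicit Types (P Q : wpred) (M A B : bimould R).

Definition coord n d (w : word n) : 'I_(d + d) -> ratfun R n := fun k =>
  match split k with inl i => (nth 0 w i).1 | inr i => (nth 0 w i).2 end.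

Lemma evE n d (w : word n) M : size w = d -> ev M w = rsubst (coord w) (M d).
Proof. by move=> <-. Qed.

Definition points P d n (x : 'I_(d + d) -> ratfun R n) :=
  exists w : word n, [/\ size w = d, P n w & x = @coord n d w].

(** In each depth a single fraction represents M, with denominator invertible at the words
    satisfying P for all n at once; evaluation there never meets the default value 0 of [rsubst]. *)
Definition nice P M := forall d, rdef (@points P d) (M d).

Definition subpoly m d (z : seq ({mpoly R[m]} * {mpoly R[m]})) (p : {mpoly R[d + d]}) :
    {mpoly R[m]} :=
  mmap (@mpolyC m R) (fun k => match split k with
     inl i => (nth 0 z i).1 | inr i => (nth 0 z i).2 end) p.

Lemma rmorph_subpoly m n d (g : {rmorphism {mpoly R[m]} -> ratfun R n}) z
    (p : {mpoly R[d + d]}) : (forall c, g c%:MP = rcst n c) -> size z = d ->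
  g (subpoly z p) = peval (coord (mapl g z)) p.
Proof.
move=> gc hz; rewrite /subpoly /peval /mmap rmorph_sum; apply: eq_bigr => u _.
rewrite rmorphM gc; congr (_ * _); rewrite /mmap1 rmorph_prod.
apply: eq_bigr => k _; rewrite rmorphXn; congr (_ ^+ _); rewrite /coord.
case: (split k) => i.
- by rewrite (nth_map 0) ?hz.
- by rewrite (nth_map 0) ?hz.
Qed.

(** A fraction p/q representing M becomes p(z)/q(z), whose denominator is invertible because the
    word z and its specializations at the points of X satisfy P. *)
Lemma ev_comp P M m (X : forall n, ('I_m -> ratfun R n) -> Prop)
    (z : seq ({mpoly R[m]} * {mpoly R[m]})) :
  nice P M -> P m (mapl totfrac z) ->
  (forall n x, @X n x -> P n (mapl (peval x) z)) ->
  rdef X (ev M (mapl totfrac z)) /\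
  forall n x, @X n x -> rsubst x (ev M (mapl totfrac z)) = ev M (mapl (peval x) z).
Proof.
move=> hM hz hX; have [p [q [rq fq uq]]] := hM (size z).
have st : size (mapl totfrac z) = size z by apply: size_map.
have sx n (x : 'I_m -> ratfun R n) : size (mapl (peval x) z) = size z by apply: size_map.
have et (r : {mpoly R[size z + size z]}) :
    totfrac (subpoly z r) = peval (coord (mapl totfrac z)) r.
  exact: rmorph_subpoly.
have ex n (x : 'I_m -> ratfun R n) (r : {mpoly R[size z + size z]}) :
    peval x (subpoly z r) = peval (coord (mapl (peval x) z)) r.
  apply: (rmorph_subpoly (g := mmap (@rcst R n) x)) => // c.
  exact: mmapC.
have uz : totfrac (subpoly z q) \is a GRing.unit.
  by rewrite et; apply: uq; exists (mapl totfrac z).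
have ux n x : @X n x -> peval x (subpoly z q) \is a GRing.unit.
  by move=> Xx; rewrite ex; apply: uq; exists (mapl (peval x) z); rewrite sx; split=> //; apply: hX.
have -> : ev M (mapl totfrac z) = totfrac (subpoly z p) * (totfrac (subpoly z q))^-1.
  have uz' : peval (coord (mapl totfrac z)) q \is a GRing.unit by rewrite -et.
  by rewrite (evE _ st) (rsubst_frac rq fq uz') !et.
have dV : rdef X (totfrac (subpoly z q))^-1 by apply: rdefV.
split; first by apply: rdefM => //; apply: rdef_poly.
move=> n x Xx; rewrite (rsubstM Xx) //; last exact: rdef_poly.
rewrite rsubst_poly rsubstV ?ux // (evE _ (sx _ _)) (rsubst_frac rq fq) -?ex //.
exact: ux.
Qed.

Definition gword0 d : seq ({mpoly R[d + d]} * {mpoly R[d + d]}) :=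
  [seq ('X_(lshift d i), 'X_(rshift d i)) | i <- enum 'I_d].

Lemma gwordE d : gword R d = mapl totfrac (gword0 d).
Proof. by rewrite /mapl -map_comp. Qed.

Lemma size_gword d : size (gword R d) = d.
Proof. by rewrite size_map size_enum_ord. Qed.

Lemma size_gword0 d : size (gword0 d) = d.
Proof. by rewrite size_map size_enum_ord. Qed.

Lemma peval_gword0 n d (w : word n) : size w = d ->
  mapl (peval (@coord n d w)) (gword0 d) = w.
Proof.
move=> hw; apply: (@eq_from_nth _ 0) => [|i].
  by rewrite size_map size_gword0.
rewrite size_map size_gword0 => hi.
rewrite /mapl -map_comp (nth_map (Ordinal hi)) ?size_enum_ord //=.
rewrite /peval !mmapX !mmap1U /coord.
rewrite (unsplitK (inl (nth (Ordinal hi) (enum 'I_d) i))).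
rewrite (unsplitK (inr (nth (Ordinal hi) (enum 'I_d) i))).
by rewrite nth_enum_ord // -surjective_pairing.
Qed.

Section Formula.
Variables (A B : bimould R) (PA PB P : wpred).
Variable L : forall V : zmodType, seq (V * V) -> seq (seq (bool * seq (V * V))).

Hypothesis L_mapl : forall (V V' : zmodType) (f : {additive V -> V'}) w,
  L (mapl f w) = [seq [seq (s.1, mapl f s.2) | s <- t] | t <- L w].

Let Ms (i : bool) := if i then A else B.
Let Ps (i : bool) : wpred := if i then PA else PB.

Hypothesis niceA : nice PA A.
Hypothesis niceB : nice PB B.
Hypothesis L_good : forall n (w : word n), @P n w ->
  all (all (fun s => @Ps s.1 n s.2)) (L w).
Hypothesis P_gword : forall d, @P (d + d)%N (gword R d).

(** The operations on bimoulds have this common shape. The flag of a factor selects A or B, and L is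
    a rule for words over any additive group, so that it applies both to polynomials and to rational
    functions. *)
Definition formula n (w : word n) : ratfun R n :=
  \sum_(t <- L w) \prod_(s <- t) ev (Ms s.1) s.2.

(** Any word w is the image of the generic word under substitution of its coordinates. L commutes
    with this substitution, which is a ring morphism on the fractions involved. *)
Lemma formula_nice M : (forall d, M d = formula (gword R d)) ->
  nice P M /\ forall n (w : word n), @P n w -> ev M w = formula w.
Proof.
move=> hM.
have niceM i : nice (Ps i) (Ms i) by case: i.
have key d : rdef (@points P d) (M d) /\
    forall n (w : word n), size w = d -> @P n w -> rsubst (@coord n d w) (M d) = formula w.
  have Lw n (w : word n) : size w = d -> L w =
     [seq [seq (s.1, mapl (peval (@coord n d w)) s.2) | s <- t] | t <- L (gword0 d)].
    move=> sw; rewrite -{1}(peval_gword0 sw).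
    exact: (L_mapl (mmap (@rcst R n) (@coord n d w))).
  have base t : t \in L (gword0 d) -> {in t, forall s,
      rdef (@points P d) (ev (Ms s.1) (mapl totfrac s.2)) /\
      forall n (x : 'I_(d + d) -> ratfun R n), points P x ->
        rsubst x (ev (Ms s.1) (mapl totfrac s.2)) = ev (Ms s.1) (mapl (peval x) s.2)}.
    move=> ht s hs; apply: ev_comp (niceM s.1) _ _ => [|n x [w [sw Pw ->]]].
      have := L_good (P_gword d); rewrite gwordE L_mapl all_map => /allP/(_ t ht) /=.
      by rewrite all_map => /allP/(_ s hs).
    have := L_good Pw; rewrite (Lw _ _ sw) all_map => /allP/(_ t ht) /=.
    by rewrite all_map => /allP/(_ s hs).
  have dt t : t \in L (gword0 d) ->
      {in t, forall s, rdef (@points P d) (ev (Ms s.1) (mapl totfrac s.2))}.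
    by move=> ht s hs; case: (base t ht s hs).
  have dp : {in L (gword0 d), forall t, rdef (@points P d)
      (\prod_(s <- [seq (s.1, mapl totfrac s.2) | s <- t]) ev (Ms s.1) s.2)}.
    by move=> t ht; rewrite big_map; apply: rdef_prod; apply: dt.
  rewrite hM /formula gwordE L_mapl big_map; split=> [|n w sw Pw]; first exact: rdef_sum.
  have Xw : points P (@coord n d w) by exists w.
  rewrite (rsubst_sum Xw dp) (Lw _ _ sw) big_map; apply: eq_big_seq => t ht.
  rewrite !big_map (rsubst_prod Xw (dt t ht)); apply: eq_big_seq => s hs.
  by case: (base t ht s hs) => _; apply.
split=> [d|n w Pw]; first by case: (key d).
by rewrite (evE _ (erefl (size w))); case: (key (size w)) => _; apply.
Qed.

End Formula.

Lemma niceD P M N : nice P M -> nice P N -> nice P (M + N).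
Proof. by move=> hM hN d; apply: rdefD. Qed.
Lemma niceB P M N : nice P M -> nice P N -> nice P (M - N).
Proof. by move=> hM hN d; apply: rdefB. Qed.

Lemma evD P M N n (w : word n) : nice P M -> nice P N -> P n w ->
  ev (M + N) w = ev M w + ev N w.
Proof.
move=> hM hN Pw; rewrite !(evE _ (erefl (size w))).
by apply: (rsubstD (X := @points P (size w))) => //; exists w.
Qed.
Lemma evB P M N n (w : word n) : nice P M -> nice P N -> P n w ->
  ev (M - N) w = ev M w - ev N w.
Proof.
move=> hM hN Pw; rewrite !(evE _ (erefl (size w))).
by apply: (rsubstB (X := @points P (size w))) => //; exists w.
Qed.

Lemma ev_gword P M d : nice P M -> P (d + d)%N (gword R d) ->
  ev M (gword R d) = M d.
Proof.
move=> hM hP; have [p [q [rq fq uq]]] := hM d.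
have X0 (i : 'I_d) : nth 0 (gword0 d) i = ('X_(lshift d i), 'X_(rshift d i)).
  by rewrite (nth_map i) ?size_enum_ord // nth_ord_enum.
have id_poly (r : {mpoly R[d + d]}) : peval (coord (gword R d)) r = totfrac r.
  rewrite gwordE -(rmorph_subpoly (g := @TotFrac.tofrac _)) ?size_gword0 //.
  congr totfrac; rewrite /subpoly.
  have -> : (fun k : 'I_(d + d) => match split k with
      | inl i => (nth 0 (gword0 d) i).1 | inr i => (nth 0 (gword0 d) i).2 end) =
      (fun k => 'X_k).
    by apply: funext => k; rewrite -[in RHS](splitK k); case: (split k) => i; rewrite X0.
  rewrite [RHS]mpolyE /mmap; apply: eq_bigr => u _.
  by rewrite mmap1_id mul_mpolyC.
have uq' : totfrac q \is a GRing.unit.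
  by rewrite -id_poly; apply: uq; exists (gword R d); rewrite size_gword.
rewrite (evE _ (size_gword d)) (rsubst_frac rq fq) ?id_poly //.
by rewrite -fq mulrK.
Qed.

Lemma nice_eq P M N : nice P M -> nice P N ->
  (forall d, P (d + d)%N (gword R d)) ->
  (forall d, ev M (gword R d) = ev N (gword R d)) -> M = N.
Proof.
move=> hM hN hP h; apply: functional_extensionality_dep => d.
by rewrite -(ev_gword hM) // -(ev_gword hN).
Qed.

End Transport.

(** * The sums defining arit and ganit as derivations and substitutions *)

Section Sums.
Variable K : comUnitRingType.
Local Notation letter := (K * K)%type.
Local Notation word := (seq (K * K)).
Implicit Types (l m k : letter) (w a b c x y z : word) (A B : word -> K).

Lemma sum_iota (F : word -> word -> K) w :
  \sum_(j <- iota 0 (size w).+1) F (take j w) (drop j w) = cuts F w.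
Proof.
elim: w F => [|l w IH] F; first by rewrite cutsE big_seq1.
rewrite cutsE -IH -[iota 0 _]/(0%N :: iota 1 (size w).+1) big_cons take0 drop0.
congr (_ + _).
have -> : iota 1 (size w).+1 = map S (iota 0 (size w).+1) by rewrite -(iotaDl 1 0).
by rewrite big_map.
Qed.

Lemma sum_factor3 (F : word -> word -> word -> K) w :
  \sum_(t <- factor3 w) F t.1.1 t.1.2 t.2 =
  cuts (fun x c => cuts (fun a b => F a b c) x) w.
Proof.
rewrite -sum_iota /factor3 big_allpairs_dep; apply: eq_big_seq => j.
rewrite mem_iota add0n ltnS => /andP[_ hj].
rewrite -sum_iota size_takel //; apply: eq_big_seq => i.
rewrite mem_iota add0n ltnS => /andP[_ hi].
by rewrite take_takel.
Qed.

Lemma sum_lceil A B w : B [::] = 0 ->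
  \sum_(t <- factor3 w | ~~ nilp t.1.2 && ~~ nilp t.2)
    A (t.1.1 ++ lceil t.1.2 t.2) * B (rfloor t.1.2 t.2) =
  cuts (fun a z => cutl (fun b m c =>
    B (shv m.2 b) * A (a ++ addu m (usum b) :: c)) z) w.
Proof.
move=> B0; rewrite big_mkcond (sum_factor3 (fun a b c =>
  if ~~ nilp b && ~~ nilp c then A (a ++ lceil b c) * B (rfloor b c) else 0)).
rewrite (cuts_cuts (fun a b c => if ~~ nilp b && ~~ nilp c then
  A (a ++ lceil b c) * B (rfloor b c) else 0)).
apply: eq_cuts => a z _; rewrite cuts_split andbF addr0.
apply: eq_cutl => b m c _; rewrite andbT.
case: b => [|k b]; first by rewrite /= B0 mul0r.
rewrite [~~ _]/= mulrC; congr (_ * A (_ ++ (_, _) :: _)); exact: addrC.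
Qed.

Lemma rceil_rcons a l b : rceil (rcons a l) b = rcons a (addu l (usum b)).
Proof.
by case: a => //= k a; rewrite last_rcons belast_rcons.
Qed.

Lemma lfloor_rcons a l b : lfloor (rcons a l) b = shv l.2 b.
Proof. by case: a => //= k a; rewrite last_rcons. Qed.

Lemma sum_rceil A B w : B [::] = 0 ->
  \sum_(t <- factor3 w | ~~ nilp t.1.1 && ~~ nilp t.1.2)
    A (rceil t.1.1 t.1.2 ++ t.2) * B (lfloor t.1.1 t.1.2) =
  cutl (fun a l z => cuts (fun b c =>
    B (shv l.2 b) * A (a ++ addu l (usum b) :: c)) z) w.
Proof.
move=> B0; rewrite big_mkcond (sum_factor3 (fun a b c =>
  if ~~ nilp a && ~~ nilp b then A (rceil a b ++ c) * B (lfloor a b) else 0)).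
rewrite (cuts_cuts (fun a b c => if ~~ nilp a && ~~ nilp b then
  A (rceil a b ++ c) * B (lfloor a b) else 0)).
rewrite cuts_rcons /= cuts0 add0r; apply: eq_cutl => a l z _.
apply: eq_cuts => b c _.
rewrite /nilp size_rcons /= -/(nilp b).
case: b => [|k b]; first by rewrite /= B0 mul0r.
by rewrite rceil_rcons lfloor_rcons cat_rcons mulrC.
Qed.

Definition ganit_sum B A w :=
  \sum_(p <- decomps w) A (flatten [seq rceil bc.1 bc.2 | bc <- p])
    * \prod_(bc <- p) B (lfloor bc.1 bc.2).

Lemma decomps_rec_size n w : (size w <= n)%N -> decomps_rec n w = decomps w.
Proof.
suff h n' w' : (size w' <= n)%N -> (size w' <= n')%N ->
    decomps_rec n w' = decomps_rec n' w' by move=> hn; apply: h.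
elim: n n' w' => [|n IH] [|n'] [|l w'] // hn hn'; rewrite !decomps_recS.
congr flatten; apply/eq_in_map => -[[a b] c].
rewrite mem_filter mem_factor3 => /andP[/= /andP[na _] /eqP e].
have hc : (size c <= size w')%N.
  by have := congr1 size e; rewrite !size_cat /=; case: (a) na => //= *; lia.
by rewrite (IH n' c) //; apply: leq_trans hc _.
Qed.

Lemma ganit_sum_block B A l w : ganit_sum B A (l :: w) =
  cuts (fun a z => cuts (fun b c =>
    if ~~ nilp a && (~~ nilp b || nilp c) then
      B (lfloor a b) * ganit_sum B (fun z => A (rceil a b ++ z)) c
    else 0) z) (l :: w).
Proof.
rewrite -(cuts_cuts (fun a b c => if ~~ nilp a && (~~ nilp b || nilp c) then
      B (lfloor a b) * ganit_sum B (fun z => A (rceil a b ++ z)) c else 0)).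
rewrite -(sum_factor3 (fun a b c => if ~~ nilp a && (~~ nilp b || nilp c) then
      B (lfloor a b) * ganit_sum B (fun z => A (rceil a b ++ z)) c else 0)).
rewrite /ganit_sum {1}/decomps [size _]/= decomps_recS big_allpairs_dep big_filter.
rewrite big_mkcond; apply: eq_big_seq => -[[a b] c] /=.
rewrite mem_factor3 => /eqP e; case: ifP => // /andP[na _].
rewrite decomps_rec_size; last first.
  by have := congr1 size e; rewrite !size_cat /=; case: (a) na => //= *; lia.
rewrite big_distrr; apply: eq_bigr => p _ /=.
by rewrite big_cons mulrCA.
Qed.

(** In a block b_i only the last letter absorbs c_i, whereas [subst] lets every letter absorb a
    block; the letters absorbing nothing contribute the factor B(empty) = 1. *)
Lemma ganit_sumE B A w : B [::] = 1 ->
  ganit_sum B A w = subst (fun e c => B (shv e c)) A w.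
Proof.
move=> B1; elim/word_ind: w A => -[|l w] IH A.
  by rewrite /ganit_sum big_seq1 big_nil mulr1.
rewrite ganit_sum_block cutsE /= cuts0 add0r cuts_rcons.
(* Either the first block is l alone and absorbs b, or it goes on; then l absorbs nothing, and the
   rest of the block begins a decomposition of w. *)
have e1 : cuts (fun b c => if ~~ nilp b || nilp c then B (shv l.2 b) *
    ganit_sum B (fun z => A (addu l (usum b) :: z)) c else 0) w
  + (if w is [::] then 0 else ganit_sum B (fun z => A (l :: z)) w) =
  subst (fun e c => B (shv e c)) A (l :: w).
  rewrite subst_cons; case: w IH => [|k w] IH.
    by rewrite !cutsE addr0 /= /ganit_sum big_seq1 big_nil mulr1.
  rewrite cutsE add0r [RHS]cutsE addrC; congr (_ + _).
    by rewrite B1 mul1r usum_nil addu0 IH.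
  apply: eq_cuts => b c e /=; rewrite IH //.
  by have := congr1 size e; rewrite size_cat /=; lia.
rewrite -e1; congr (_ + _).
case: w {IH e1} => [|k w]; first by rewrite cutlE.
rewrite ganit_sum_block [RHS]cuts_rcons /= cuts0 add0r.
apply: eq_cutl => a m z _; apply: eq_cuts => b c _.
rewrite /nilp size_rcons /=; case: ifP => // _.
by rewrite rceil_rcons last_rcons belast_rcons lfloor_rcons.
Qed.

Lemma eq_subst_pdiff q q' A w : (forall l c, pdiff (l :: c) -> q l.2 c = q' l.2 c) ->
  pdiff w -> subst q A w = subst q' A w.
Proof.
move=> hq; elim/word_ind: w A => -[|l w] IH A hP //; rewrite !subst_cons.
apply: eq_cuts => c r e; rewrite IH.
- by rewrite hq //; move: hP; rewrite -e => /pdiff_cons_catl.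
- exact: size_cut e.
- by move: hP; rewrite -e => /pdiff_cons/pdiff_catr.
Qed.

End Sums.

Section Blocks.
Variable V : zmodType.
Implicit Types (a b c w : seq (V * V)).

Lemma unzip2_lceil a b : unzip2 (lceil a b) = unzip2 b.
Proof. by case: b. Qed.

Lemma unzip2_rceil a b : unzip2 (rceil a b) = unzip2 a.
Proof.
case/lastP: a => [|a l] //.
have -> : rceil (rcons a l) b = rcons a (l.1 + usum b, l.2).
  by case: a => //= k a; rewrite last_rcons belast_rcons.
by rewrite /unzip2 !map_rcons.
Qed.

End Blocks.

(** * The operations mu, arit, ari and ganit on words *)

Section Operations.
Variable R : comNzRingType.
Local Notation word n := (seq (ratfun R n * ratfun R n)).
Local Notation wpred := (forall n, pred (word n)).
Implicit Types (M A B : bimould R).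

Definition Pdiff : wpred := fun n => @pdiff (ratfun R n).
Definition Pall : wpred := fun n => xpredT.
(** The letter 0 in front accounts for the denominators of [pic] and [poc] that are v's rather than
    differences of v's. *)
Definition Pgen : wpred := fun n w => pdiff (0 :: w).

Definition mu_words (V : zmodType) (w : seq (V * V)) :=
  [seq [:: (true, take j w); (false, drop j w)] | j <- iota 0 (size w).+1].

Definition arit_words_l (V : zmodType) (w : seq (V * V)) :=
  [seq [:: (true, t.1.1 ++ lceil t.1.2 t.2); (false, rfloor t.1.2 t.2)]
     | t <- [seq t <- factor3 w | ~~ nilp t.1.2 && ~~ nilp t.2]].

Definition arit_words_r (V : zmodType) (w : seq (V * V)) :=
  [seq [:: (true, rceil t.1.1 t.1.2 ++ t.2); (false, lfloor t.1.1 t.1.2)]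
     | t <- [seq t <- factor3 w | ~~ nilp t.1.1 && ~~ nilp t.1.2]].

Definition natural (L : forall V : zmodType, seq (V * V) -> seq (seq (bool * seq (V * V)))) :=
  forall (V V' : zmodType) (f : {additive V -> V'}) w,
    L _ (mapl f w) = [seq [seq (s.1, mapl f s.2) | s <- t] | t <- L _ w].

Lemma mu_words_natural : natural mu_words.
Proof.
move=> V V' f w; rewrite /mu_words size_mapl -map_comp; apply: eq_map => j /=.
by rewrite mapl_take mapl_drop.
Qed.

Lemma arit_words_l_natural : natural arit_words_l.
Proof.
move=> V V' f w; rewrite /arit_words_l factor3_mapl filter_map -!map_comp.
under eq_filter => t do rewrite /= !nilp_mapl.
by apply: eq_map => t /=; rewrite lceil_mapl rfloor_mapl -mapl_cat.
Qed.

Lemma arit_words_r_natural : natural arit_words_r.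
Proof.
move=> V V' f w; rewrite /arit_words_r factor3_mapl filter_map -!map_comp.
under eq_filter => t do rewrite /= !nilp_mapl.
by apply: eq_map => t /=; rewrite rceil_mapl lfloor_mapl -mapl_cat.
Qed.

Lemma mu_formula A B d : mu A B d = formula A B mu_words (gword R d).
Proof.
rewrite /mu -(big_mkord xpredT (fun j => ev A (take j (gword R d))
    * ev B (drop j (gword R d)))) /index_iota subn0 /formula big_map size_gword.
by apply: eq_bigr => j _; rewrite !big_cons big_nil mulr1.
Qed.

Definition arit_l B A : bimould R := fun d => formula A B arit_words_l (gword R d).
Definition arit_r B A : bimould R := fun d => formula A B arit_words_r (gword R d).

Lemma arit_formula B A : arit B A = arit_l B A - arit_r B A.
Proof.
apply: functional_extensionality_dep => d.
rewrite -[RHS]/(arit_l B A d - arit_r B A d) /arit_l /arit_r /formula.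
rewrite !big_map !big_filter; congr (_ - _); apply: eq_bigr => -[[a b] c] _;
  by rewrite !big_cons big_nil mulr1.
Qed.

Lemma ev_nil n M (c : R) : M 0%N = rcst _ c -> ev M [::] = rcst n c.
Proof. by move=> h; rewrite (@evE R n 0 [::] M) // h rsubst_rcst. Qed.

Lemma ev_nil0 n M : M 0%N = 0 -> ev M ([::] : word n) = 0.
Proof. by move=> h; rewrite (@ev_nil n M 0) ?rmorph0 // h rmorph0. Qed.

Section Stable.
Variable P : wpred.
Hypothesis P_sub : forall n (a b : word n), subseq (unzip2 a) (unzip2 b) -> P b -> P a.
Hypothesis P_shv : forall n e (w : word n), P w -> P (shv e w).
Hypothesis P_gword : forall d, P (gword R d).

Lemma mu_nice A B : nice P A -> nice P B ->
  nice P (mu A B) /\ forall n (w : word n), P w -> ev (mu A B) w = fmul (ev A) (ev B) w.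
Proof.
move=> hA hB.
have [|n1 e1] := @formula_nice R A B P P P mu_words mu_words_natural hA hB _ P_gword
    (mu A B) (mu_formula A B).
  move=> n w Pw; rewrite /mu_words all_map; apply/allP => j _ /=.
  rewrite andbT; apply/andP; split;
    apply: P_sub Pw; rewrite -{2}(cat_take_drop j w) /unzip2 map_cat.
    exact: prefix_subseq.
  exact: suffix_subseq.
split=> // n w Pw; rewrite e1 // /formula big_map /fmul -sum_iota.
by apply: eq_bigr => j _; rewrite !big_cons big_nil mulr1.
Qed.

Lemma flie_nice A B : nice P A -> nice P B ->
  nice P (lu A B) /\ forall n (w : word n), P w -> ev (lu A B) w = flie (ev A) (ev B) w.
Proof.
move=> hA hB; have [n1 e1] := mu_nice hA hB; have [n2 e2] := mu_nice hB hA.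
split; first exact: niceB.
by move=> n w Pw; rewrite (evB n1 n2) // e1 // e2.
Qed.

Lemma arit_nice B A : nice P A -> nice P B -> B 0%N = 0 ->
  nice P (arit B A) /\
  forall n (w : word n), P w -> ev (arit B A) w = der (ev B) (ev B) (ev A) w.
Proof.
move=> hA hB B0; rewrite arit_formula.
have [|n1 e1] := @formula_nice R A B P P P arit_words_l arit_words_l_natural hA hB _
    P_gword (arit_l B A) (fun=> erefl).
  move=> n w Pw; rewrite /arit_words_l all_map; apply/allP => -[[a b] c].
  rewrite mem_filter mem_factor3 => /andP[_ /eqP e] /=; rewrite andbT.
  apply/andP; split.
    apply: P_sub Pw; rewrite -e /unzip2 !map_cat -!/(unzip2 _) unzip2_lceil.
    by rewrite cat_subseq // suffix_subseq.
  have Pb : P b.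
    apply: P_sub Pw; rewrite -e /unzip2 !map_cat.
    exact: subseq_trans (prefix_subseq _ _) (suffix_subseq _ _).
  by case: (c) => //= m c'; apply: (P_shv m.2 Pb).
have [|n2 e2] := @formula_nice R A B P P P arit_words_r arit_words_r_natural hA hB _
    P_gword (arit_r B A) (fun=> erefl).
  move=> n w Pw; rewrite /arit_words_r all_map; apply/allP => -[[a b] c].
  rewrite mem_filter mem_factor3 => /andP[_ /eqP e] /=; rewrite andbT.
  apply/andP; split.
    apply: P_sub Pw; rewrite -e /unzip2 !map_cat -!/(unzip2 _) unzip2_rceil.
    by rewrite cat_subseq // suffix_subseq.
  have Pb : P b.
    apply: P_sub Pw; rewrite -e /unzip2 !map_cat.
    exact: subseq_trans (prefix_subseq _ _) (suffix_subseq _ _).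
  by case: (a) => //= m c'; apply: P_shv.
split; first exact: niceB.
move=> n w Pw; have B0' := @ev_nil0 n B B0.
rewrite (evB n1 n2) // e1 // e2 // der_global; congr (_ - _).
  rewrite -(sum_lceil (ev A) w B0') /formula big_map big_filter.
  by apply: eq_bigr => t _; rewrite !big_cons big_nil mulr1.
rewrite -(sum_rceil (ev A) w B0') /formula big_map big_filter.
by apply: eq_bigr => t _; rewrite !big_cons big_nil mulr1.
Qed.

Lemma ari_nice A B : nice P A -> nice P B -> A 0%N = 0 -> B 0%N = 0 ->
  nice P (ari A B) /\
  forall n (w : word n), P w -> ev (ari A B) w = fari (ev A) (ev B) w.
Proof.
move=> hA hB A0 B0.
have [n1 e1] := arit_nice hA hB B0; have [n2 e2] := arit_nice hB hA A0.
have [n3 e3] := flie_nice hA hB.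
split; first by apply: niceD => //; apply: niceB.
by move=> n w Pw; rewrite (evD (niceB n1 n2) n3) // (evB n1 n2) // e1 // e2 // e3.
Qed.

End Stable.

Lemma Pdiff_sub n (a b : word n) : subseq (unzip2 a) (unzip2 b) -> Pdiff b -> Pdiff a.
Proof. exact: pdiff_sub. Qed.

Lemma Pdiff_shv n e (w : word n) : Pdiff w -> Pdiff (shv e w).
Proof. by rewrite /Pdiff pdiff_shv. Qed.

Lemma Pgen_gword d : Pgen (gword R d).
Proof.
have u (i : 'I_d) : vvar R i \is a GRing.unit.
  by apply: TotFrac.tofrac_unit; apply: lreg_var.
have ud (i j : 'I_d) : i != j -> vvar R i - vvar R j \is a GRing.unit.
  move=> nij; rewrite -rmorphB; apply: TotFrac.tofrac_unit; apply: lreg_subvar.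
  by apply: contraNneq nij => /rshift_inj ->.
rewrite /Pgen /pdiff /= all_map; apply/andP; split.
  apply/allP => i _; have := u i; rewrite -unitrN -sub0r; exact.
rewrite pairwise_map; have := enum_uniq 'I_d; rewrite uniq_pairwise.
by apply: sub_pairwise => i j /= /ud.
Qed.

Lemma Pdiff_gword d : Pdiff (gword R d).
Proof. exact: pdiff_cons (Pgen_gword d). Qed.

(** The block c_i is shifted by the last v of b_i, which turns [pdiff] of that letter followed by
    c_i into [Pgen]. A is evaluated on words whose v's form a subsequence of those of w. *)
Lemma ganit_nice Q A : nice Pgen Q -> nice Pdiff A -> Q 0%N = 1 ->
  nice Pdiff (ganit Q A) /\
  forall n (w : word n), Pdiff w ->
    ev (ganit Q A) w = subst (fun e c => ev Q (shv e c)) (ev A) w.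
Proof.
move=> hQ hA Q0.
pose L (V : zmodType) (w : seq (V * V)) :=
  [seq (true, flatten [seq rceil bc.1 bc.2 | bc <- p])
     :: [seq (false, lfloor bc.1 bc.2) | bc <- p] | p <- decomps w].
have [|n w Pw|d|h1 h2] := @formula_nice R A Q Pdiff Pgen Pdiff L _ hA hQ _ Pdiff_gword
    (ganit Q A).
- move=> V V' f w; rewrite /L decomps_mapl -!map_comp; apply: eq_map => p /=.
  congr ((_, _) :: _).
    elim: p => //= bc p IH; rewrite rceil_mapl IH mapl_cat //.
  by rewrite -!map_comp; apply: eq_map => bc /=; rewrite lfloor_mapl.
- rewrite /L all_map; apply/allP => p; rewrite mem_decomps /= => /and3P[/eqP e nb _].
  apply/andP; split.
    apply: Pdiff_sub Pw; rewrite -e.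
    elim: (p) => //= -[b c] p' IH; rewrite /unzip2 !map_cat -!/(unzip2 _) unzip2_rceil.
    by rewrite cat_subseq // prefix_subseq.
  rewrite all_map; elim: p w e nb Pw => //= -[b c] p IH w e /= /andP[nb np] Pw.
  apply/andP; split; last first.
    apply: IH (erefl _) np _; move: Pw; rewrite -e /Pdiff; exact: pdiff_catr.
  have : pdiff (b ++ c) by move: Pw; rewrite -e /Pdiff; apply: pdiff_catl.
  case/lastP: b nb {e} => // b l _.
  rewrite lfloor_rcons cat_rcons => /pdiff_catr hP.
  have -> : Pgen (shv l.2 c) = pdiff (shv l.2 (l :: c)).
    by rewrite /Pgen /pdiff /= subrr.
  by rewrite pdiff_shv.
- rewrite /ganit /formula big_map; apply: eq_bigr => p _.
  by rewrite big_cons big_map.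
split=> // n w Pw; rewrite h2 // -(ganit_sumE (ev A) w); last first.
  by rewrite (@ev_nil n Q 1) ?rmorph1 // Q0 rmorph1.
rewrite /formula big_map; apply: eq_bigr => p _.
by rewrite big_cons big_map.
Qed.

End Operations.

(** * Alternility and depth *)

Section AlternilDepth.
Variable K : comUnitRingType.
Local Notation letter := (K * K)%type.
Local Notation word := (seq (K * K)).
Implicit Types (l m k t : letter) (w a b c x y z : word) (M N A B : word -> K).

(** The two merged letters have the same u, so the divided differences vanish. *)
Lemma stsum_vfree M x y : vfree M -> stsum M x y = shsum M x y.
Proof.
elim: x M y => [|l x IHx] M y vM; first by rewrite stsum_nill shsum_nill.
elim: y M vM => [|k y IHy] M vM; first by rewrite stsum_nilr shsum_nilr.
have vc h : vfree (fun z => M (h :: z)) by move=> z z' e; apply: vM; rewrite /= e.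
rewrite stsum_cons shsum_cons IHx ?IHy //.
have -> : (fun z => M (addu l k.1 :: z)) = (fun z => M (addu k l.1 :: z)).
  by apply: funext => z; apply: vM; rewrite /= addrC.
by rewrite subrr mulr0 addr0.
Qed.

Lemma falternil_vfree M : vfree M -> falternal xpredT M -> falternil M.
Proof. by move=> vM hM x y _ nx ny; rewrite stsum_vfree // hM. Qed.

Lemma falternilD M N : falternil M -> falternil N -> falternil (fun z => M z + N z).
Proof. by move=> hM hN x y hP nx ny; rewrite stsumD hM // hN // addr0. Qed.
Lemma falternilB M N : falternil M -> falternil N -> falternil (fun z => M z - N z).
Proof. by move=> hM hN x y hP nx ny; rewrite stsumB hM // hN // subrr. Qed.

Lemma eq_subst_in q M N w :
  (forall z, subseq (unzip2 z) (unzip2 w) -> M z = N z) ->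
  subst q M w = subst q N w.
Proof.
elim/word_ind: w M N => -[|l w] IH M N h; first by rewrite !subst_nil h.
rewrite !subst_cons; apply: eq_cuts => c r e; congr (_ * _).
apply: IH => [|z sz]; first exact: size_cut e.
apply: h; rewrite /= eqxx -e /unzip2 map_cat.
exact: subseq_trans sz (suffix_subseq _ _).
Qed.

Lemma subst0 q w : subst q (fun=> 0) w = 0.
Proof.
rewrite -[RHS](mul0r (subst q (fun=> 0) w)) -substM.
by apply: eq_subst => z; rewrite mul0r.
Qed.

Lemma size_subseq2 z w : subseq (unzip2 z) (unzip2 w) -> (size z <= size w)%N.
Proof. by move/size_subseq; rewrite !size_map. Qed.

(** Unitriangularity of G: as soon as a nonempty block is absorbed, M is evaluated on a shorter
    word. *)
Lemma subst_top M w :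
  (forall z, z <> [::] -> subseq (unzip2 z) (unzip2 w) ->
     (size z < size w)%N -> M z = 0) ->
  subst chain M w = M w.
Proof.
case: w => // l w; elim: w l M => [|k w IH] l M h.
  by rewrite subst_cons cutsE mul1r subst_nil usum_nil addu0.
rewrite subst_cons cuts_head => [|a b e na].
  rewrite mul1r usum_nil addu0 IH //= => z nz sz hz.
  by apply: h => //=; rewrite eqxx.
rewrite (eq_subst_in _ (N := fun=> 0)) => [|z sz]; first by rewrite subst0 mulr0.
apply: h => //.
- have sz' : subseq (unzip2 z) (unzip2 (k :: w)).
    by rewrite -e /unzip2 map_cat; apply: subseq_trans sz (suffix_subseq _ _).
  exact: (cat_subseq (subseq_refl [:: l.2]) sz').
- rewrite /= ltnS -[(size w).+1]/(size (k :: w)) -e size_cat.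
  have := size_subseq2 sz; case: (a) na => //= *; lia.
Qed.

(** By induction on the total length, the only term of the double substitution that can survive is
    the one where nothing is absorbed. *)
Lemma falternil_of_subst M : falternal pdiff (subst chain M) -> falternil M.
Proof.
move=> hM x y; move: {2}(size x + size y)%N (leqnn (size x + size y)) => n.
elim: n x y => [|n IH] x y.
  by case: x => //; case: y.
move=> hn hP nx ny; have := hM x y hP nx ny.
have hs a b : a <> [::] -> b <> [::] -> subseq (unzip2 a) (unzip2 x) ->
    subseq (unzip2 b) (unzip2 y) -> (size a + size b < size x + size y)%N ->
    stsum M a b = 0.
  move=> na nb sa sb h; apply: IH => //; first by lia.
  by apply: pdiff_sub hP; rewrite /unzip2 !map_cat cat_subseq.
rewrite shsum_subst_chain // /subst2 subst_top => [|z nz sz hz].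
  rewrite subst_top // => z nz sz hz; apply: hs => //; lia.
by apply: subst_eq0 => // b nb sb; apply: hs => //; have := size_subseq2 sb; lia.
Qed.

Lemma eq_der_in N N' N1 N1' M M' w : pdiff w ->
  (forall z, pdiff z -> N z = N1 z) -> (forall z, pdiff z -> N' z = N1' z) ->
  (forall z, pdiff z -> M z = M' z) ->
  der N N' M w = der N1 N1' M' w.
Proof.
move=> hP hN hN' hM; have {}hM z : subseq (unzip2 z) (unzip2 w) -> M z = M' z.
  by move=> sz; apply: hM; apply: pdiff_sub hP.
elim: w hP M M' hM => // l w IH hP M M' hM; rewrite !der_cons.
congr (_ - _ + _).
- apply: IH => [|z sz]; first exact: pdiff_cons hP.
  by apply: hM; rewrite /= eqxx.
- apply: eq_cuts => b c e; rewrite hN' ?hM //.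
  + rewrite /= eqxx -e /unzip2 map_cat; exact: suffix_subseq.
  + rewrite pdiff_shv; apply: pdiff_sub hP; rewrite -e /= /unzip2 map_cat.
    apply: subseq_trans (subseq_cons _ _); exact: prefix_subseq.
- apply: eq_cutl => b m c e; rewrite hN ?hM //.
  + rewrite -e /unzip2 map_cat; exact: suffix_subseq.
  + rewrite pdiff_shv; apply: pdiff_sub hP; rewrite -e /= /unzip2 map_cat.
    exact: prefix_subseq.
Qed.

Lemma eq_fari_in M M' N N' w : pdiff w ->
  (forall z, pdiff z -> M z = M' z) -> (forall z, pdiff z -> N z = N' z) ->
  fari M N w = fari M' N' w.
Proof.
move=> hP hM hN; rewrite /fari (eq_der_in hP hN hN hM) (eq_der_in hP hM hM hN).
congr (_ + (_ - _)); apply: eq_cuts => a b e.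
  by rewrite hM ?hN //; move: hP; rewrite -e; [apply: pdiff_catr | apply: pdiff_catl].
by rewrite hM ?hN //; move: hP; rewrite -e; [apply: pdiff_catl | apply: pdiff_catr].
Qed.

Lemma fari_size M N n n' w :
  (forall z, (n <= size z)%N -> M z = 0) -> (forall z, (n' <= size z)%N -> N z = 0) ->
  (n + n' <= size w)%N -> fari M N w = 0.
Proof.
move=> hM hN hw.
have e1 A B (k k' : nat) : (forall z, (k <= size z)%N -> A z = 0) ->
    (forall z, (k' <= size z)%N -> B z = 0) -> (k + k' <= size w)%N ->
    fmul A B w = 0 /\ der A A B w = 0.
  move=> hA hB hk.
  have AB a b : (size a + size b = size w)%N -> A a * B b = 0.
    move=> e; have [h|h] := leqP k (size a); first by rewrite hA ?mul0r.
    by rewrite hB ?mulr0 //; lia.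
  split.
    rewrite -[RHS](cuts0 K w); apply: eq_cuts => a b e; apply: AB.
    by rewrite -e size_cat.
  rewrite der_global -[RHS]subr0; congr (_ - _).
    rewrite -[RHS](cuts0 K w); apply: eq_cuts => a z e.
    rewrite -[RHS](cutl0 K z); apply: eq_cutl => b m c e'; apply: AB.
    by rewrite size_map -e -e' !size_cat /=; lia.
  rewrite -[RHS](cutl0 K w); apply: eq_cutl => a m z e.
  rewrite -[RHS](cuts0 K z); apply: eq_cuts => b c e'; apply: AB.
  by rewrite size_map -e -e' !size_cat /= size_cat; lia.
have [f1 d1] := e1 _ _ _ _ hM hN hw.
have [|f2 d2] := e1 _ _ _ _ hN hM; first by rewrite addnC.
by rewrite /fari /flie d1 d2 f1 f2 !subrr addr0.
Qed.

Lemma fari_nil M N : fari M N [::] = 0.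
Proof. by rewrite /fari /flie /fmul !cutsE /= mulrC !subrr addr0. Qed.

Lemma fari_letter M N l : M [::] = 0 -> N [::] = 0 -> fari M N [:: l] = 0.
Proof.
move=> M0 N0; rewrite /fari /flie /fmul !der_cons !cutsE !cutlE /= M0 N0.
by rewrite !mul0r !mulr0 !(addr0, subr0).
Qed.

Lemma shsum_fconst M x y : fconst M ->
  (forall z, size z = (size x + size y)%N -> M z = 0) -> shsum M x y = 0.
Proof.
move=> cM h; rewrite (eq_shsum_perm (F' := fun=> 0)) => [|z /perm_size e].
  by rewrite /shsum big1.
by apply: h; rewrite e size_cat.
Qed.

End AlternilDepth.

(** * Polynomial bimoulds *)

Section Bimoulds.
Variable R : comNzRingType.
Local Notation word n := (seq (ratfun R n * ratfun R n)).
Local Notation wpred := (forall n, pred (word n)).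
Implicit Types (M A B C : bimould R).

Lemma poly_nice (P : wpred) M : polynomial M -> nice P M.
Proof. by move=> hM d; have [p ->] := hM d; apply: rdef_poly. Qed.

Lemma polyD M A : polynomial M -> polynomial A -> polynomial (M + A).
Proof.
move=> hM hA d; have [p ep] := hM d; have [q eq] := hA d.
by exists (p + q); rewrite rmorphD /= -ep -eq.
Qed.

Lemma polyB M A : polynomial M -> polynomial A -> polynomial (M - A).
Proof.
move=> hM hA d; have [p ep] := hM d; have [q eq] := hA d.
by exists (p - q); rewrite rmorphB /= -ep -eq.
Qed.

Lemma polyZ (k : R) M : polynomial M -> polynomial (k *: M).
Proof.
move=> hM d; have [p ep] := hM d.
by exists (k%:MP * p); rewrite rmorphM /= -ep.
Qed.

Lemma formula_poly A B (L : forall V : zmodType, seq (V * V) -> seq (seq (bool * seq (V * V)))) M :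
  natural L -> polynomial A -> polynomial B ->
  (forall d, M d = formula A B L (gword R d)) -> polynomial M.
Proof.
move=> hL hA hB hM d; rewrite hM /formula gwordE hL big_map.
have ev_poly (i : bool) (z : seq ({mpoly R[d + d]} * {mpoly R[d + d]})) :
    exists p : {mpoly R[d + d]}, ev (if i then A else B) (mapl totfrac z) = totfrac p.
  have [p ep] : exists p : {mpoly R[size z + size z]},
      (if i then A else B) (size z) = totfrac p by case: i; [apply: hA | apply: hB].
  exists (subpoly z p); rewrite (@evE _ _ (size z)) ?size_map // ep rsubst_poly.
  by rewrite -(rmorph_subpoly (g := @TotFrac.tofrac _)).
elim: (L _ _) => [|t s [p IH]]; first by exists 0; rewrite big_nil rmorph0.
rewrite big_cons IH.
have [r ->] : exists r : {mpoly R[d + d]},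
    \prod_(u <- [seq (s0.1, mapl totfrac s0.2) | s0 <- t])
       ev (if u.1 then A else B) u.2 = totfrac r.
  elim: t => [|u t [r IHt]]; first by exists 1; rewrite big_nil rmorph1.
  have [r' e] := ev_poly u.1 u.2.
  by exists (r' * r); rewrite big_cons IHt e rmorphM.
by exists (r + p); rewrite rmorphD.
Qed.

Lemma mu_poly A B : polynomial A -> polynomial B -> polynomial (mu A B).
Proof.
by move=> hA hB; apply: (formula_poly (@mu_words_natural) hA hB (mu_formula A B)).
Qed.

Lemma arit_poly A B : polynomial A -> polynomial B -> polynomial (arit B A).
Proof.
move=> hA hB; rewrite arit_formula; apply: polyB.
  exact: (formula_poly (@arit_words_l_natural) hA hB (fun=> erefl)).
exact: (formula_poly (@arit_words_r_natural) hA hB (fun=> erefl)).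
Qed.

Lemma ari_poly A B : polynomial A -> polynomial B -> polynomial (ari A B).
Proof.
move=> hA hB; apply: polyD; first by apply: polyB; apply: arit_poly.
by apply: polyB; apply: mu_poly.
Qed.

Lemma ev_nat A (F : forall V : zmodType, seq (V * V) -> seq (V * V)) M :
  (forall (V V' : zmodType) (f : {additive V -> V'}) w, F _ (mapl f w) = mapl f (F _ w)) ->
  polynomial A -> (forall d, M d = ev A (F _ (gword R d))) ->
  polynomial M /\ forall n (w : word n), ev M w = ev A (F _ w).
Proof.
move=> hF hA hM.
pose L (V : zmodType) (w : seq (V * V)) := [:: [:: (true, F _ w)]].
have hL : natural L by move=> V V' f w; rewrite /L hF.
have LE n (w : word n) : formula A A L w = ev A (F _ w).
  by rewrite /formula /L !big_seq1.
split; first by apply: (formula_poly hL hA hA) => d; rewrite LE.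
have [|||d|_ h] := @formula_nice R A A (@Pall R) (@Pall R) (@Pall R) L hL _ _ _ (fun=> isT) M.
- exact: poly_nice.
- exact: poly_nice.
- by move=> n w _; rewrite /L.
- by rewrite LE.
by move=> n w; rewrite h.
Qed.

Lemma swap_poly A : polynomial A ->
  polynomial (swap A) /\ forall n (w : word n), ev (swap A) w = ev A (swap_word w).
Proof.
move=> hA; apply: (@ev_nat A (fun V => @swap_word V)) => // V V' f w.
exact: swap_word_mapl.
Qed.

Lemma evZ n (w : word n) (k : R) M : polynomial M ->
  ev (k *: M) w = rcst n k * ev M w.
Proof.
move=> hM; rewrite !(evE _ (erefl (size w))).
rewrite -[(k *: M) _]/(rcst _ k * M (size w)).
rewrite (rsubstM (X := @points R (@Pall R) (size w))) ?rsubst_rcst //.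
- by exists w.
- exact: rdef_poly.
- exact: (poly_nice (@Pall R) hM).
Qed.

Lemma ev_D n (w : word n) M A : polynomial M -> polynomial A ->
  ev (M + A) w = ev M w + ev A w.
Proof. by move=> hM hA; apply: (@evD R (@Pall R)) => //; apply: poly_nice. Qed.

Lemma ev_B n (w : word n) M A : polynomial M -> polynomial A ->
  ev (M - A) w = ev M w - ev A w.
Proof. by move=> hM hA; apply: (@evB R (@Pall R)) => //; apply: poly_nice. Qed.

Lemma ev_eq0 n (w : word n) M : M (size w) = 0 -> ev M w = 0.
Proof. by move=> h; rewrite (evE _ (erefl (size w))) h rsubst0. Qed.

Lemma ev_poly_gword M d : polynomial M -> ev M (gword R d) = M d.
Proof. by move=> hM; apply: (@ev_gword R (@Pall R)) => //; apply: poly_nice. Qed.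

Lemma poly_eq M A : polynomial M -> polynomial A ->
  (forall n (w : word n), ev M w = ev A w) -> M = A.
Proof.
by move=> hM hA h; apply: (@nice_eq R (@Pall R)) => //; apply: poly_nice.
Qed.

Lemma const_poly C : const_mould C -> polynomial C.
Proof. by move=> [_ h] d; have [c ->] := h d; exists c%:MP. Qed.

Lemma const_fconst C n : const_mould C -> fconst (@ev R n C).
Proof.
move=> [_ h] w w' e; rewrite (evE _ (erefl (size w))) (evE _ (esym e)).
by have [c ->] := h (size w); rewrite !rsubst_rcst.
Qed.

(** The shuffle sum is a [formula] in A; it vanishes on the generic word, hence on all its
    specializations. *)
Lemma falternal_ev A n : polynomial A -> alternal A ->
  falternal xpredT (@ev R n A).
Proof.
move=> hA [_ alt] x y _ nx ny.
pose L (V : zmodType) (w : seq (V * V)) :=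
  [seq [:: (true, z)] | z <- shuffle (take (size x) w) (drop (size x) w)].
have shE (V V' : zmodType) (f : {additive V -> V'}) a b :
    shuffle (mapl f a) (mapl f b) = map (mapl f) (shuffle a b).
  elim: a b => [|l a IHa] b //; elim: b => [|k b IHb] //=.
  rewrite map_cat -!map_comp -[_ :: mapl f b]/(mapl f (k :: b)) IHa; congr (_ ++ _).
    by rewrite -map_comp; apply: eq_map.
  by rewrite [X in map _ X]IHb -map_comp; apply: eq_map.
pose M : bimould R := fun d => \sum_(z <- shuffle (take (size x) (gword R d))
   (drop (size x) (gword R d))) ev A z.
have [||||d|_ h] := @formula_nice R A A (@Pall R) (@Pall R) (@Pall R) L _ _ _ _ (fun=> isT) M.
- move=> V V' f w; rewrite /L mapl_take mapl_drop shE -!map_comp.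
  by apply: eq_map.
- exact: poly_nice.
- exact: poly_nice.
- by move=> k w _; rewrite /L all_map; apply/allP => z _.
- by rewrite /M /formula big_map; apply: eq_bigr => z _; rewrite big_seq1.
have := h n (x ++ y) isT; rewrite /formula big_map take_size_cat // drop_size_cat //.
rewrite ev_eq0; last first.
  rewrite /M alt // size_cat -{2}[size x]addn0 ltn_add2l.
  by case: (x) nx => //; case: (y) ny.
by move=> ->; apply: eq_bigr => z _; rewrite big_seq1.
Qed.

Lemma alternal_of_falternal A : A 0%N = 0 ->
  (forall n, falternal xpredT (@ev R n A)) -> alternal A.
Proof.
move=> A0 h; split=> // d n /andP[n0 nd]; apply: h => //.
- by apply/eqP; rewrite -size_eq0 size_takel ?size_gword ?(ltnW nd) // -lt0n.
- by apply/eqP; rewrite -size_eq0 size_drop size_gword subn_eq0 -ltnNge.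
Qed.

Lemma alternil_of_falternil A : A 0%N = 0 ->
  (forall n, falternil (@ev R n A)) -> alternil A.
Proof.
move=> A0 h; split=> // d n /andP[n0 nd]; apply: h => //.
- rewrite cat_take_drop; exact: Pdiff_gword.
- by apply/eqP; rewrite -size_eq0 size_takel ?size_gword ?(ltnW nd) // -lt0n.
- by apply/eqP; rewrite -size_eq0 size_drop size_gword subn_eq0 -ltnNge.
Qed.

Definition udiff m (X : forall n, ('I_m -> ratfun R n) -> Prop)
    (l k : {mpoly R[m]} * {mpoly R[m]}) :=
  (totfrac (l.2 - k.2) \is a GRing.unit) /\
  forall n x, @X n x -> peval x (l.2 - k.2) \is a GRing.unit.

Lemma rdef_divided_difference m (X : forall n, ('I_m -> ratfun R n) -> Prop)
    (f1 f2 f3 f4 : ratfun R m) q :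
  rdef X f1 -> rdef X f2 -> rdef X f3 -> rdef X f4 ->
  totfrac q \is a GRing.unit ->
  (forall n x, @X n x -> peval x q \is a GRing.unit) ->
  rdef X (f1 + f2 + (totfrac q)^-1 * (f3 - f4)) /\
  forall n x, @X n x -> rsubst x (f1 + f2 + (totfrac q)^-1 * (f3 - f4)) =
    rsubst x f1 + rsubst x f2 + (peval x q)^-1 * (rsubst x f3 - rsubst x f4).
Proof.
move=> d1 d2 d3 d4 uq hq; have dV := rdefV uq hq.
have dB := rdefB d3 d4; have d12 := rdefD d1 d2; have dM := rdefM dV dB.
split=> [|n x Xx]; first exact: rdefD.
rewrite (rsubstD Xx d12 dM) (rsubstD Xx d1 d2) (rsubstM Xx dV dB) (rsubstB Xx d3 d4).
by rewrite (rsubstV uq (hq n x Xx)).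
Qed.

(** The counterpart of [formula_nice] for stuffle sums, whose coefficients are fractions. The word
    pre collects the letters already chosen in the recursion. *)
Lemma stsum_nat A m (X : forall n, ('I_m -> ratfun R n) -> Prop)
    (pre x y : seq ({mpoly R[m]} * {mpoly R[m]})) : polynomial A ->
  {in x & y, forall l k, udiff X l k} ->
  rdef X (stsum (fun z => ev A (mapl totfrac pre ++ z)) (mapl totfrac x) (mapl totfrac y))
  /\ forall n p, @X n p ->
    rsubst p (stsum (fun z => ev A (mapl totfrac pre ++ z)) (mapl totfrac x) (mapl totfrac y))
    = stsum (fun z => ev A (mapl (peval p) pre ++ z)) (mapl (peval p) x) (mapl (peval p) y).
Proof.
move=> hA.
have base (z : seq ({mpoly R[m]} * {mpoly R[m]})) : rdef X (ev A (mapl totfrac z)) /\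
    forall n p, @X n p -> rsubst p (ev A (mapl totfrac z)) = ev A (mapl (peval p) z).
  by apply: (@ev_comp R (@Pall R)) => //; apply: poly_nice.
elim: x pre y => [|l x IHx] pre y.
  move=> _; rewrite stsum_nill -mapl_cat; have [d1 r1] := base (pre ++ y).
  by split=> // n p Xp; rewrite stsum_nill -mapl_cat; apply: r1.
elim: y pre => [|k y IHy] pre h.
  rewrite stsum_nilr -mapl_cat; have [d1 r1] := base (pre ++ l :: x).
  by split=> // n p Xp; rewrite stsum_nilr -mapl_cat; apply: r1.
have cc (U : Type) (f : {mpoly R[m]} -> U) j z :
   mapl f pre ++ (f j.1, f j.2) :: z = mapl f (rcons pre j) ++ z.
  by rewrite /mapl map_rcons cat_rcons.
have hl : {in x & k :: y, forall l k, udiff X l k}.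
  by move=> a b ha hb; apply: h => //; rewrite inE ha orbT.
have hk : {in l :: x & y, forall l k, udiff X l k}.
  by move=> a b ha hb; apply: h => //; rewrite inE hb orbT.
have hlk : {in x & y, forall l k, udiff X l k}.
  by move=> a b ha hb; apply: h; rewrite inE ?ha ?hb orbT.
have [d1 r1] := IHx (rcons pre l) (k :: y) hl.
have [d2 r2] := IHy (rcons pre k) hk.
have [d3 r3] := IHx (rcons pre (l.1 + k.1, l.2)) y hlk.
have [d4 r4] := IHx (rcons pre (k.1 + l.1, k.2)) y hlk.
have [u1 u2] := h l k (mem_head _ _) (mem_head _ _).
have step n (f : {rmorphism {mpoly R[m]} -> ratfun R n}) :
  stsum (fun z => ev A (mapl f pre ++ z)) (mapl f (l :: x)) (mapl f (k :: y)) =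
  stsum (fun z => ev A (mapl f (rcons pre l) ++ z)) (mapl f x) (mapl f (k :: y))
  + stsum (fun z => ev A (mapl f (rcons pre k) ++ z)) (mapl f (l :: x)) (mapl f y)
  + (f (l.2 - k.2))^-1 *
     (stsum (fun z => ev A (mapl f (rcons pre (l.1 + k.1, l.2)) ++ z)) (mapl f x) (mapl f y)
    - stsum (fun z => ev A (mapl f (rcons pre (k.1 + l.1, k.2)) ++ z)) (mapl f x) (mapl f y)).
  rewrite [mapl f (l :: x)]/= [mapl f (k :: y)]/= stsum_cons rmorphB /=.
  by congr (_ + _ + _ * (_ - _)); apply: eq_bigr => t _; rewrite -cc //=
    ?rmorphD // addrC.
rewrite (step _ (@TotFrac.tofrac _)).
have [d r] := rdef_divided_difference d1 d2 d3 d4 u1 u2.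
split=> [|n p Xp]; first exact: d.
by rewrite (r n p Xp) r1 // r2 // r3 // r4 // (step _ (mmap (@rcst R n) p)).
Qed.

End Bimoulds.

(** * The bimoulds pic and poc *)

Section PicPoc.
Variable R : comNzRingType.
Local Notation word n := (seq (ratfun R n * ratfun R n)).

Section Prod.
Variables (m : nat) (X : forall n, ('I_m -> ratfun R n) -> Prop).

Lemma rdef_cuts (T : Type) (F : seq T -> seq T -> ratfun R m) w :
  (forall a b, rdef X (F a b)) -> rdef X (cuts F w).
Proof.
elim: w F => [|l w IH] F h; rewrite cutsE //; apply: rdefD => //; exact: IH.
Qed.

Lemma rsubst_cuts n (x : 'I_m -> ratfun R n) (T : Type)
    (F : seq T -> seq T -> ratfun R m) w : X x -> (forall a b, rdef X (F a b)) ->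
  rsubst x (cuts F w) = cuts (fun a b => rsubst x (F a b)) w.
Proof.
move=> Xx; elim: w F => [|l w IH] F h; rewrite !cutsE // (rsubstD Xx) ?IH //.
exact: rdef_cuts.
Qed.

End Prod.

Lemma vvar_unit d (i : 'I_d) : vvar R i \is a GRing.unit.
Proof. by apply: TotFrac.tofrac_unit; apply: lreg_var. Qed.

Lemma peval_v n d (w : word n) (i : 'I_d) :
  peval (@coord R n d w) 'X_(rshift d i) = (nth 0 w i).2.
Proof. by rewrite /peval mmapX mmap1U /coord (unsplitK (inr i)). Qed.

Lemma Pgen_nth n (w : word n) i : Pgen w -> (i < size w)%N ->
  (nth 0 w i).2 \is a GRing.unit.
Proof.
move=> /andP[/(all_nthP 0) h _] hi; have := h _ hi.
by rewrite -unitrN opprB subr0.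
Qed.

Lemma pic_nice : nice (@Pgen R) (pic R) /\
  forall n (w : word n), Pgen w -> ev (pic R) w = pprod 0 w.
Proof.
have dV d (i : 'I_d) : rdef (@points R (@Pgen R) d) (vvar R i)^-1.
  apply: rdefV; first exact: vvar_unit.
  by move=> n x [w [sw Pw ->]]; rewrite peval_v; apply: Pgen_nth; rewrite ?sw.
split=> [d|n w Pw]; first by rewrite /pic; apply: rdef_prod.
have Xw : @points R (@Pgen R) (size w) n (@coord R n (size w) w) by exists w.
rewrite (@evE R n (size w)) // (rsubst_prod Xw) //.
rewrite /pprod (big_nth 0) big_mkord; apply: eq_bigr => i _.
rewrite rsubstV ?peval_v ?subr0 //; first exact: vvar_unit.
exact: Pgen_nth.
Qed.

Lemma chain_prod (K : comUnitRingType) p (w : seq (K * K)) : pdiff ((0, p) :: w) ->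
  let D := \prod_(i < size w) ((nth 0 ((0, p) :: w) i).2 - (nth 0 w i).2) in
  D \is a GRing.unit /\ chain p w = D^-1.
Proof.
elim: w p => [|l w IH] p hP /=; first by rewrite big_ord0 unitr1 invr1.
have [u e] := IH l.2 (pdiff_cons hP).
have up : p - l.2 \is a GRing.unit by move: hP => /andP[/andP[]].
rewrite big_ord_recl /=.
have eq : \prod_(i < size w) ((nth 0 (l :: w) (lift ord0 i).-1).2 - (nth 0 w i).2)
   = \prod_(i < size w) ((nth 0 ((0, l.2) :: w) i).2 - (nth 0 w i).2).
  by apply: eq_bigr => -[[|i] hi] _.
rewrite [X in _ * X](_ : _ = \prod_(i < size w) ((nth 0 ((0, l.2) :: w) i).2 - (nth 0 w i).2)).
  by rewrite unitrM up u invrM // e mulrC.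
by apply: eq_bigr => -[[|i] hi] _.
Qed.

Lemma poc_nice : nice (@Pgen R) (poc R) /\
  forall n (w : word n), Pgen w -> ev (poc R) w = chain 0 w.
Proof.
(* The denominator of [poc] as a polynomial, without its sign. *)
pose q d' : {mpoly R[d'.+1 + d'.+1]} := 'X_(rshift d'.+1 ord0) *
  \prod_(i < d') ('X_(rshift d'.+1 (inord i : 'I_d'.+1)) - 'X_(rshift d'.+1 (inord i.+1))).
have pocE d' : poc R d'.+1 = - (totfrac (q d'))^-1.
  rewrite /poc /q rmorphM rmorph_prod; congr (- (_ * _)^-1).
  by apply: eq_bigr => i _; rewrite rmorphB.
have val n d' (f : {rmorphism {mpoly R[d'.+1 + d'.+1]} -> ratfun R n}) (w : word n) :
    (forall i, f 'X_(rshift d'.+1 i) = (nth 0 w i).2) -> size w = d'.+1 -> Pgen w ->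
    f (q d') \is a GRing.unit /\ - (f (q d'))^-1 = chain 0 w.
  case: w => // l w hf [sw] Pw.
  have [u ->] := chain_prod (p := 0) (w := l :: w) Pw.
  set D := \prod_(i < _) _ in u *.
  suff -> : f (q d') = - D by rewrite unitrN u invrN opprK.
  rewrite /D [size _]/= big_ord_recl [nth _ (0 :: _) _]/= sub0r mulNr.
  rewrite /q rmorphM rmorph_prod hf opprK; congr (_ * _).
  rewrite sw; apply: eq_bigr => i _.
  by rewrite rmorphB !hf !inordK ?ltnS // ltnW.
have uq d' : totfrac (q d') \is a GRing.unit.
  case: (val _ d' (@TotFrac.tofrac _) (gword R d'.+1)) => // [i||].
  - by rewrite (nth_map i) ?size_enum_ord // nth_ord_enum.
  - exact: size_gword.
  - exact: Pgen_gword.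
have nq d' : rdef (@points R (@Pgen R) d'.+1) (totfrac (q d'))^-1.
  apply: rdefV => //.
  move=> n x [w [sw Pw ->]].
  case: (val _ d' (mmap (@rcst R n) (@coord R n d'.+1 w)) w) => // i.
  exact: peval_v.
split=> [[|d]|n [|l w] Pw].
- by rewrite /= -(rmorph1 (@TotFrac.tofrac _)); apply: rdef_poly.
- by rewrite pocE; apply: rdefN.
- by rewrite (@evE R n 0) // rsubst1.
have Xw : @points R (@Pgen R) (size w).+1 n (@coord R n (size w).+1 (l :: w)).
  by exists (l :: w).
rewrite (@evE R n (size w).+1) // pocE (rsubstN Xw) //.
have [u <-] := val _ (size w) (mmap (@rcst R n) (@coord R n (size w).+1 (l :: w))) (l :: w)
  (fun i => peval_v _ i) erefl Pw.
by rewrite rsubstV.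
Qed.

Lemma ganit_poc_nice A : nice (@Pdiff R) A -> nice (@Pdiff R) (ganit (poc R) A) /\
  forall n (w : word n), pdiff w -> ev (ganit (poc R) A) w = subst chain (ev A) w.
Proof.
move=> hA; have [n1 e1] := poc_nice; have [n2 e2] := ganit_nice n1 hA (erefl _).
split=> // n w Pw; rewrite e2 //; apply: eq_subst_pdiff => // l c hP.
rewrite e1; first by rewrite -[RHS](chain_shv l.2) subrr.
have -> : Pgen (shv l.2 c) = pdiff (shv l.2 (l :: c)).
  by rewrite /Pgen /pdiff /= subrr.
by rewrite pdiff_shv.
Qed.

Lemma ganit_pic_nice A : nice (@Pdiff R) A -> nice (@Pdiff R) (ganit (pic R) A) /\
  forall n (w : word n), pdiff w -> ev (ganit (pic R) A) w = subst pprod (ev A) w.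
Proof.
move=> hA; have [n1 e1] := pic_nice.
have p0 : pic R 0 = 1 by rewrite /pic big_ord0.
have [n2 e2] := ganit_nice n1 hA p0.
split=> // n w Pw; rewrite e2 //; apply: eq_subst_pdiff => // l c hP.
rewrite e1; first by rewrite -[RHS](pprod_shv l.2) subrr.
have -> : Pgen (shv l.2 c) = pdiff (shv l.2 (l :: c)).
  by rewrite /Pgen /pdiff /= subrr.
by rewrite pdiff_shv.
Qed.

End PicPoc.

(** * Moulds in the u's, parity and swap *)

Section UMoulds.
Variable R : comNzRingType.
Local Notation word n := (seq (ratfun R n * ratfun R n)).
Implicit Types (M A B C : bimould R).

Lemma rmorph_mmap k m n (f : {rmorphism {mpoly R[m]} -> ratfun R n})
    (x : 'I_k -> {mpoly R[m]}) p :
  (forall c, f c%:MP = rcst n c) ->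
  f (mmap (@mpolyC m R) x p) = peval (f \o x) p.
Proof.
move=> fC; rewrite /peval /mmap rmorph_sum; apply: eq_bigr => u _.
rewrite rmorphM fC; congr (_ * _); rewrite /mmap1 rmorph_prod.
by apply: eq_bigr => i _; rewrite rmorphXn.
Qed.

Lemma ev_umould A n (w : word n) p : A (size w) = peval (@uvar R (size w)) p ->
  ev A w = peval (fun i => (nth 0 w i).1) p.
Proof.
rewrite (evE _ (erefl (size w))) => ->.
pose x i : {mpoly R[size w + size w]} := 'X_(lshift (size w) i).
rewrite -(rmorph_mmap (f := @TotFrac.tofrac _) x) // rsubst_poly.
rewrite [LHS](rmorph_mmap (f := mmap (@rcst R n) (@coord R n _ w))).
  congr peval; apply: funext => i /=.
  by rewrite mmapX mmap1U /coord (unsplitK (inl i)).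
exact: mmapC.
Qed.

Lemma ARI_pol_vfree A n : ARI_pol A -> vfree (@ev R n A).
Proof.
move=> [_ hA] w w' e.
have sE : size w' = size w by rewrite -(size_map fst) -/(unzip1 w') -e size_map.
have [p hp] := hA (size w).
rewrite (ev_umould hp); have [q hq] := hA (size w').
rewrite (ev_umould hq); move: q hq; rewrite sE => q hq.
have -> : (fun i : 'I_(size w) => (nth 0 w' i).1) = fun i => (nth 0 w i).1.
  apply: funext => i; rewrite -!(nth_map 0 0 fst) ?sE //.
  by rewrite -/(unzip1 w) e.
by rewrite -(ev_umould hq) -(ev_umould hp).
Qed.

Lemma vfree_umould A : polynomial A -> (forall n, vfree (@ev R n A)) ->
  forall d, exists p : {mpoly R[d]}, A d = peval (@uvar R d) p.
Proof.
move=> hA vA d; have [q hq] := hA d.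
(* Setting the v's to 0 does not change the values of A. *)
pose x (k : 'I_(d + d)) : {mpoly R[d]} :=
  match split k with inl i => 'X_i | inr _ => 0 end.
exists (mmap (@mpolyC d R) x q).
rewrite [RHS](rmorph_mmap (f := mmap (@rcst R _) (@uvar R d))); last exact: mmapC.
rewrite -(ev_poly_gword d hA).
rewrite (vA _ _ [seq (uvar R i, 0) | i <- enum 'I_d]); last first.
  by rewrite /unzip1 -!map_comp.
rewrite (@evE R _ d); last by rewrite size_map size_enum_ord.
rewrite hq rsubst_poly; congr peval.
apply: funext => k; rewrite /coord /x /=; case: (split k) => i.
  by rewrite (nth_map i) ?size_enum_ord // nth_ord_enum mmapX mmap1U.
by rewrite (nth_map i) ?size_enum_ord // rmorph0.
Qed.

Definition feven n (M : word n -> ratfun R n) :=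
  forall l, M [:: (- l.1, - l.2)] = M [:: l].

Lemma gword1 : gword R 1 = [:: (uvar R (@ord0 0), vvar R (@ord0 0))].
Proof. by rewrite /gword enum_ordSl /= (size0nil (size_enum_ord 0)). Qed.

Lemma even1_feven A n : polynomial A -> even1 A -> feven (@ev R n A).
Proof.
move=> hA eA l.
pose F (V : zmodType) (w : seq (V * V)) := [seq (- l.1, - l.2) | l <- w].
pose N : bimould R := fun d => ev A (F _ (gword R d)).
have [||pN eN] := @ev_nat R A F N _ hA.
- move=> V V' f w; rewrite /F /mapl -!map_comp; apply: eq_map => k /=.
  by rewrite !raddfN.
- by [].
rewrite -[LHS](eN n [:: l]) !(@evE R n 1) //; congr rsubst.
by rewrite /N gword1 /= eA.
Qed.

Lemma feven_even1 A : polynomial A -> (forall n, feven (@ev R n A)) -> even1 A.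
Proof. by move=> hA eA; rewrite /even1 (eA _ (_, _)) -gword1 ev_poly_gword. Qed.

Lemma size_swap_word (V : zmodType) (w : seq (V * V)) : size (swap_word w) = size w.
Proof. exact: size_mkseq. Qed.

(** The u's of the double swap are differences of consecutive partial sums of the u's of w. *)
Lemma swap_wordK1 (V : zmodType) (w : seq (V * V)) :
  unzip1 (swap_word (swap_word w)) = unzip1 w.
Proof.
apply: (@eq_from_nth _ 0) => [|i]; rewrite size_map !size_swap_word.
  by rewrite size_map.
move=> hi; have nE (z : seq (V * V)) j : (j < size z)%N -> nth 0 (swap_word z) j =
    ((nth 0 z (size z - j.+1)).2 - (nth 0 z (size z - j)).2,
     \sum_(k < size z - j) (nth 0 z k).1).
  by move=> hj; rewrite /swap_word nth_mkseq.
rewrite [RHS](nth_map 0) // [LHS](nth_map 0) ?size_swap_word // nE ?size_swap_word //=.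
have vE j : (j <= size w)%N ->
    (nth 0 (swap_word w) j).2 = \sum_(k < size w - j) (nth 0 w k).1.
  rewrite leq_eqVlt => /orP[/eqP ->|hj]; last by rewrite nE.
  by rewrite nth_default ?size_swap_word // subnn big_ord0.
rewrite !vE ?leq_subr // !subKn ?(ltnW hi) // big_ord_recr /= addrAC subrr add0r.
by [].
Qed.

(** [swap_word] lists the differences of the v's in reverse order; the antipode of the alternal A
    undoes the reversal at the cost of a sign. *)
Lemma ev_swap_part A C n (w : word n) : polynomial A -> const_mould C ->
  vfree (@ev R n A) -> alternal A ->
  ev (swap A + C) w = swap_part (@ev R n A) (@ev R n C) w.
Proof.
move=> hA hC vA alt; have [pS eS] := swap_poly hA.
rewrite ev_D //; last exact: const_poly.
rewrite eS /swap_part; congr (_ + _).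
rewrite (vA _ (rev (steps 0 w))); last first.
  by rewrite swap_word_steps /unzip1 map_rev.
rewrite (falternal_rev _ (falternal_ev hA alt)); last first.
  by case: alt => A0 _; apply: ev_nil0.
by rewrite /sgw size_steps.
Qed.

(** The denominators of a stuffle are differences between a letter of x and one of y, so v's may be
    repeated inside x or inside y. This is what allows words of zeros below. *)
Lemma stsum_ev A n (x y : word n) : polynomial A -> alternil A ->
  allrel (fun l k => l.2 - k.2 \is a GRing.unit) x y ->
  x <> [::] -> y <> [::] -> stsum (@ev R n A) x y = 0.
Proof.
move=> hA [_ alt] hxy nx ny.
pose d := size (x ++ y); pose s := size x.
pose P n (w : word n) :=
  allrel (fun l k => l.2 - k.2 \is a GRing.unit) (take s w) (drop s w).
pose X := @points R P d.
have udf (i j : 'I_d) : (i < s <= j)%N ->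
    udiff X ('X_(lshift d i), 'X_(rshift d i)) ('X_(lshift d j), 'X_(rshift d j)).
  move=> /andP[hi hj]; split.
    apply: TotFrac.tofrac_unit; apply: lreg_subvar.
    apply/eqP => /rshift_inj e; move: hj; rewrite -e; lia.
  move=> k p [w [sw Pw ->]].
  have -> : peval (@coord R k d w) ('X_(rshift d i) - 'X_(rshift d j)) =
     (nth 0 w i).2 - (nth 0 w j).2 by rewrite -!peval_v; apply: rmorphB.
  apply: (allrelP Pw).
    by rewrite -(nth_take _ hi) mem_nth // size_take_min sw leq_min hi ltn_ord.
  by rewrite -{1}(subnKC hj) -nth_drop mem_nth // size_drop sw; have := ltn_ord j; lia.
have := @stsum_nat R A (d + d) X [::] (take s (gword0 R d)) (drop s (gword0 R d)) hA.
have ge (i : 'I_d) t : i \in take t (enum 'I_d) -> (i < t)%N.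
  move=> hi; have : val i \in map val (take t (enum 'I_d)) by rewrite map_f.
  by rewrite map_take val_enum_ord take_iota mem_iota add0n leq_min => /andP[_ /andP[]].
have le (i : 'I_d) t : i \in drop t (enum 'I_d) -> (t <= i)%N.
  move=> hi; have : val i \in map val (drop t (enum 'I_d)) by rewrite map_f.
  by rewrite map_drop val_enum_ord drop_iota mem_iota => /andP[].
case.
  rewrite /gword0 -map_take -map_drop => l k /mapP[i hi ->] /mapP[j hj ->].
  by apply: udf; rewrite ge ?le.
move=> _ r.
have Xx : X _ (@coord R n d (x ++ y)).
  by exists (x ++ y); rewrite /P take_size_cat // drop_size_cat.
have := r _ _ Xx.
rewrite -!mapl_take -!mapl_drop -gwordE peval_gword0 // take_size_cat // drop_size_cat //.
rewrite [stsum _ (take _ _) _](alt d s) ?rsubst0; last first.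
  rewrite /d /s size_cat -{2}[size x]addn0 ltn_add2l.
  by case: (x) nx => //; case: (y) ny.
by move=> <-.
Qed.

Lemma falternil_ev A n : polynomial A -> alternil A -> falternil (@ev R n A).
Proof.
move=> hA alt x y hP nx ny; apply: stsum_ev => //.
by move: hP; rewrite /pdiff pairwise_cat => /and3P[].
Qed.

End UMoulds.

(** * Constants *)

Section Nseq.
Variables (T : eqType) (K : comNzRingType).

Lemma cuts_const (c : K) (w : seq T) : cuts (fun _ _ => c) w = c *+ (size w).+1.
Proof. by elim: w => [|l w IH]; rewrite cutsE // IH -mulrS. Qed.

Lemma cat_nseq (k : nat) (t : T) a b : a ++ b = nseq k t ->
  a = nseq (size a) t /\ b = nseq (size b) t.
Proof.
move=> e; have /all_pred1P h : all (pred1 t) (a ++ b).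
  by rewrite e; apply/all_pred1P; rewrite size_nseq.
have : all (pred1 t) (a ++ b) by rewrite h all_pred1_nseq.
by rewrite all_cat => /andP[/all_pred1P ? /all_pred1P].
Qed.

Lemma cutl_nseq (F : seq T -> T -> seq T -> K) k t :
  cutl F (nseq k.+1 t) = cuts (fun a b => F a t b) (nseq k t).
Proof. by elim: k F => [|k IH] F; rewrite cutlE ?IH /= cutsE ?cutlE ?addr0. Qed.

End Nseq.

Section Constants.
Variable K : comUnitRingType.
Local Notation word := (seq (K * K)).
Hypothesis K_tf : forall (x : K) k, x *+ k.+1 = 0 -> x = 0.

Lemma falternil_const (M : word -> K) t y : falternil M -> pdiff (t :: y) ->
  y <> [::] ->
  (forall z z', (size y <= size z)%N -> size z = size z' -> M z = M z') ->
  M (t :: y) = 0.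
Proof.
move=> hM hP ny hc; apply: (K_tf (k := size y)).
rewrite -cuts_const -[RHS](hM [:: t] y hP) // stsum_letter -[LHS]addr0.
congr (_ + _).
  apply: eq_cuts => a b e; apply: hc; first exact: leqnSn.
  by rewrite -e /= !size_cat /= addnS.
rewrite (eq_cutl (F' := fun _ _ _ => 0)) ?cutl0 // => a l b e.
rewrite (hc _ (a ++ addu l t.1 :: b)) ?subrr ?mulr0 ?size_cat //.
by rewrite -e !size_cat.
Qed.

(** All shuffles of one zero with the other zeros coincide. *)
Lemma falternal_nseq (M : word -> K) k : falternal xpredT M -> (1 < k)%N ->
  M (nseq k 0) = 0.
Proof.
case: k => [|[|k]] // hM _; apply: (K_tf (k := k.+1)).
rewrite -[RHS](hM [:: 0] (nseq k.+1 0)) //.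
rewrite (eq_shsum_perm (F' := fun=> M (nseq k.+2 0))) => [|z hz].
  rewrite /shsum big_const_seq count_predT iter_addr_0; congr (_ *+ _).
  by elim: (k.+1) => //= j IH; rewrite size_map -IH.
have /all_pred1P -> : all (pred1 0) z.
  rewrite (perm_all _ hz); exact: (all_pred1_nseq _ k.+2).
by rewrite (perm_size hz) /= size_nseq.
Qed.

End Constants.

(** * Vanishing on words of zeros of even length *)

Section EvenConstants.
Variable R : comAlgType rat.
Local Notation word n := (seq (ratfun R n * ratfun R n)).
Implicit Types (M A B C : bimould R).

Lemma ratfun_torsionfree n (x : ratfun R n) k : x *+ k.+1 = 0 -> x = 0.
Proof.
move=> h; pose c : R := (k.+1%:R^-1 : rat)%:A.
have cE : c *+ k.+1 = 1.
  by rewrite /c scalerMnl -mulr_natr mulVf ?scale1r // pnatr_eq0.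
by rewrite -[x]mulr1 -(rmorph1 (@rcst R n)) -cE rmorphMn /= mulrnAr -mulrnAl h
  mul0r.
Qed.

Let v : {mpoly R[1 + 1]} := 'X_(rshift 1 ord0).
Let s : ratfun R (1 + 1) := totfrac v.
(** The shuffle part of the stuffle of the letter (0, e) with k zeros, studied as a function of
    e. *)
Let g M k (e : ratfun R (1 + 1)) : ratfun R (1 + 1) :=
  cuts (fun a b => ev M (a ++ (0, e) :: b)) (nseq k 0).

(** Alternility for the letter (0, e) and k+1 zeros, multiplied by e to clear the denominator of the
    divided differences. *)
Lemma gS M k (e : ratfun R (1 + 1)) : polynomial M -> alternil M ->
  e \is a GRing.unit ->
  e * g M k.+1 e + g M k e = ev M (nseq k.+1 0 : word (1 + 1)) *+ k.+1.
Proof.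
move=> hM alt ue; have := stsum_ev (x := [:: (0, e)]) (y := nseq k.+1 0) hM alt.
rewrite stsum_letter cutl_nseq => h.
have := congr1 (fun x => e * x) (h _ _ _); rewrite mulr0 mulrDr -[X in _ + X]cutsM.
rewrite (eq_cuts (F := fun a b => _ * (_ * _))
  (F' := fun a b => ev M (a ++ (0, e) :: b) - ev M (nseq k.+1 0 : word (1 + 1)))).
  rewrite cutsB cuts_const size_nseq => e0; apply/eqP.
  rewrite -subr_eq0 -addrA; apply/eqP/e0 => //.
  by apply/allrelP => l m; rewrite inE => /eqP -> /nseqP[-> _]; rewrite subr0.
move=> a b ab; rewrite mulrA subr0 mulrV // mul1r /= addu0.
have [-> ->] := cat_nseq ab; rewrite /addu /= !addr0.
have -> : (0, 0) = 0 :> ratfun R (1 + 1) * ratfun R (1 + 1) by [].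
rewrite -[0 :: _]/(nseq (size b).+1 0) -nseqD.
by rewrite (addnS (size a)) -size_cat ab size_nseq.
Qed.

Lemma rsubst_g M k q : polynomial M ->
  rdef (fun _ _ => True) (g M k (totfrac q)) /\
  forall x : 'I_(1 + 1) -> ratfun R (1 + 1),
    rsubst x (g M k (totfrac q)) = g M k (peval x q).
Proof.
move=> hM; pose z a b : seq ({mpoly R[1 + 1]} * {mpoly R[1 + 1]}) := a ++ (0, q) :: b.
have base a b := @ev_comp R (@Pall R) M _ (fun _ _ => True) (z a b)
  (poly_nice _ hM) isT (fun _ _ _ => isT).
have gE (f : {rmorphism {mpoly R[1 + 1]} -> ratfun R (1 + 1)}) :
    g M k (f q) = cuts (fun a b => ev M (mapl f (z a b))) (nseq k 0).
  rewrite /g; have -> : nseq k (0 : ratfun R (1 + 1) * ratfun R (1 + 1)) = mapl f (nseq k 0).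
    by rewrite /mapl map_nseq !rmorph0.
  rewrite cuts_map; apply: eq_cuts => a b _; congr ev.
  by rewrite /z /mapl map_cat /= rmorph0.
rewrite (gE (@TotFrac.tofrac _)).
split=> [|x]; first by apply: rdef_cuts => a b; case: (base a b).
rewrite [RHS](gE (mmap (@rcst R _) x)).
rewrite (rsubst_cuts (X := fun _ _ => True)) // => [|a b]; last by case: (base a b).
by apply: eq_cuts => a b _; case: (base a b) => _; apply.
Qed.

Lemma g0 M k : g M k 0 = ev M (nseq k.+1 0 : word (1 + 1)) *+ k.+1.
Proof.
rewrite /g -{3}(size_nseq k (0 : ratfun R (1 + 1) * ratfun R (1 + 1))) -cuts_const.
apply: eq_cuts => a b ab; congr ev; have [-> ->] := cat_nseq ab.
rewrite -[_ :: _]/(nseq (size b).+1 0) -nseqD; congr nseq.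
by rewrite (addnS (size a)) -size_cat ab size_nseq.
Qed.

(** By [gS], s g_(k+1)(s) is a constant minus g_k(s), and by [g0] this constant is g_k(0). If g_k is
    odd the constant vanishes; hence the parity alternates with k, starting from the evenness of M
    in depth 1. *)
Lemma g_even M k : polynomial M -> alternil M -> even1 M ->
  g M k (- s) = (-1) ^+ k * g M k s /\
  (odd k -> ev M (nseq k.+1 0 : word (1 + 1)) = 0).
Proof.
move=> hM alt eM; have us : s \is a GRing.unit by apply: (@vvar_unit R 1 ord0).
have odd_case j : g M j (- s) = (-1) ^+ j * g M j s -> odd j ->
    ev M (nseq j.+1 0 : word (1 + 1)) = 0.
  move=> h oj; apply: (ratfun_torsionfree (k := j)); rewrite -g0.
  pose x : 'I_(1 + 1) -> ratfun R (1 + 1) := fun=> 0.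
  have px q : q = v \/ q = - v -> peval x q = 0.
    have e : peval x v = 0 by rewrite /peval /v mmapX mmap1U.
    have eN : peval x (- v) = - peval x v by apply: rmorphN.
    by case=> ->; rewrite ?eN e ?oppr0.
  have [d1 /(_ x) h1] := rsubst_g j v hM; have [_ /(_ x) h2] := rsubst_g j (- v) hM.
  rewrite px in h1; last by left.
  rewrite px in h2; last by right.
  move: h2; rewrite rmorphN -/s h -signr_odd oj expr1 mulN1r.
  rewrite (rsubstN (X := fun _ _ => True)) // h1 => h2.
  by apply: (ratfun_torsionfree (k := 1)); rewrite mulr2n -{1}h2 addNr.
suff h : g M k (- s) = (-1) ^+ k * g M k s by split=> //; apply: odd_case.
elim: k => [|k IH].
  rewrite mul1r /g !cutsE; have := even1_feven hM eM (0, s).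
  by rewrite oppr0.
have := gS k hM alt us; have := gS k (e := - s) hM alt.
rewrite unitrN => /(_ us); set E := _ *+ _ => hn hp.
have EE : (-1) ^+ k * E = E.
  rewrite -signr_odd; case ok : (odd k); last by rewrite mul1r.
  by rewrite /E odd_case // mul0rn mulr0.
apply: (mulrI us); rewrite -[LHS]opprK -mulNr.
have -> : - s * g M k.+1 (- s) = E - (-1) ^+ k * g M k s by rewrite -IH -hn addrK.
by rewrite -{1}EE -hp exprS; ring.
Qed.

Lemma const_even M k : polynomial M -> alternil M -> even1 M -> odd k ->
  ev M (nseq k.+1 0 : word (1 + 1)) = 0.
Proof. by move=> hM alt eM; have [_] := g_even k hM alt eM. Qed.

End EvenConstants.

(** * The constant mould C_A *)

Section Model.
Variable R : comAlgType rat.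
Local Notation word n := (seq (ratfun R n * ratfun R n)).
Implicit Types (M A B C : bimould R).

Lemma rcst_eq0 n (c : R) : rcst n c = 0 -> c = 0.
Proof.
move=> h; apply: (can_inj (@mpolyCK n R)); apply: (@TotFrac.tofrac_inj _).
by rewrite -/(rcst n c) h !rmorph0.
Qed.

Lemma falternil_evB n M N : polynomial M -> polynomial N ->
  falternil (@ev R n M) -> falternil (@ev R n N) -> falternil (@ev R n (M - N)).
Proof.
move=> hM hN aM aN; have -> : @ev R n (M - N) = fun z => ev M z - ev N z.
  by apply: funext => z; apply: ev_B.
exact: falternilB.
Qed.

(* In depth at least 2 the stuffle product of a letter and a word is a positive
   multiple of a constant. *)
Lemma const_alternil_finite M d : polynomial M -> alternil M ->
  (forall k, (d <= k)%N -> exists c : R, M k = rcst (k + k) c) -> (0 < d)%N ->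
  M d.+1 = 0.
Proof.
move=> hM alt hc d0; rewrite -(ev_poly_gword _ hM).
have := Pdiff_gword R d.+1; have := size_gword R d.+1.
case: (gword _ _) => // t y [sy] hP.
apply: (falternil_const (@ratfun_torsionfree R _)) => //.
- exact: falternil_ev.
- by move=> y0; rewrite -sy y0 in d0.
- move=> z z'; rewrite sy => hz sz; rewrite (evE _ (esym sz)) (evE _ (erefl (size z))).
  by have [c ->] := hc _ hz; rewrite !rsubst_rcst.
Qed.

Section Element.
Variables (A C : bimould R).
Hypotheses (polA : ARI_pol A) (altA : alternal A) (evenA : even1 A).
Hypothesis corrC : corr_const A C.

Let hA : polynomial A. Proof. by case: polA => -[]. Qed.
Let A0 : A 0%N = 0. Proof. by case: polA => -[]. Qed.
Let vA n : vfree (@ev R n A). Proof. exact: ARI_pol_vfree. Qed.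
Let cC : const_mould C. Proof. by case: corrC. Qed.
Let pM : polynomial (swap A + C).
Proof. by apply: polyD; [case: (swap_poly hA) | apply: const_poly]. Qed.

Let swapE n : @ev R n (swap A + C) = swap_part (@ev R n A) (@ev R n C).
Proof. by apply: funext => w; apply: ev_swap_part. Qed.

Let evC1 n l : @ev R n C [:: l] = 0.
Proof. by apply: ev_eq0; case: corrC. Qed.

Lemma even1_swap : even1 (swap A + C).
Proof.
apply: (feven_even1 pM) => n l; rewrite swapE /swap_part evC1 (evC1 l).
apply: (congr1 (fun e => - (-1) ^+ 1 * e + 0)).
have := even1_feven (n := n) hA evenA (l.2, 0); rewrite /= /hdv /= !subr0 oppr0.
by move=> ->.
Qed.

(** The differences of a word of zeros are zeros, where the alternal A vanishes in depth at least 2;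
    so [const_even] speaks of C alone. *)
Lemma corr_const_even k : odd k -> C k.+1 = 0.
Proof.
move=> ok; have altM : alternil (swap A + C) by case: corrC.
have := const_even pM altM even1_swap ok; rewrite swapE /swap_part.
have -> : steps 0 (nseq k.+1 0 : word (1 + 1)) = nseq k.+1 0.
  elim: (k.+1) => //= j ->; congr ((_, _) :: _).
  by rewrite /hdv; case: j => [|j] /=; rewrite subrr.
rewrite (falternal_nseq (@ratfun_torsionfree R _) (falternal_ev hA altA)); last first.
  by case: (k) ok.
rewrite mulr0 add0r; have [_ /(_ k.+1) [c hc]] := cC.
rewrite (@evE R _ k.+1) ?size_nseq // hc rsubst_rcst => /rcst_eq0 ->.
exact: rmorph0.
Qed.

Lemma al_il_ev n : al_il (@ev R n A) (@ev R n (swap A + C)).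
Proof.
have C0 : @ev R n C [::] = 0 by apply: ev_nil0; case: cC.
have uM : ufree (@ev R n (swap A + C)).
  move=> w w' e; rewrite swapE /swap_part (steps_ufree 0 e).
  have sE : size w = size w' by rewrite -(size_map snd w) -/(unzip2 w) e size_map.
  by congr (- _ * _ + _); [rewrite /sgw sE | apply: const_fconst].
split.
- exact: vA.
- exact: ev_nil0.
- exact: uM.
- by rewrite swapE /swap_part [ev A _]ev_nil0 // mulr0 C0 addr0.
- by apply: falternil_ev => //; case: corrC.
- move=> w; rewrite swapE; apply: push_swap_part.
  + exact: falternal_ev.
  + exact: ev_nil0.
  + exact: const_fconst.
  + move=> z hz; case: z hz => // l z hz; apply: ev_eq0; apply: corr_const_even.
    move: hz; rewrite /sgw /= exprS -signr_odd; case: (odd _) => //.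
    rewrite mulr1 => h; have : (1 : ratfun R n) = 0.
      by apply: (ratfun_torsionfree (k := 1)); rewrite mulr2n -{2}h subrr.
    by move/eqP; rewrite oner_eq0.
  + by move=> z; rewrite /sgw -signr_odd; case: (odd _); [right | left].
- move=> l m e; rewrite -[RHS](even1_feven pM even1_swap); apply: uM.
  by rewrite /= e.
Qed.

End Element.

(** C - D is constant and alternil, hence zero in depth at least 2. *)
Lemma corr_const_uniq A C D : polynomial A -> corr_const A C -> corr_const A D ->
  C = D.
Proof.
move=> hA [cC C1 altC] [cD D1 altD]; have [pS _] := swap_poly hA.
have [pC pD] := (const_poly cC, const_poly cD).
apply: subr0_eq; apply: functional_extensionality_dep => -[|[|d]].
- by rewrite -[LHS]/(C 0%N - D 0%N) (proj1 cC) (proj1 cD) subrr.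
- by rewrite -[LHS]/(C 1%N - D 1%N) C1 D1 subrr.
apply: const_alternil_finite => //.
- exact: polyB.
- apply: alternil_of_falternil => [|n].
    by rewrite -[LHS]/(C 0%N - D 0%N) (proj1 cC) (proj1 cD) subrr.
  have -> : C - D = swap A + C - (swap A + D) by rewrite opprD addrACA subrr add0r.
  by apply: falternil_evB; try apply: polyD => //; apply: falternil_ev => //; apply: polyD.
move=> k _; have [c hc] := proj2 cC k; have [c' hc'] := proj2 cD k.
by exists (c - c'); rewrite rmorphB /= -hc -hc'.
Qed.

Lemma corr_const_ex A : ARI_pol_al_il A -> exists! C, corr_const A C.
Proof.
move=> [[[hA A0 _] _] _ [C cC altC] _ _].
have [pS _] := swap_poly hA; have pC := const_poly cC.
(* Alternility is a condition in depth at least 2, so the constant in depth 1 can be replaced by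
   0. *)
pose C' : bimould R := fun d => if d is 1%N then 0 else C d.
have cC' : const_mould C'.
  split=> [|[|[|d]]]; [by case: cC | by apply: (proj2 cC) | | by apply: (proj2 cC)].
  by exists 0; rewrite rmorph0.
have corrC' : corr_const A C'.
  split=> //; apply: alternil_of_falternil => [|n].
    by case: altC => h _; rewrite -h.
  have pC' := const_poly cC'.
  have := falternil_ev (n := n) (polyD pS pC) altC.
  have fE : falternil (@ev R n (C - C')).
    have cE : fconst (@ev R n (C - C')).
      by move=> w w' e; rewrite !ev_B // (const_fconst cC e) (const_fconst cC' e).
    move=> x y _ nx ny; rewrite stsum_vfree; last exact: fconst_vfree.
    apply: shsum_fconst => // z sz; apply: ev_eq0; rewrite sz.
    case: x y nx ny {sz} => [|? x] [|? y] // _ _; rewrite /= addnS /=.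
    exact: subrr.
  move=> aM; have := falternil_evB (polyD pS pC) (polyB pC pC') aM fE.
  by rewrite opprB [C' - C]addrC addrA addrK.
by exists C'; split=> // D hD; apply: corr_const_uniq corrC' hD.
Qed.

Lemma corrP A : ARI_pol_al_il A -> corr_const A (corr A).
Proof.
move=> /corr_const_ex[C [hC _]]; rewrite /corr; case: xgetP => // /(_ C) //.
Qed.

Lemma corrE A C : ARI_pol_al_il A -> corr_const A C -> corr A = C.
Proof.
move=> hA hC; apply: (@corr_const_uniq A) => //; last exact: corrP.
by case: hA => -[[]].
Qed.

End Model.

(** * The map iota *)

Section IlPart.
Variable K : comUnitRingType.
Local Notation word := (seq (K * K)).
Implicit Types (A B C M N : word -> K).

Lemma falternil_linear k M N : falternil M -> falternil N ->
  falternil (fun z => k * M z + N z).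
Proof.
move=> hM hN x y hP nx ny; rewrite stsumD (hN x y) // addr0.
by rewrite -[RHS](mulr0 k) -(hM x y) // /stsum big_distrr; apply: eq_bigr => t _;
  rewrite mulrCA.
Qed.

Lemma falternal_linear k M N : falternal xpredT M -> falternal xpredT N ->
  falternal xpredT (fun z => k * M z + N z).
Proof.
by move=> hM hN x y _ nx ny; rewrite shsumD shsumM hM // hN // mulr0 addr0.
Qed.

Lemma der_scale N N' M k w :
  der (fun z => k * N z) (fun z => k * N' z) M w = k * der N N' M w.
Proof.
elim: w M => [|l w IH] M; first by rewrite mulr0.
rewrite !der_cons IH.
under eq_cuts => b c _ do rewrite -mulrA.
under eq_cutl => b m c _ do rewrite -mulrA.
by rewrite cutsM cutlM; ring.
Qed.

Lemma fmulMl k M N w : fmul (fun z => k * M z) N w = k * fmul M N w.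
Proof. by rewrite /fmul -cutsM; apply: eq_cuts => a b _; rewrite mulrA. Qed.

Lemma fmulMr k M N w : fmul M (fun z => k * N z) w = k * fmul M N w.
Proof. by rewrite /fmul -cutsM; apply: eq_cuts => a b _; rewrite mulrCA. Qed.

Lemma fari_linearl k A B C w :
  fari (fun z => k * A z + B z) C w = k * fari A C w + fari B C w.
Proof.
rewrite /fari /flie derD derM derDN der_scale !fmulDl !fmulDr !fmulMl !fmulMr; ring.
Qed.

(** By [subst_fari] the image of H under G is a bracket of alternal functions, hence alternal, and
    [falternil_of_subst] makes H alternil. The summand [fari M N] of H is alternal in the u's alone,
    so it is alternil too and can be subtracted. *)
Lemma falternil_il_part M M' N N' : al_il M M' -> al_il N N' ->
  falternal xpredT M -> falternal xpredT N -> falternil (il_part M' N').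
Proof.
move=> hM hN aM aN.
pose H z := fari M N z + il_part M' N' z.
have X0 A A' : al_il A A' -> subst chain (fun z => A z + A' z) [::] = 0.
  by move=> [_ A0 _ A'0 _ _ _]; rewrite subst_nil A0 A'0 addr0.
have aX A A' : al_il A A' -> falternal xpredT A ->
    falternal pdiff (subst chain (fun z => A z + A' z)).
  move=> [vA _ _ _ altA' _ _] altA; apply: falternal_subst.
  by apply: falternilD => //; apply: falternil_vfree.
have aH : falternal pdiff (subst chain H).
  move=> x y hP nx ny.
  rewrite (eq_shsum_perm (F' := fari (subst chain (fun z => M z + M' z))
      (subst chain (fun z => N z + N' z)))) => [|z hz].
    apply: (falternal_fari (@pdiff_perm K) (@pdiff_sub K)) => //; try exact: X0.
    - exact: falternal_shv (aX _ _ hM aM).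
    - exact: falternal_shv (aX _ _ hN aN).
    - exact: aX.
    - exact: aX.
  by rewrite subst_fari //; apply: pdiff_perm hP; rewrite perm_sym.
have [vM M0 _ _ _ _ _] := hM; have [vN N0 _ _ _ _ _] := hN.
have -> : il_part M' N' = fun z => H z - fari M N z.
  by apply: funext => z; rewrite /H addrC addKr.
apply: falternilB; first exact: falternil_of_subst.
by apply: falternil_vfree; [apply: vfree_fari | apply: falternal_fari_vfree].
Qed.

End IlPart.

Lemma lie_algebra_image (R : comNzRingType) (V : lmodType R) (L : set V)
    (br br' : V -> V -> V) (f : V -> V) : lie_algebra L br ->
  (forall k x y, L x -> L y -> f (k *: x + y) = k *: f x + f y) ->
  (forall x y, L x -> L y -> f (br x y) = br' (f x) (f y)) ->
  lie_algebra [set f x | x in L]%classic br'.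
Proof.
move=> [[L0 Llin] Lbr bil alt jac] flin fbr.
have f0 : f 0 = 0.
  have := flin 1 0 0 L0 L0; rewrite !scale1r addr0 => /eqP.
  by rewrite -[X in X == _]addr0 (inj_eq (addrI _)) eq_sym => /eqP.
have LD x y : L x -> L y -> L (x + y) by move=> /(Llin 1 x y); rewrite scale1r.
have fD x y : L x -> L y -> f (x + y) = f x + f y.
  by move=> Lx Ly; have := flin 1 x y Lx Ly; rewrite !scale1r.
split.
- split; first by exists 0.
  by move=> k _ _ [x Lx <-] [y Ly <-]; exists (k *: x + y); [apply: Llin | apply: flin].
- by move=> _ _ [x Lx <-] [y Ly <-]; exists (br x y); [apply: Lbr | apply: fbr].
- move=> k _ _ _ [x Lx <-] [y Ly <-] [z Lz <-].
  have [e1 e2] := bil k x y z Lx Ly Lz; have Lxy := Llin k x y Lx Ly.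
  rewrite -flin // -!fbr // e1 e2.
  by split; apply: flin; apply: Lbr.
- by move=> _ [x Lx <-]; rewrite -fbr // alt.
- move=> _ _ _ [x Lx <-] [y Ly <-] [z Lz <-].
  have [Lxy Lyz Lzx] := And3 (Lbr _ _ Lx Ly) (Lbr _ _ Ly Lz) (Lbr _ _ Lz Lx).
  rewrite -!fbr // -!fD ?jac //; do ?by apply: Lbr.
  by apply: LD; apply: Lbr.
Qed.

(** * The image of iota and its Lie bracket *)

Section Iota.
Variable R : comAlgType rat.
Local Notation word n := (seq (ratfun R n * ratfun R n)).
Implicit Types (A B C : bimould R).

Let S : bimould R -> Prop := @ARI_pol_al_il R.

Lemma al_il_poly A : S A -> polynomial A.
Proof. by case=> [[[]]]. Qed.

Lemma al_il_vfree A n : S A -> vfree (@ev R n A).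
Proof. by case=> h _ _ _ _; apply: ARI_pol_vfree. Qed.

Lemma al_il_falternal A n : S A -> falternal xpredT (@ev R n A).
Proof. by move=> hA; apply: falternal_ev (al_il_poly hA) _; case: hA. Qed.

Lemma al_il_0 A : S A -> A 0%N = 0.
Proof. by case=> [[[]]]. Qed.

Lemma swap_corr_poly A : S A -> polynomial (swap A + corr A).
Proof.
move=> hA; apply: polyD; first by case: (swap_poly (al_il_poly hA)).
by apply: const_poly; case: (corrP hA).
Qed.

Lemma al_il_model A n : S A -> al_il (@ev R n A) (@ev R n (swap A + corr A)).
Proof. by move=> hA; case: (hA) => ? ? _ ? _; apply: al_il_ev => //; apply: corrP. Qed.

Lemma iotaE A : iota_al_il A = A + (swap A + corr A).
Proof. by rewrite /iota_al_il addrA. Qed.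

Lemma iota_poly A : S A -> polynomial (iota_al_il A).
Proof.
by move=> hA; rewrite iotaE; apply: polyD; [apply: al_il_poly | apply: swap_corr_poly].
Qed.

Lemma ev_iota A n : S A ->
  @ev R n (iota_al_il A) = fun w => ev A w + ev (swap A + corr A) w.
Proof.
move=> hA; apply: funext => w; rewrite iotaE ev_D //.
  exact: al_il_poly.
exact: swap_corr_poly.
Qed.

Lemma iota_falternil A n : S A -> falternil (@ev R n (iota_al_il A)).
Proof.
move=> hA; rewrite ev_iota //; have [vA _ _ _ hM _ _] := al_il_model n hA.
apply: falternilD; last exact: hM.
by apply: falternil_vfree; [apply: vA | apply: al_il_falternal].
Qed.

Lemma swap_eq0 A d : A d = 0 -> swap A d = 0.
Proof. by move=> h; apply: ev_eq0; rewrite size_swap_word size_gword. Qed.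

Lemma iota_0 A : S A -> iota_al_il A 0%N = 0.
Proof.
move=> hA; rewrite -[LHS]/(A 0%N + swap A 0%N + corr A 0%N).
have [[c0 _] _ _] := corrP hA.
by rewrite c0 (swap_eq0 (al_il_0 hA)) (al_il_0 hA) !addr0.
Qed.

(** In depths where A vanishes only the constants remain, and [const_alternil_finite] makes them
    vanish as well. *)
Lemma iota_finite A : S A -> exists N, forall d, (N <= d)%N -> iota_al_il A d = 0.
Proof.
move=> hA; have [[[_ _ [N hN]] _] _ _ _ _] := hA.
have [cC C1 alt] := corrP hA.
(* The vanishing lemma concerns depth d + 1 with d positive, whence the successor and the maximum
   with 1. *)
exists (maxn N 1).+1 => -[|d] //; rewrite ltnS geq_max => /andP[Nd d0].
have sE k : (N <= k)%N -> (swap A + corr A) k = corr A k.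
  by move=> hk; rewrite -[LHS]/(swap A k + corr A k) swap_eq0 ?add0r ?hN.
rewrite iotaE -[LHS]/(A d.+1 + (swap A + corr A) d.+1) hN ?add0r; last exact: leqW.
apply: (const_alternil_finite (swap_corr_poly hA) alt _ d0) => k hk.
by rewrite sE; [case: cC => _; apply | apply: leq_trans hk].
Qed.

Lemma iota_swap A : S A -> swap (iota_al_il A) = iota_al_il A.
Proof.
move=> hA; have pI := iota_poly hA; have [pS eS] := swap_poly pI.
have pA := al_il_poly hA; have [pSA eSA] := swap_poly pA.
have [cC _ _] := corrP hA; have pC := const_poly cC.
apply: poly_eq => // n w; rewrite eS !ev_iota // !ev_D // !eSA.
rewrite (al_il_vfree hA (swap_wordK1 w)) addrCA; congr (_ + (_ + _)).
by apply: const_fconst => //; rewrite size_swap_word.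
Qed.

Lemma iota_even A : S A -> even1 (iota_al_il A).
Proof.
move=> hA; have [polA altA _ evenA _] := hA; have pA := al_il_poly hA.
have := even1_swap polA altA evenA (corrP hA).
move/(even1_feven (swap_corr_poly hA)) => eS.
apply: (feven_even1 (iota_poly hA)) => n l; rewrite (ev_iota n hA).
by rewrite (even1_feven pA evenA) eS.
Qed.

Lemma iota_BARI A : S A -> BARI_pol_il_swap (iota_al_il A).
Proof.
move=> hA; split.
- by split; [apply: iota_poly | apply: iota_0 | apply: iota_finite].
- apply: alternil_of_falternil (iota_0 hA) _ => n; exact: iota_falternil.
- exact: iota_swap.
- exact: iota_even.
Qed.

Lemma ev_ari A B n (w : word n) : S A -> S B -> ev (ari A B) w = fari (ev A) (ev B) w.
Proof.
move=> hA hB; have p C : S C -> nice (@Pall R) C by move=> hC; apply: poly_nice; apply: al_il_poly.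
have [_ h] := @ari_nice R (@Pall R) (fun _ _ _ _ _ => isT) (fun _ _ _ _ => isT)
  (fun=> isT) _ _ (p _ hA) (p _ hB) (al_il_0 hA) (al_il_0 hB).
exact: h.
Qed.

(** Both sides are [fari] of A and B on the reversed differences of the v's, by [swap_word_steps]
    and [il_part_swap]. *)
Lemma ev_swap_ari A B n (w : word n) : S A -> S B ->
  ev (swap (ari A B)) w = il_part (ev (swap A + corr A)) (ev (swap B + corr B)) w.
Proof.
move=> hA hB; have pG := ari_poly (al_il_poly hA) (al_il_poly hB).
have [_ ->] := swap_poly pG; rewrite ev_ari //.
have sE C : S C -> @ev R n (swap C + corr C) = swap_part (@ev R n C) (@ev R n (corr C)).
  move=> hC; apply: funext => z; case: (corrP hC) => cC _ _.
  by apply: ev_swap_part; [apply: al_il_poly | | apply: al_il_vfree | case: hC].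
have [[cA _ _] [cB _ _]] := (corrP hA, corrP hB).
have [vA vB] := (al_il_vfree (n := n) hA, al_il_vfree (n := n) hB).
have nil C : C 0%N = 0 -> ev C ([::] : word n) = 0 by apply: ev_nil0.
have key M N : M = swap_part (ev A) (ev (corr A)) -> N = swap_part (ev B) (ev (corr B)) ->
    fari (ev A) (ev B) (swap_word w) = il_part M N w.
  move=> -> ->; rewrite (il_part_swap w vA vB (nil _ (al_il_0 hA)) (nil _ (al_il_0 hB))
    (nil _ (proj1 cA)) (nil _ (proj1 cB)) (const_fconst cA) (const_fconst cB)
    (al_il_falternal hA) (al_il_falternal hB)).
  by apply: (vfree_fari vA vB); rewrite swap_word_steps /unzip1 map_rev.
exact: key (sE _ hA) (sE _ hB).
Qed.

(** The swap of the bracket is [il_part], which is alternil as it stands; therefore its constant is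
    0. *)
Lemma ari_al_il A B : S A -> S B -> S (ari A B) /\ corr_const (ari A B) 0.
Proof.
move=> hA hB; have pG := ari_poly (al_il_poly hA) (al_il_poly hB).
have G0 : ari A B 0%N = 0.
  rewrite -(ev_poly_gword 0 pG) ev_ari //.
  by rewrite (size0nil (size_gword R 0)) fari_nil.
have G1 n l : ev (ari A B) ([:: l] : word n) = 0.
  by rewrite ev_ari // fari_letter //; apply: ev_nil0; apply: al_il_0.
have G1' : ari A B 1%N = 0 by rewrite -(ev_poly_gword 1 pG) gword1 G1.
have c0 : const_mould (0 : bimould R) by split=> // d; exists 0; rewrite rmorph0.
have alt : alternil (swap (ari A B) + 0).
  rewrite addr0; apply: alternil_of_falternil => [|n]; first exact: swap_eq0.
  have -> : @ev R n (swap (ari A B)) =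
      il_part (ev (swap A + corr A)) (ev (swap B + corr B)).
    by apply: funext => w; apply: ev_swap_ari.
  by apply: (falternil_il_part (al_il_model n hA) (al_il_model n hB));
    apply: al_il_falternal.
split; last by split.
split.
- split; last first.
    apply: vfree_umould => // n w w' e; rewrite !ev_ari //.
    by apply: vfree_fari e; apply: al_il_vfree.
  split=> //; have [[[_ _ [N hN]] _] _ _ _ _] := hA.
  have [[[_ _ [N' hN']] _] _ _ _ _] := hB; exists (N + N')%N => d hd.
  rewrite -(ev_poly_gword d pG) ev_ari // (fari_size (n := N) (n' := N')) //.
  + by move=> z hz; apply: ev_eq0; apply: hN.
  + by move=> z hz; apply: ev_eq0; apply: hN'.
  + by rewrite size_gword.
- apply: alternal_of_falternal => // n.
  have -> : @ev R n (ari A B) = fari (ev A) (ev B) by apply: funext => w; apply: ev_ari.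
  apply: falternal_fari_vfree; try exact: al_il_vfree; try exact: al_il_falternal;
    by apply: ev_nil0; apply: al_il_0.
- by exists 0.
- by apply: (feven_even1 pG) => n l; rewrite !G1.
- by exists 0; rewrite ?mcoeff0 // rmorph0.
Qed.

Lemma ev_iota_ari A B n (w : word n) : S A -> S B -> ev (iota_al_il (ari A B)) w =
  fari (ev A) (ev B) w + il_part (ev (swap A + corr A)) (ev (swap B + corr B)) w.
Proof.
move=> hA hB; have [hG cG] := ari_al_il hA hB.
have pG := al_il_poly hG; have [pS _] := swap_poly pG.
rewrite iotaE (corrE hG cG) addr0 (ev_D w pG pS).
exact: congr2 (ev_ari w hA hB) (ev_swap_ari w hA hB).
Qed.

Lemma iota_ari A B : S A -> S B ->
  iota_al_il (ari A B) = uri (iota_al_il A) (iota_al_il B).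
Proof.
move=> hA hB; have [hG cG] := ari_al_il hA hB.
have pI C : S C -> nice (@Pdiff R) (iota_al_il C).
  by move=> hC; apply: poly_nice; apply: iota_poly.
have [nA eA] := ganit_poc_nice (pI _ hA); have [nB eB] := ganit_poc_nice (pI _ hB).
have g0 C : S C -> ganit (poc R) (iota_al_il C) 0%N = 0.
  move=> hC; have [nC eC] := ganit_poc_nice (pI _ hC).
  rewrite -(ev_gword (d := 0) nC (Pdiff_gword R 0)) (size0nil (size_gword R 0)).
  by rewrite eC // subst_nil ev_nil0 // iota_0.
have [nL eL] := ari_nice (@Pdiff_sub R) (@Pdiff_shv R) (@Pdiff_gword R) nA nB
  (g0 _ hA) (g0 _ hB).
have [nU eU] := ganit_pic_nice nL.
apply: (nice_eq (pI _ hG) nU (@Pdiff_gword R)) => d.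
have hw := Pdiff_gword R d; rewrite (eU _ _ hw).
pose H w := fari (ev A) (ev B) w
  + il_part (ev (swap A + corr A)) (ev (swap B + corr B)) (w : word (d + d)).
(* By [substK] the left-hand side is the inverse of G applied to G(H), so it suffices to compare
   G(H) with the ari bracket on the words z. *)
rewrite (ev_iota_ari _ hA hB) -[LHS](substK H hw); apply: eq_subst_in => z sz.
have hz : pdiff z by apply: pdiff_sub hw.
rewrite (eL _ _ hz) (eq_fari_in hz (eA _) (eB _)).
have key M N : M = (fun w => ev A w + ev (swap A + corr A) w) ->
    N = (fun w => ev B w + ev (swap B + corr B) w) ->
    subst chain H z = fari (subst chain M) (subst chain N) z.
  move=> -> ->; symmetry.
  exact: (subst_fari (al_il_model _ hA) (al_il_model _ hB) hz).
exact: (key _ _ (ev_iota _ hA) (ev_iota _ hB)).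
Qed.

Lemma swap_linear k A B : polynomial A -> polynomial B ->
  swap (k *: A + B) = k *: swap A + swap B.
Proof.
move=> hA hB; apply: functional_extensionality_dep => d.
by rewrite /swap ev_D ?evZ //; apply: polyZ.
Qed.

Lemma ev_linear k A B n : polynomial A -> polynomial B ->
  @ev R n (k *: A + B) = fun w => rcst n k * ev A w + ev B w.
Proof. by move=> hA hB; apply: funext => w; rewrite ev_D ?evZ //; apply: polyZ. Qed.

Lemma al_il_linear k A B : S A -> S B ->
  S (k *: A + B) /\ corr_const (k *: A + B) (k *: corr A + corr B).
Proof.
move=> hA hB; have [pA pB] := (al_il_poly hA, al_il_poly hB).
have p : polynomial (k *: A + B) by apply: polyD => //; apply: polyZ.
have valE (M N : bimould R) d : (k *: M + N) d = rcst (d + d) k * M d + N d by [].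
have [[cA A1 altA] [cB B1 altB]] := (corrP hA, corrP hB).
have [qA qB] := (swap_corr_poly hA, swap_corr_poly hB).
have corrC : corr_const (k *: A + B) (k *: corr A + corr B).
  split.
  - split=> [|d]; first by rewrite valE (proj1 cA) (proj1 cB) mulr0 addr0.
    have [a ha] := proj2 cA d; have [b hb] := proj2 cB d.
    by exists (k * a + b); rewrite valE ha hb rmorphD rmorphM.
  - by rewrite valE A1 B1 mulr0 addr0.
  - rewrite swap_linear // addrACA -scalerDr; apply: alternil_of_falternil => [|n].
      by rewrite valE (proj1 altA) (proj1 altB) mulr0 addr0.
    have hk := falternil_linear (rcst n k) (falternil_ev qA altA) (falternil_ev qB altB).
    by rewrite (ev_linear k n qA qB).
split=> //.
have [polA aA _ eA [a ha a0]] := hA; have [polB aB _ eB [b hb b0]] := hB.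
have [[_ A0 [N hN]] _] := polA; have [[_ B0 [N' hN']] _] := polB.
have AB0 : (k *: A + B) 0%N = 0 by rewrite valE A0 B0 mulr0 addr0.
split.
- split; last first.
    apply: vfree_umould => // n w w' e.
    by rewrite (ev_linear k n pA pB) (al_il_vfree hA e) (al_il_vfree hB e).
  split=> //; exists (maxn N N') => d; rewrite geq_max => /andP[hd hd'].
  by rewrite valE hN // hN' // mulr0 addr0.
- apply: (alternal_of_falternal AB0) => n; rewrite (ev_linear k n pA pB).
  by apply: falternal_linear; apply: al_il_falternal.
- by exists (k *: corr A + corr B); case: corrC.
- apply: (feven_even1 p) => n l; rewrite (ev_linear k n pA pB).
  by rewrite (even1_feven pA eA) (even1_feven pB eB).
- exists (k%:MP * a + b); first by rewrite valE ha hb rmorphD rmorphM.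
  by rewrite mcoeffD mcoeffCM a0 b0 mulr0 addr0.
Qed.

Lemma iota_linear k A B : S A -> S B ->
  iota_al_il (k *: A + B) = k *: iota_al_il A + iota_al_il B.
Proof.
move=> hA hB; have [hAB cAB] := al_il_linear k hA hB.
rewrite /iota_al_il (corrE hAB cAB) swap_linear; try exact: al_il_poly.
by rewrite !scalerDr (addrACA (k *: A)) [LHS]addrACA.
Qed.

Lemma al_il_zero : S 0.
Proof.
have p0 : polynomial (0 : bimould R) by move=> d; exists 0; rewrite rmorph0.
have e0 n : @ev R n 0 = fun=> 0 by apply: funext => w; apply: ev_eq0.
have c0 : const_mould (0 : bimould R) by split=> // d; exists 0; rewrite rmorph0.
split.
- split; first by split=> //; exists 0%N.
  by apply: vfree_umould => // n w w' _; rewrite e0.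
- by apply: alternal_of_falternal => // n x y _ _ _; rewrite e0 /shsum big1.
- exists 0 => //; rewrite addr0.
  apply: alternil_of_falternil => [|n x y _ _ _]; first exact: swap_eq0.
  rewrite [ev _](_ : _ = fun=> 0); last by apply: funext => w; rewrite (proj2 (swap_poly p0)) e0.
  by rewrite /stsum big1 // => t _; rewrite mulr0.
- by apply: (feven_even1 p0) => n l; rewrite e0.
- by exists 0; rewrite ?mcoeff0 // rmorph0.
Qed.

Lemma ari_linearl k A B C : S A -> S B -> S C ->
  ari (k *: A + B) C = k *: ari A C + ari B C.
Proof.
move=> hA hB hC; have [hAB _] := al_il_linear k hA hB.
have [pA pB pC] := And3 (al_il_poly hA) (al_il_poly hB) (al_il_poly hC).
apply: poly_eq => [||n w].
- exact: ari_poly (al_il_poly hAB) pC.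
- by apply: polyD; [apply: polyZ|]; apply: ari_poly.
rewrite (ev_ari w hAB hC) (ev_linear k n (ari_poly pA pC) (ari_poly pB pC)).
by rewrite (ev_ari w hA hC) (ev_ari w hB hC) (ev_linear k n pA pB) fari_linearl.
Qed.

Lemma ari_antisym A B : ari A B = - ari B A.
Proof.
have e (x y z t : bimould R) : x - y + (z - t) = - (y - x + (t - z)).
  by rewrite opprD !opprB.
exact: e.
Qed.

Lemma ari_linearr k A B C : S A -> S B -> S C ->
  ari C (k *: A + B) = k *: ari C A + ari C B.
Proof.
move=> hA hB hC; have [hAB _] := al_il_linear k hA hB.
by rewrite !(ari_antisym C) ari_linearl // opprD scalerN.
Qed.

Lemma ari_jacobi A B C : S A -> S B -> S C ->
  ari A (ari B C) + ari B (ari C A) + ari C (ari A B) = 0.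
Proof.
move=> hA hB hC.
have [[hAB _] [hBC _]] := (ari_al_il hA hB, ari_al_il hB hC).
have [hCA _] := ari_al_il hC hA.
have pp X Y : S X -> S Y -> polynomial (ari X Y).
  by move=> hX hY; apply: ari_poly; apply: al_il_poly.
have [p1 p2 p3] := And3 (pp _ _ hA hBC) (pp _ _ hB hCA) (pp _ _ hC hAB).
apply: poly_eq => [||n w]; first exact: polyD (polyD p1 p2) p3.
  by move=> d; exists 0; rewrite rmorph0.
have e X Y : S X -> S Y -> @ev R n (ari X Y) = fari (ev X) (ev Y).
  by move=> hX hY; apply: funext => z; apply: ev_ari.
rewrite [RHS]ev_eq0 // (ev_D w (polyD p1 p2) p3) (ev_D w p1 p2).
rewrite (e _ _ hA hBC) (e _ _ hB hCA) (e _ _ hC hAB) (e _ _ hB hC) (e _ _ hC hA).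
by rewrite (e _ _ hA hB) fari_jacobi //; apply: al_il_vfree.
Qed.

Lemma ari_lie_algebra : lie_algebra S (@ari R).
Proof.
split.
- by split=> [|k A B hA hB]; [exact: al_il_zero | case: (al_il_linear k hA hB)].
- by move=> A B hA hB; case: (ari_al_il hA hB).
- by move=> k A B C hA hB hC; split; [apply: ari_linearl | apply: ari_linearr].
- by move=> A _; rewrite /ari /lu !subrr addr0.
- exact: ari_jacobi.
Qed.

End Iota.

Theorem theorem1p1 (R : comAlgType rat) :
  (* iota is a well-defined map ARI_pol_al_il -> BARI_pol_il_swap *)
  (forall A : bimould R, ARI_pol_al_il A ->
     (exists! C : bimould R, corr_const A C) /\
     BARI_pol_il_swap (iota_al_il A)) /\
  (forall A B : bimould R, ARI_pol_al_il A -> ARI_pol_al_il B ->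
     ARI_pol_al_il (ari A B) /\
     iota_al_il (ari A B) = uri (iota_al_il A) (iota_al_il B)) /\
  lie_algebra [set iota_al_il A | A in @ARI_pol_al_il R]%classic (@uri R).
Proof.
split; last split; last first.
- apply: lie_algebra_image (ari_lie_algebra R) _ _ => [k A B|A B].
    exact: iota_linear.
  exact: iota_ari.
- by move=> A B hA hB; split; [case: (ari_al_il hA hB) | apply: iota_ari].
- by move=> A hA; split; [apply: corr_const_ex | apply: iota_BARI].
Qed.
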